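(* Let $\Bbbk$ be a field of characteristic zero and let $\mathcal{A}$ be a central arrangement of three lines (three distinct lines through the origin in a two-dimensional $\Bbbk$-vector space). The Hilbert series of the Hochschild cohomology $HH^\bullet(\mathsf{Diff}\,\mathcal{A})$ is $$h_{HH^\bullet(\mathsf{Diff}\,\mathcal{A})}(t) = 1 + 3t + 6t^2 + 4t^3.$$ Moreover, the first cohomology space $HH^1(\mathsf{Diff}\,\mathcal{A})$ is an abelian Lie algebra of dimension three.
   Context: Let $V$ be a two-dimensional $\Bbbk$-vector space, $S$ the algebra of polynomial functions on $V$, and let $Q\in S$ be a defining polynomial of $\mathcal{A}=\{H_1,H_2,H_3\}$, that is, $Q=\lambda_1\lambda_2\lambda_3$ with $\lambda_i:V\to\Bbbk$ a linear form with kernel $H_i$. The algebra $\mathsf{Diff}\,\mathcal{A}$ of differential operators tangent to $\mathcal{A}$ is the algebra of differential operators on $S$ which preserve the ideal $QS$ of $S$ and all its powers. Equivalently, it is the associative subalgebra of $\mathrm{End}_\Bbbk(S)$ generated by the left multiplications by elements of $S$ and by $\mathrm{Der}\,\mathcal{A}=\{\theta\in\mathrm{Der}_\Bbbk(S): \theta(Q)\in QS\}$. For an associative $\Bbbk$-algebra $A$, $A^e$ denotes the enveloping algebra $A\otimes A$ (whose modules are the $A$-bimodules), $HH^\bullet(A)=\mathrm{Ext}^\bullet_{A^e}(A,A)$, and its Hilbert series is $\sum_{i\ge0}\dim_\Bbbk HH^i(A)\,t^i$. The Lie algebra structure on $HH^1(A)$ is the one induced by the commutator of derivations under the identification of $HH^1(A)$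 with the space of derivations of $A$ modulo inner derivations. *)

(* Defs.v *)
From HB Require Import structures.
From mathcomp Require Import all_boot all_order all_algebra.
From mathcomp Require Import boolp classical_sets functions.

Set Implicit Arguments.
Unset Strict Implicit.
Unset Printing Implicit Defensive.

Import GRing.Theory.
Local Open Scope ring_scope.

Inductive is_polyfun (k : fieldType) (V : vectType k) : (V -> k) -> Prop :=
| polyfun_const (c : k) : is_polyfun (fun=> c)
| polyfun_lin (l : 'Hom(V, k^o)) : is_polyfun (fun v => l v)
| polyfun_add (f g : V -> k) :
    is_polyfun f -> is_polyfun g -> is_polyfun (fun v => f v + g v)
| polyfun_mul (f g : V -> k) :
    is_polyfun f -> is_polyfun g -> is_polyfun (fun v => f v * g v).

Record polyfun (k : fieldType) (V : vectType k) := Polyfun {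
  polyfun_val :> V -> k;
  polyfunP : `[< is_polyfun polyfun_val >] }.

Section PolyfunAlgebra.
Variables (k : fieldType) (V : vectType k).

Definition polyfun_pred : {pred V -> k} := fun f => `[< is_polyfun f >].

HB.instance Definition _ := [isSub for @polyfun_val k V].
HB.instance Definition _ := [Choice of polyfun V by <:].

Lemma polyfun_subring : subring_closed polyfun_pred.
Proof.
have opp f : is_polyfun f -> is_polyfun (fun v : V => - f v).
  move=> fP; have -> : (fun v => - f v) = (fun v => (fun=> -1) v * f v).
    by apply: funext => v; rewrite mulN1r.
  by apply: polyfun_mul => //; exact: polyfun_const.
split.
- exact/asboolP/polyfun_const.
- move=> f g /asboolP fP /asboolP gP; apply/asboolP.
  exact: polyfun_add fP (opp _ gP).
- by move=> f g /asboolP fP /asboolP gP; apply/asboolP; exact: polyfun_mul.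
Qed.

HB.instance Definition _ :=
  GRing.SubChoice_isSubComPzRing.Build (V -> k) polyfun_pred (polyfun V)
    polyfun_subring.

Lemma polyfun_oner_neq0 : 1 != 0 :> polyfun V.
Proof.
apply/eqP => /(congr1 (fun f : polyfun V => f 0)) /= /eqP.
by rewrite (negPf (oner_neq0 k)).
Qed.

HB.instance Definition _ :=
  GRing.PzSemiRing_isNonZero.Build (polyfun V) polyfun_oner_neq0.

Lemma polyfun_scale_subproof (a : k) (f : polyfun V) :
  `[< is_polyfun (fun v => a * f v) >].
Proof.
have /asboolP fP := polyfunP f; apply/asboolP.
exact: polyfun_mul (polyfun_const _ a) fP.
Qed.

Definition polyfun_scale (a : k) (f : polyfun V) : polyfun V :=
  Polyfun (polyfun_scale_subproof a f).

Lemma polyfun_scaleA a b f :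
  polyfun_scale a (polyfun_scale b f) = polyfun_scale (a * b) f.
Proof. by apply: val_inj; apply: funext => v /=; exact: mulrA. Qed.
Lemma polyfun_scale1 : left_id 1 polyfun_scale.
Proof. by move=> f; apply: val_inj; apply: funext => v; exact: mul1r. Qed.
Lemma polyfun_scaleDr : right_distributive polyfun_scale +%R.
Proof. by move=> a f g; apply: val_inj; apply: funext => v; exact: mulrDr. Qed.
Lemma polyfun_scaleDl f : {morph polyfun_scale^~ f : a b / a + b}.
Proof. by move=> a b; apply: val_inj; apply: funext => v; exact: mulrDl. Qed.

HB.instance Definition _ :=
  GRing.Zmodule_isLmodule.Build k (polyfun V)
    polyfun_scaleA polyfun_scale1 polyfun_scaleDr polyfun_scaleDl.

Lemma polyfun_scaleAl (a : k) (f g : polyfun V) : a *: (f * g) = (a *: f) * g.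
Proof. by apply: val_inj; apply: funext => v; exact: mulrA. Qed.

HB.instance Definition _ :=
  GRing.Lmodule_isLalgebra.Build k (polyfun V) polyfun_scaleAl.
HB.instance Definition _ := GRing.Lalgebra_isComAlgebra.Build k (polyfun V).

Definition linform (l : 'Hom(V, k^o)) : polyfun V :=
  Polyfun (asboolT (polyfun_lin l)).

End PolyfunAlgebra.

(* Grothendieck's filtration: [diffop_lt n D] says that [D] has order less
   than [n], i.e. that all its [n]-fold commutators with multiplications by
   elements of [S] vanish. *)
Fixpoint diffop_lt (S : comNzRingType) (n : nat) (D : S -> S) : Prop :=
  if n is n'.+1
  then forall f : S, diffop_lt n' (fun g => D (f * g) - f * D g)
  else forall g : S, D g = 0.

Definition diffop (S : comNzRingType) (D : S -> S) : Prop :=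
  exists n, diffop_lt n D.

Definition preserves_powers (S : comNzRingType) (Q : S) (D : S -> S) : Prop :=
  forall (m : nat) (g : S), exists h : S, D (Q ^+ m * g) = Q ^+ m * h.

Definition is_tangent_diffop (k : fieldType) (S : comAlgType k) (Q : S)
    (D : S -> S) : Prop :=
  [/\ linear D, diffop D & preserves_powers Q D].

Record Diff (k : fieldType) (S : comAlgType k) (Q : S) := MkDiff {
  Diff_val :> S -> S;
  DiffP : `[< is_tangent_diffop Q Diff_val >] }.

Section DiffAlgebra.
Variables (k : fieldType) (S : comAlgType k) (Q : S).
Implicit Types D E : S -> S.

Lemma diffop_lt_ext n D E : D =1 E -> diffop_lt n D -> diffop_lt n E.
Proof. by move=> /funext ->. Qed.

Lemma diffop_lt0 n : diffop_lt n (fun=> 0 : S).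
Proof.
elim: n => //= n IHn f; apply: diffop_lt_ext IHn => g /=.
by rewrite mulr0 subr0.
Qed.

Lemma diffop_ltS n D : diffop_lt n D -> diffop_lt n.+1 D.
Proof.
elim: n D => [|n IHn] D; last by move=> /= DP f; exact: IHn (DP f).
by move=> /= DP f g; rewrite !DP mulr0 subr0.
Qed.

Lemma diffop_lt_leq m n D : (m <= n)%N -> diffop_lt m D -> diffop_lt n D.
Proof.
move=> /subnKC <- DP; elim: (n - m)%N => [|p IHp]; first by rewrite addn0.
by rewrite addnS; exact: diffop_ltS.
Qed.

Lemma diffop_lt_lin n (a : k) D E :
  diffop_lt n D -> diffop_lt n E -> diffop_lt n (fun g => a *: D g + E g).
Proof.
elim: n D E => [|n IHn] D E /= DP EP.
  by move=> g; rewrite DP EP scaler0 addr0.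
move=> f; have := IHn _ _ (DP f) (EP f); apply: diffop_lt_ext => g /=.
by rewrite mulrDr scalerBr scalerAr opprD addrACA.
Qed.

Lemma linear0_subproof D : linear D -> D 0 = 0.
Proof. by move=> /(_ (-1) 0 0); rewrite scaler0 add0r scaleN1r addNr. Qed.

Lemma linearB_subproof D : linear D -> {morph D : x y / x - y}.
Proof. by move=> lD x y; rewrite -[- y]scaleN1r addrC lD scaleN1r addrC. Qed.

Lemma linear_commutator_subproof (f : S) D :
  linear D -> linear (fun g => D (f * g) - f * D g).
Proof.
move=> lD a x y; rewrite mulrDr -scalerAr !lD mulrDr -scalerAr scalerBr.
by rewrite opprD addrACA.
Qed.

Lemma diffop_lt_comp m n D E : linear D -> linear E ->
  diffop_lt m D -> diffop_lt n E -> diffop_lt (m + n) (D \o E).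
Proof.
have [p] := ubnP (m + n); elim: p m n D E => // p IHp [|m] [|n] D E ltp lD lE.
- by move=> DP _ g; exact: DP.
- by move=> DP _; apply: diffop_lt_ext (diffop_lt0 _) => g /=; rewrite DP.
- move=> _ EP; apply: diffop_lt_ext (diffop_lt0 _) => g /=.
  by rewrite EP linear0_subproof.
move=> DP EP; rewrite addSn => f.
pose D' g := D (f * g) - f * D g; pose E' g := E (f * g) - f * E g.
have lD' : linear D' by exact: linear_commutator_subproof.
have lE' : linear E' by exact: linear_commutator_subproof.
have H1 : diffop_lt (m + n.+1) (D \o E').
  rewrite -addSnnS; apply: IHp => //; last exact: EP.
  by rewrite addSnnS -ltnS.
have H2 : diffop_lt (m + n.+1) (D' \o E).
  by apply: IHp => //; exact: DP.
have := diffop_lt_lin 1 H1 H2; apply: diffop_lt_ext => g /=.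
rewrite scale1r /D' /E' (linearB_subproof lD).
by rewrite [LHS]addrA subrK.
Qed.

Definition Diff_pred : {pred S -> S} := fun D => `[< is_tangent_diffop Q D >].

HB.instance Definition _ := [isSub for @Diff_val k S Q].
HB.instance Definition _ := [Choice of Diff Q by <:].

Lemma Diff_submod : submod_closed Diff_pred.
Proof.
split.
  apply/asboolP; split.
  - by move=> a x y /=; rewrite scaler0 addr0.
  - by exists 0%N.
  - by move=> m g; exists 0; rewrite mulr0.
move=> a D E /asboolP[lD [m DP] pD] /asboolP[lE [n EP] pE].
apply/asboolP; split.
- move=> b x y /=; rewrite [LHS]/(a *: D (b *: x + y) + E (b *: x + y)).
  rewrite [RHS]/(b *: (a *: D x + E x) + (a *: D y + E y)) lD lE.
  rewrite !scalerDr !scalerA [b * a]mulrC.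
  exact: addrACA.
- exists (maxn m n); apply: diffop_lt_lin.
    exact: diffop_lt_leq (leq_maxl _ _) DP.
  exact: diffop_lt_leq (leq_maxr _ _) EP.
- move=> i g; have [h hE] := pD i g; have [h' h'E] := pE i g.
  exists (a *: h + h').
  by rewrite mulrDr -scalerAr -hE -h'E.
Qed.

HB.instance Definition _ :=
  GRing.SubChoice_isSubLmodule.Build k (S -> S) Diff_pred (Diff Q) Diff_submod.

Lemma Diff_linear (D : Diff Q) : linear D.
Proof. by have /asboolP[] := DiffP D. Qed.

Lemma Diff_id_subproof : `[< is_tangent_diffop Q (fun g : S => g) >].
Proof.
apply/asboolP; split=> //; first by exists 1%N => /= f g; rewrite subrr.
by move=> m g; exists g.
Qed.

Lemma Diff_comp_subproof (D E : Diff Q) :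
  `[< is_tangent_diffop Q (fun g => D (E g)) >].
Proof.
have /asboolP[lD [m DP] pD] := DiffP D; have /asboolP[lE [n EP] pE] := DiffP E.
apply/asboolP; split.
- by move=> a x y; rewrite lE lD.
- by exists (m + n)%N; exact: diffop_lt_comp.
- by move=> i g; have [h ->] := pE i g; exact: pD.
Qed.

Definition Diff_one : Diff Q := MkDiff Diff_id_subproof.

(* The product is the composition of operators; it is not the restriction of
   the pointwise product that [S -> S] carries canonically. *)
Definition Diff_mul (D E : Diff Q) : Diff Q := MkDiff (Diff_comp_subproof D E).

Lemma Diff_mulA : associative Diff_mul.
Proof. by move=> D E F; exact: val_inj. Qed.
Lemma Diff_mul1 : left_id Diff_one Diff_mul.
Proof. by move=> D; exact: val_inj. Qed.
Lemma Diff_mulr1 : right_id Diff_one Diff_mul.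
Proof. by move=> D; exact: val_inj. Qed.
Lemma Diff_mulDl : left_distributive Diff_mul +%R.
Proof. by move=> D E F; exact: val_inj. Qed.
Lemma Diff_mulDr : right_distributive Diff_mul +%R.
Proof.
move=> D E F; apply: val_inj; apply: funext => g.
have := Diff_linear D 1 (E g) (F g); rewrite !scale1r; exact.
Qed.
Lemma Diff_one_neq0 : Diff_one != 0.
Proof.
apply/eqP => /(congr1 (fun D : Diff Q => D 1)) /= /eqP.
by rewrite (negPf (oner_neq0 S)).
Qed.

HB.instance Definition _ :=
  GRing.Zmodule_isNzRing.Build (Diff Q)
    Diff_mulA Diff_mul1 Diff_mulr1 Diff_mulDl Diff_mulDr Diff_one_neq0.

Lemma Diff_scaleAl (a : k) (D E : Diff Q) : a *: (D * E) = (a *: D) * E.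
Proof. exact: val_inj. Qed.

HB.instance Definition _ :=
  GRing.Lmodule_isLalgebra.Build k (Diff Q) Diff_scaleAl.

Lemma Diff_scaleAr (a : k) (D E : Diff Q) : a *: (D * E) = D * (a *: E).
Proof.
apply: val_inj; apply: funext => g.
have := Diff_linear D a (E g) 0.
by rewrite !addr0 (linear0_subproof (Diff_linear D)) addr0; exact: esym.
Qed.

HB.instance Definition _ :=
  GRing.Lalgebra_isAlgebra.Build k (Diff Q) Diff_scaleAr.

End DiffAlgebra.

(* Left modules over the enveloping algebra [A (x) A^op].  The scalars act
   centrally: [c *: m = c%:A . m = m . c%:A] follows from the axioms. *)
Record bimodule (k : fieldType) (A : algType k) := Bimodule {
  bimod_sort :> lmodType k;
  lact : A -> bimod_sort -> bimod_sort;
  ract : bimod_sort -> A -> bimod_sort;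
  lact_linearl : forall m, linear (lact^~ m);
  lact_linearr : forall a, linear (lact a);
  ract_linearl : forall a, linear (ract^~ a);
  ract_linearr : forall m, linear (ract m);
  lact1 : forall m, lact 1 m = m;
  ract1 : forall m, ract m 1 = m;
  lactM : forall a b m, lact (a * b) m = lact a (lact b m);
  ractM : forall a b m, ract m (a * b) = ract (ract m a) b;
  lract : forall a b m, ract (lact a m) b = lact a (ract m b) }.

Definition bimod_hom (k : fieldType) (A : algType k) (M N : bimodule A)
    (f : M -> N) : Prop :=
  [/\ linear f,
      forall a m, f (lact a m) = lact a (f m) &
      forall m a, f (ract m a) = ract (f m) a].

Definition projective (k : fieldType) (A : algType k) (P : bimodule A) : Prop :=
  forall (M N : bimodule A) (g : M -> N) (f : P -> N),
    bimod_hom g -> (forall y, exists x, g x = y) -> bimod_hom f ->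
    exists2 h : P -> M, bimod_hom h & forall x, g (h x) = f x.

Section RegularBimodule.
Variables (k : fieldType) (A : algType k).

Definition regular_bimodule : bimodule A.
Proof.
exists (A : lmodType k) (fun a m : A => a * m) (fun m a : A => m * a).
- by move=> m c x y; rewrite mulrDl scalerAl.
- by move=> a c x y; rewrite mulrDr scalerAr.
- by move=> a c x y; rewrite mulrDl scalerAl.
- by move=> m c x y; rewrite mulrDr scalerAr.
- exact: mul1r.
- exact: mulr1.
- by move=> a b m; rewrite mulrA.
- by move=> a b m; rewrite mulrA.
- by move=> a b m; rewrite mulrA.
Defined.

End RegularBimodule.

Record proj_resolution (k : fieldType) (A : algType k) (M : bimodule A) :=
  ProjResolution {
  res_obj : nat -> bimodule A;
  res_diff : forall n, res_obj n.+1 -> res_obj n;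
  res_aug : res_obj 0 -> M;
  res_proj : forall n, projective (res_obj n);
  res_diff_hom : forall n, bimod_hom (@res_diff n);
  res_aug_hom : bimod_hom res_aug;
  res_aug_surj : forall m, exists x, res_aug x = m;
  res_exact0 : forall x, res_aug x = 0 <-> exists y, @res_diff 0 y = x;
  res_exactS : forall n x,
    @res_diff n x = 0 <-> exists y, @res_diff n.+1 y = x }.

Section Ext.
Variables (k : fieldType) (A : algType k) (M N : bimodule A).
Variable P : proj_resolution M.

Definition ext_cocycle (i : nat) : set (res_obj P i -> N) :=
  [set f | bimod_hom f /\ forall x, f (@res_diff _ _ _ P i x) = 0].

Definition ext_coboundary (i : nat) : set (res_obj P i -> N) :=
  match i with
  | 0 => [set f | forall x, f x = 0]
  | j.+1 => [set f | exists2 g : res_obj P j -> N,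
                       bimod_hom g & forall x, f x = g (@res_diff _ _ _ P j x)]
  end.

End Ext.

(* For subspaces [B] of [Z], the quotient [Z / B] has dimension [d]: the
   classes of [e] form a basis of it. *)
Definition quotient_dim (k : fieldType) (W : lmodType k) (Z B : set W)
    (d : nat) : Prop :=
  exists e : 'I_d -> W,
    (forall i, Z (e i)) /\
    (forall z, Z z ->
       exists! c : {ffun 'I_d -> k}, B (z - \sum_i c i *: e i)).

(* The dimension of the [i]-th cohomology of [Hom(P, N)] does not depend on the
   projective resolution [P] of [M]; it is required to be [d] for all of them. *)
Definition Ext_dim (k : fieldType) (A : algType k) (M N : bimodule A)
    (i d : nat) : Prop :=
  inhabited (proj_resolution M) /\
  forall P : proj_resolution M,
    quotient_dim (@ext_cocycle k A M N P i) (@ext_coboundary k A M N P i) d.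

Definition HH_dim (k : fieldType) (A : algType k) (i d : nat) : Prop :=
  Ext_dim (regular_bimodule A) (regular_bimodule A) i d.

Definition HH_hilbert_series (k : fieldType) (A : algType k)
    (h : {poly nat}) : Prop :=
  forall i, HH_dim A i (h`_i)%R.

Definition derivation (k : fieldType) (A : algType k) : set (A -> A) :=
  [set D | linear D /\ forall a b, D (a * b) = D a * b + a * D b].

Definition inner_derivation (k : fieldType) (A : algType k) : set (A -> A) :=
  [set D | exists a, forall b, D b = a * b - b * a].

Definition Lie_bracket (k : fieldType) (A : algType k) (D E : A -> A) : A -> A :=
  fun a => D (E a) - E (D a).

(* [HH^1(A)], as a Lie algebra, is [derivation A] modulo [inner_derivation A]
   with the bracket induced by [Lie_bracket]. *)
Definition HH1_Lie_dim (k : fieldType) (A : algType k) (d : nat) : Prop :=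
  quotient_dim (@derivation k A) (@inner_derivation k A) d.

Definition HH1_Lie_abelian (k : fieldType) (A : algType k) : Prop :=
  forall D E : A -> A, derivation D -> derivation E ->
    inner_derivation (Lie_bracket D E).

(* Main.v *)
Require Import Defs.
From HB Require Import structures.
From mathcomp Require Import all_boot all_order all_algebra.
From mathcomp Require Import boolp classical_sets functions.
From mathcomp Require Import ring.
Set Implicit Arguments.
Unset Strict Implicit.
Unset Printing Implicit Defensive.
Import GRing.Theory.
Local Open Scope ring_scope.

(* Choose coordinates in which the lines are x = 0, y = 0 and x + y = 0, and put
   E = x d/dx + y d/dy, D = y (x + y) d/dy.  A tangent operator preserves all
   powers of each of the three linear forms, so its last nonzero iterated
   commutator with x, the n-th one, is divisible by x^n; that of E^n is n! x^n,
   and subtracting a multiple of E^n lowers n.  An operator commuting with x is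
   treated in the same way with commutators with y, which are divisible by
   (y (x + y))^n, and powers of D.  Hence A is generated by x, y, D, E, with PBW
   basis x^i y^j D^p E^q.

   Let B be the subalgebra generated by x, y and D.  A Koszul complex resolves the
   bimodule A (x)_B A, and the cone of u |-> E u - u E on it resolves A.  Applying
   Hom(-, A) gives the cone of the weight operator ad_E - n on a complex C of
   length 3.  This operator is semisimple, so that only the weight-zero part C_0
   contributes: H^n = H^n(C_0) + H^(n-1)(C_0).  Its cochains are forms in x, y, D
   with coefficients in k[E]; commutators with x, y and D act on the coefficients
   through p(E) - p(E + 1), a surjective operator whose kernel is k, and an
   elimination gives the dimensions 1, 2, 4, 0 for H^*(C_0), hence 1, 3, 6, 4.

   In degree one this says that, modulo inner derivations, every derivation maps x
   and y to 0, D to a linear form in x, y and E to a constant; the brackets of such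
   derivations vanish. *)

(** * Resolutions and Ext *)

(** [A (x) A] is modelled by polynomials over [A] in four nested variables, one for each of [x],
    [y], [D], [E] in the right factor. The commutator with [x] taken in the middle of the tensor is
    then right multiplication by [x - X]; the same holds for [y], for [D] once the functions on both
    sides are identified, and for [E] once [B] is. Exactness thus comes down to the factor theorem,
    one variable at a time. What noncommutativity remains, [[D, y] = y^2 + x y], enters the Koszul
    differentials through two correction maps.

    The weight operator subtracts [n] in degree [n] because [[E, z] = z] for [z = x, y, D]: this
    makes it commute with the differentials. In the PBW basis it is diagonal with integral
    eigenvalues, and the nonzero ones are invertible in characteristic zero.

    Dimensions are demanded for every projective resolution, hence the comparison theorem. The Lie
    algebra is defined by derivations instead; a derivation is a 1-cocycle of the cone through its
    values on the four generators, and exactness of the resolution supplies a derivation with given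
    values. *)

Section QuotientDim.
Variable k : fieldType.

Definition subspace (W : lmodType k) (B : set W) : Prop :=
  B 0 /\ forall a u v, B u -> B v -> B (a *: u + v).

Lemma subspaceB (W : lmodType k) (B : set W) u v :
  subspace B -> B u -> B v -> B (u - v).
Proof. by move=> [_ BP] Bu Bv; rewrite addrC -scaleN1r; exact: BP. Qed.

Lemma subspaceD (W : lmodType k) (B : set W) u v :
  subspace B -> B u -> B v -> B (u + v).
Proof. by move=> [_ BP] Bu Bv; rewrite -[u]scale1r; exact: BP. Qed.

Lemma subspace_sum (W : lmodType k) (B : set W) (I : finType) (f : I -> W) :
  subspace B -> (forall i, B (f i)) -> B (\sum_i f i).
Proof.
move=> sB Bf; elim/big_ind: _ => //; first by case: sB.
by move=> u v; exact: subspaceD.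
Qed.

Lemma subspaceZ (W : lmodType k) (B : set W) a u :
  subspace B -> B u -> B (a *: u).
Proof. by move=> [B0 BP] Bu; rewrite -[a *: u]addr0; exact: BP. Qed.

Lemma linear_sumZ (W W' : lmodType k) (psi : W -> W') (I : finType)
    (c : I -> k) (e : I -> W) : linear psi ->
  psi (\sum_i c i *: e i) = \sum_i c i *: psi (e i).
Proof.
move=> lpsi.
pose H := GRing.isLinear.Build _ _ _ _ psi lpsi.
pose psiL : {linear W -> W'} := HB.pack psi H.
by rewrite (_ : psi = psiL) // linear_sum; apply: eq_bigr => i _; rewrite linearZ.
Qed.

Lemma linear_sub (W W' : lmodType k) (psi : W -> W') u v : linear psi ->
  psi (u - v) = psi u - psi v.
Proof. by move=> lpsi; rewrite addrC -scaleN1r lpsi scaleN1r addrC. Qed.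

(** The hypotheses say that [psi] induces an isomorphism of [Z / B] onto [Z' / B']. A basis of the
    target is lifted by choice; the lifts map back to it only modulo [B'], an error controlled by
    [Bdiff]. *)
Lemma quotient_dim_pull (W W' : lmodType k) (psi : W -> W')
    (Z B : set W) (Z' B' : set W') d :
  linear psi -> subspace Z -> subspace B' ->
  (forall z, Z z -> Z' (psi z)) ->
  (forall z', Z' z' -> exists2 z, Z z & B' (z' - psi z)) ->
  (forall b, B b -> B' (psi b)) ->
  (forall z, Z z -> B' (psi z) -> B z) ->
  quotient_dim Z' B' d -> quotient_dim Z B d.
Proof.
move=> lpsi sZ sB' ZZ' Zsurj BB' Binj [e' [Ze' e'P]].
have /choice [e eP] : forall i, exists z, Z z /\ B' (e' i - psi z).
  by move=> i; have [z Zz Bz] := Zsurj _ (Ze' i); exists z.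
exists e; split=> [i|z Zz]; first by have [] := eP i.
have Bdiff c : B' (\sum_i c i *: e' i - \sum_i c i *: psi (e i)).
  rewrite -sumrB; apply: subspace_sum => // i; rewrite -scalerBr.
  by apply: subspaceZ => //; have [] := eP i.
have [c [cP cU]] := e'P _ (ZZ' _ Zz).
exists c; split.
  apply: Binj.
    apply: subspaceB => //; apply: subspace_sum => // i.
    by apply: subspaceZ => //; have [] := eP i.
  rewrite linear_sub // linear_sumZ //.
  by have := subspaceD sB' cP (Bdiff c); rewrite addrA subrK.
move=> c2 /BB'; rewrite linear_sub // linear_sumZ // => c2P.
by apply: cU; have := subspaceB sB' c2P (Bdiff c2); rewrite opprB addrA subrK.
Qed.

Lemma quotient_dim_push (W W' : lmodType k) (phi : W' -> W)
    (Z B : set W) (Z' B' : set W') d :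
  linear phi -> subspace Z' -> subspace B ->
  (forall z', Z' z' -> Z (phi z')) ->
  (forall z, Z z -> exists2 z', Z' z' & B (z - phi z')) ->
  (forall b', B' b' -> B (phi b')) ->
  (forall z', Z' z' -> B (phi z') -> B' z') ->
  quotient_dim Z' B' d -> quotient_dim Z B d.
Proof.
move=> lphi sZ' sB ZZ Zsurj BB Binj [e [Ze eP]].
exists (phi \o e); split=> [i|z Zz]; first exact/ZZ/Ze.
have [z' Zz' Bz'] := Zsurj _ Zz; have [c [cP cU]] := eP _ Zz'.
have E c0 : \sum_i c0 i *: phi (e i) = phi (\sum_i c0 i *: e i).
  by rewrite linear_sumZ.
exists c; split.
  have := subspaceD sB Bz' (BB _ cP).
  by rewrite /= E (linear_sub _ _ lphi) addrA subrK.
move=> c2 /=; rewrite E => c2P; apply: cU; apply: Binj.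
  apply: subspaceB => //; apply: subspace_sum => // i; exact: subspaceZ.
rewrite (linear_sub _ _ lphi).
have := subspaceB sB c2P Bz'.
by rewrite opprB addrC addrA subrK.
Qed.

Lemma quotient_dim_prod (W1 W2 : lmodType k) (Z1 B1 : set W1) (Z2 B2 : set W2)
    d1 d2 : subspace Z1 -> subspace Z2 ->
  quotient_dim Z1 B1 d1 -> quotient_dim Z2 B2 d2 ->
  quotient_dim (W := (W1 * W2)%type) [set z | Z1 z.1 /\ Z2 z.2]
    [set b | B1 b.1 /\ B2 b.2] (d1 + d2).
Proof.
move=> [Z10 _] [Z20 _] [e1 [Ze1 e1P]] [e2 [Ze2 e2P]].
pose e (i : 'I_(d1 + d2)) : (W1 * W2)%type :=
  match fintype.split i with inl j => (e1 j, 0) | inr j => (0, e2 j) end.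
have sumE (c : 'I_(d1 + d2) -> k) : \sum_i c i *: e i =
   (\sum_i c (lshift d2 i) *: e1 i, \sum_i c (rshift d1 i) *: e2 i).
  rewrite big_split_ord /=.
  rewrite (eq_bigr (fun i => (c (lshift d2 i) *: e1 i, 0))); last first.
    move=> i _; rewrite /e (unsplitK (inl _ i)).
    by congr pair; rewrite /= scaler0.
  rewrite [X in _ + X](eq_bigr (fun i => (0, c (rshift d1 i) *: e2 i))); last first.
    move=> i _; rewrite /e (unsplitK (inr _ i)).
    by congr pair; rewrite /= scaler0.
  have s1 (I : finType) (f : I -> W1) : \sum_i (f i, 0 : W2) = (\sum_i f i, 0).
    by elim/big_ind2: _ => // u v u' v' -> ->; congr pair; rewrite /= addr0.
  have s2 (I : finType) (f : I -> W2) : \sum_i (0 : W1, f i) = (0, \sum_i f i).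
    by elim/big_ind2: _ => // u v u' v' -> ->; congr pair; rewrite /= addr0.
  by rewrite s1 s2; congr pair; rewrite /= ?addr0 ?add0r.
exists e; split.
  by move=> i; rewrite /e; case: (fintype.split i) => j /=; split.
move=> [z1 z2] [/= Zz1 Zz2].
have [c1 [c1P c1U]] := e1P _ Zz1; have [c2 [c2P c2U]] := e2P _ Zz2.
exists [ffun i => match fintype.split i with inl j => c1 j | inr j => c2 j end]; split.
  rewrite sumE /=; split.
    by under eq_bigr do rewrite ffunE (unsplitK (inl _ _)).
  by under eq_bigr do rewrite ffunE (unsplitK (inr _ _)).
move=> c; rewrite sumE /= => -[cP1 cP2].
have E1 : c1 = [ffun i => c (lshift d2 i)].
  by apply: c1U; under eq_bigr do rewrite ffunE.
have E2 : c2 = [ffun i => c (rshift d1 i)].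
  by apply: c2U; under eq_bigr do rewrite ffunE.
apply/ffunP => i; rewrite ffunE E1 E2.
by rewrite -{2}[i]splitK; case: (fintype.split i) => j; rewrite ffunE.
Qed.

Lemma quotient_dim0 (W : lmodType k) (Z B : set W) :
  (forall z, Z z -> B z) -> quotient_dim Z B 0.
Proof.
move=> ZB; exists (fun=> 0); split=> [[]//|z Zz].
exists [ffun=> 0]; split; first by rewrite big_ord0 subr0; exact: ZB.
by move=> c _; apply/ffunP => -[].
Qed.

End QuotientDim.

(** * Bimodules and lifting from projectives *)

Section Bimodules.
Variables (k : fieldType) (A : algType k).
Implicit Types M N P : bimodule A.

Lemma bimod_homD M N (f g : M -> N) :
  bimod_hom f -> bimod_hom g -> bimod_hom (fun x => f x + g x).
Proof.
move=> [lf fl fr] [lg gl gr]; split.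
- by move=> c u v; rewrite lf lg scalerDr addrACA.
- by move=> a m; rewrite fl gl -[lact a (f m)]scale1r -lact_linearr scale1r.
- move=> m a; rewrite fr gr -[ract (f m) a]scale1r.
  by rewrite -ract_linearl scale1r.
Qed.

Lemma lactD N (a : A) (u v : N) : lact a (u + v) = lact a u + lact a v.
Proof. by have := lact_linearr a 1 u v; rewrite !scale1r. Qed.
Lemma lactDl N (a b : A) (u : N) : lact (a + b) u = lact a u + lact b u.
Proof. by have := lact_linearl u 1 a b; rewrite !scale1r. Qed.
Lemma ractD N (a : A) (u v : N) : ract (u + v) a = ract u a + ract v a.
Proof. by have := ract_linearl a 1 u v; rewrite !scale1r. Qed.
Lemma ractDr N (a b : A) (u : N) : ract u (a + b) = ract u a + ract u b.
Proof. by have := ract_linearr u 1 a b; rewrite !scale1r. Qed.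
Lemma lact0 N (a : A) : lact a (0 : N) = 0.
Proof. by apply: (addrI (lact a 0)); rewrite -lactD !addr0. Qed.
Lemma ract0 N (a : A) : ract (0 : N) a = 0.
Proof. by apply: (addrI (ract 0 a)); rewrite -ractD !addr0. Qed.
Lemma lact0l N (u : N) : lact 0 u = 0.
Proof. by apply: (addrI (lact 0 u)); rewrite -lactDl !addr0. Qed.
Lemma ract0r N (u : N) : ract u 0 = 0.
Proof. by apply: (addrI (ract u 0)); rewrite -ractDr !addr0. Qed.
Lemma lactN N (a : A) (u : N) : lact a (- u) = - lact a u.
Proof. by apply: (addrI (lact a u)); rewrite -lactD !subrr lact0. Qed.
Lemma ractN N (a : A) (u : N) : ract (- u) a = - ract u a.
Proof. by apply: (addrI (ract u a)); rewrite -ractD !subrr ract0. Qed.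
Lemma lactNl N (a : A) (u : N) : lact (- a) u = - lact a u.
Proof. by apply: (addrI (lact a u)); rewrite -lactDl !subrr lact0l. Qed.
Lemma ractNr N (a : A) (u : N) : ract u (- a) = - ract u a.
Proof. by apply: (addrI (ract u a)); rewrite -ractDr !subrr ract0r. Qed.
Lemma lactZ N (a : A) c (u : N) : lact a (c *: u) = c *: lact a u.
Proof. by have := lact_linearr a c u 0; rewrite !addr0 lact0 addr0. Qed.
Lemma ractZ N (a : A) c (u : N) : ract (c *: u) a = c *: ract u a.
Proof. by have := ract_linearl a c u 0; rewrite !addr0 ract0 addr0. Qed.

Lemma bimod_homN M N (f : M -> N) :
  bimod_hom f -> bimod_hom (fun x => - f x).
Proof.
move=> [lf fl fr]; split.
- by move=> c u v; rewrite lf opprD scalerN.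
- by move=> a m; rewrite fl lactN.
- by move=> m a; rewrite fr ractN.
Qed.

Lemma bimod_homB M N (f g : M -> N) :
  bimod_hom f -> bimod_hom g -> bimod_hom (fun x => f x - g x).
Proof. by move=> fP gP; exact: bimod_homD fP (bimod_homN gP). Qed.

Lemma bimod_homZ M N c (f : M -> N) :
  bimod_hom f -> bimod_hom (fun x => c *: f x).
Proof.
move=> [lf fl fr]; split.
- by move=> d u v; rewrite lf scalerDr !scalerA mulrC.
- by move=> a m; rewrite fl lactZ.
- by move=> m a; rewrite fr ractZ.
Qed.

Lemma bimod_hom0 M N : bimod_hom (fun _ : M => 0 : N).
Proof.
split; first by move=> c u v; rewrite scaler0 addr0.
  by move=> a m; rewrite lact0.
by move=> a m; rewrite ract0.
Qed.

Lemma bimod_hom_id M : bimod_hom (fun x : M => x).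
Proof. by split. Qed.

Lemma bimod_hom_comp M N P (g : N -> P) (f : M -> N) :
  bimod_hom g -> bimod_hom f -> bimod_hom (fun x => g (f x)).
Proof.
move=> [lg gl gr] [lf fl fr]; split.
- by move=> c u v; rewrite lf lg.
- by move=> a m; rewrite fl gl.
- by move=> m a; rewrite fr gr.
Qed.

Lemma bimod_hom_eq M N (f g : M -> N) : f =1 g -> bimod_hom f -> bimod_hom g.
Proof. by move=> /funext ->. Qed.

Section Hom.
Variables (M N : bimodule A) (f : M -> N) (fP : bimod_hom f).
Lemma homD u v : f (u + v) = f u + f v.
Proof. by case: fP => lf _ _; have := lf 1 u v; rewrite !scale1r. Qed.
Lemma hom0 : f 0 = 0.
Proof. by apply: (addrI (f 0)); rewrite -homD !addr0. Qed.
Lemma homN u : f (- u) = - f u.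
Proof. by apply: (addrI (f u)); rewrite -homD !subrr hom0. Qed.
Lemma homB u v : f (u - v) = f u - f v.
Proof. by rewrite homD homN. Qed.
End Hom.

Record sub_bimodule N := SubBimodule {
  sub_set :> N -> Prop;
  sub_subspace : subspace sub_set;
  sub_lact : forall a u, sub_set u -> sub_set (lact a u);
  sub_ract : forall a u, sub_set u -> sub_set (ract u a) }.

Section SubBimodule.
Variables (N : bimodule A) (Z : sub_bimodule N).

Record sub_elt := SubElt { sub_val :> N; sub_valP : `[< Z sub_val >] }.
Definition sub_pred : {pred N} := fun u => `[< Z u >].
HB.instance Definition _ := [isSub for sub_val].
HB.instance Definition _ := [Choice of sub_elt by <:].

Lemma sub_submod : submod_closed sub_pred.
Proof.
case: (sub_subspace Z) => Z0 ZP; split; first exact/asboolP.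
by move=> c u v /asboolP Zu /asboolP Zv; apply/asboolP; exact: ZP.
Qed.
HB.instance Definition _ :=
  GRing.SubChoice_isSubLmodule.Build k N sub_pred sub_elt sub_submod.

Lemma sub_lact_subproof a (u : sub_elt) : `[< Z (lact a u) >].
Proof. by apply/asboolP/sub_lact/asboolP/sub_valP. Qed.
Lemma sub_ract_subproof a (u : sub_elt) : `[< Z (ract u a) >].
Proof. by apply/asboolP/sub_ract/asboolP/sub_valP. Qed.

Definition bimodule_of_sub : bimodule A.
Proof.
exists (sub_elt : lmodType k) (fun a u => SubElt (sub_lact_subproof a u))
  (fun u a => SubElt (sub_ract_subproof a u)).
- by move=> m c a b; apply: val_inj => /=; rewrite lact_linearl.
- by move=> a c u v; apply: val_inj => /=; rewrite lact_linearr.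
- by move=> a c u v; apply: val_inj => /=; rewrite ract_linearl.
- by move=> m c a b; apply: val_inj => /=; rewrite ract_linearr.
- by move=> m; apply: val_inj => /=; rewrite lact1.
- by move=> m; apply: val_inj => /=; rewrite ract1.
- by move=> a b m; apply: val_inj => /=; rewrite lactM.
- by move=> a b m; apply: val_inj => /=; rewrite ractM.
- by move=> a b m; apply: val_inj => /=; rewrite lract.
Defined.

End SubBimodule.

Lemma hom_image_subspace M N (g : M -> N) : bimod_hom g ->
  subspace (fun y => exists x, g x = y).
Proof.
move=> gP; split; first by exists 0; exact: hom0.
by move=> c _ _ [u <-] [v <-]; exists (c *: u + v); case: gP => ->.
Qed.

Definition hom_image M N (g : M -> N) (gP : bimod_hom g) : sub_bimodule N.
Proof.
exists (fun y => exists x, g x = y); first exact: hom_image_subspace.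
  by move=> a _ [x <-]; exists (lact a x); case: gP.
by move=> a _ [x <-]; exists (ract x a); case: gP.
Defined.

(** Projectivity lifts along surjections only, so [g] and [f] are both corestricted to the image of
    [g]; this is what images as bimodules are for. *)
Lemma projective_lift P M N (g : M -> N) (f : P -> N) :
  projective P -> bimod_hom g -> bimod_hom f ->
  (forall p, exists m, g m = f p) ->
  exists2 h : P -> M, bimod_hom h & forall p, g (h p) = f p.
Proof.
move=> prP gP fP fg.
have gI m : `[< hom_image gP (g m) >] by apply/asboolP; exists m.
have fI p : `[< hom_image gP (f p) >] by apply/asboolP; exact: fg.
pose I := bimodule_of_sub (hom_image gP).
pose g' m : I := SubElt (gI m); pose f' p : I := SubElt (fI p).
have := prP M I g' f'.
case.
- case: (gP) => lg gl gr; split.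
  + by move=> c u v; apply: val_inj => /=; rewrite lg.
  + by move=> a u; apply: val_inj => /=; rewrite gl.
  + by move=> u a; apply: val_inj => /=; rewrite gr.
- by case=> y yP; have /asboolP[x xP] := yP; exists x; apply: val_inj.
- case: (fP) => lf fl fr; split.
  + by move=> c u v; apply: val_inj => /=; rewrite lf.
  + by move=> a u; apply: val_inj => /=; rewrite fl.
  + by move=> u a; apply: val_inj => /=; rewrite fr.
move=> h hP hE; exists h => // p.
by have := congr1 (@sub_val _ _) (hE p).
Qed.

End Bimodules.

(** * Comparison of projective resolutions *)

Section Comparison.
Variables (k : fieldType) (A : algType k) (M : bimodule A).
Implicit Types (P R T : proj_resolution M) (N : bimodule A).

(** In degree 0 the augmentation replaces the differential, so that the two exactness axioms of a
    resolution take the single form [cycleP]. *)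
Definition cycle P n : res_obj P n -> Prop :=
  match n with
  | 0 => fun x => res_aug x = 0
  | m.+1 => fun x => res_diff x = 0
  end.

Lemma cycleP P n (x : res_obj P n) :
  cycle x <-> exists y, @res_diff _ _ _ P n y = x.
Proof. by case: n x => [|n] x; [exact: res_exact0 | exact: res_exactS]. Qed.

Definition chain_map P R (f : forall n, res_obj P n -> res_obj R n) : Prop :=
  (forall n, bimod_hom (f n)) /\
  (forall n x, f n (res_diff x) = res_diff (f n.+1 x)).

Lemma chain_map_exists P R : exists f : forall n, res_obj P n -> res_obj R n,
  chain_map f /\ forall x, res_aug (f 0 x) = res_aug x.
Proof.
(* The recursion carries preservation of cycles along with the map: composed with the differential
   of [P], such a map takes values in boundaries, as the next lift requires. *)
pose inv n (f : res_obj P n -> res_obj R n) :=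
  bimod_hom f /\ forall x, cycle x -> cycle (f x).
have start : {f : res_obj P 0 -> res_obj R 0 |
    inv 0 f /\ forall x, res_aug (f x) = res_aug x}.
  apply: cid.
  have [p|h hP hE] := projective_lift (@res_proj _ _ _ P 0)
    (res_aug_hom R) (res_aug_hom P); first exact: res_aug_surj.
  by exists h; split=> //; split=> // x /=; rewrite hE.
have step n (f : {f | inv n f}) :
    {g | inv n.+1 g /\ forall x, sval f (res_diff x) = res_diff (g x)}.
  case: f => f /= [fP fc]; apply: cid.
  have [p|h hP hE] := projective_lift (@res_proj _ _ _ P n.+1)
    (res_diff_hom R n) (bimod_hom_comp fP (res_diff_hom P n)).
    by apply/cycleP/fc/cycleP; exists p.
  by exists h; split=> //; split=> // x /= x0; rewrite hE x0 (hom0 fP).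
pose s : forall n, {f | inv n f} := nat_rect (fun n => {f | inv n f})
  (exist _ (sval start) (proj1 (svalP start)))
  (fun n f => exist _ (sval (step n f)) (proj1 (svalP (step n f)))).
exists (fun n => sval (s n)); split; last exact: (proj2 (svalP start)).
split=> [n|n x]; first by case: (svalP (s n)).
exact: (proj2 (svalP (step n (s n))) x).
Qed.

Lemma homotopy_exists P R (u : forall n, res_obj P n -> res_obj R n) :
  chain_map u -> (forall x, res_aug (u 0 x) = 0) ->
  exists s : forall n, res_obj P n -> res_obj R n.+1,
    [/\ forall n, bimod_hom (s n),
        forall x, u 0 x = res_diff (s 0 x) &
        forall n x, u n.+1 x = res_diff (s n.+1 x) + s n (res_diff x)].
Proof.
move=> [uP ud] u0.
(* On cycles the homotopy identity reduces to [d s = u]. Applied to [d x], it shows that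
   [u x - s (d x)] is a cycle in the next degree, hence can be lifted. *)
pose inv n (f : res_obj P n -> res_obj R n.+1) :=
  bimod_hom f /\ forall x, cycle x -> res_diff (f x) = u n x.
have start : {f : res_obj P 0 -> res_obj R 1 |
    inv 0 f /\ forall x, u 0 x = res_diff (f x)}.
  apply: cid.
  have [p|h hP hE] := projective_lift (@res_proj _ _ _ P 0)
    (res_diff_hom R 0) (uP 0%N); first by apply/cycleP; exact: u0.
  by exists h; split=> //; split.
have step n (f : {f | inv n f}) :
    {g | inv n.+1 g /\ forall x, u n.+1 x = res_diff (g x) + sval f (res_diff x)}.
  case: f => f /= [fP fc]; apply: cid.
  have [p|h hP hE] := projective_lift (@res_proj _ _ _ P n.+1)
    (res_diff_hom R n.+1)
    (bimod_homB (uP n.+1) (bimod_hom_comp fP (res_diff_hom P n))).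
    apply/cycleP => /=; rewrite (homB (res_diff_hom R n)) fc ?ud ?subrr //.
    by apply/cycleP; exists p.
  exists h; split; last by move=> x; rewrite hE subrK.
  by split=> // x /= x0; rewrite hE x0 (hom0 fP) subr0.
pose s : forall n, {f | inv n f} := nat_rect (fun n => {f | inv n f})
  (exist _ (sval start) (proj1 (svalP start)))
  (fun n f => exist _ (sval (step n f)) (proj1 (svalP (step n f)))).
exists (fun n => sval (s n)); split.
- by move=> n; case: (svalP (s n)).
- exact: (proj2 (svalP start)).
- by move=> n x; exact: (proj2 (svalP (step n (s n))) x).
Qed.

Lemma chain_map_comp P R T (g : forall n, res_obj R n -> res_obj T n)
    (f : forall n, res_obj P n -> res_obj R n) :
  chain_map g -> chain_map f -> chain_map (fun n x => g n (f n x)).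
Proof.
move=> [gP gd] [fP fd]; split=> [n|n x]; first exact: bimod_hom_comp.
by rewrite fd gd.
Qed.

Lemma ext_cocycle_subspace N P i : subspace (@ext_cocycle _ _ M N P i).
Proof.
split; first by split=> //; exact: bimod_hom0.
move=> a u v [uP u0] [vP v0]; split.
  exact: bimod_homD (bimod_homZ a uP) vP.
move=> x; change (a *: u (res_diff x) + v (res_diff x) = 0).
by rewrite u0 v0 scaler0 addr0.
Qed.

Lemma ext_coboundary_subspace N P i : subspace (@ext_coboundary _ _ M N P i).
Proof.
case: i => [|i]; split=> //=.
- move=> a u v u0 v0 x; change (a *: u x + v x = 0).
  by rewrite u0 v0 scaler0 addr0.
- by exists (fun=> 0) => //; exact: bimod_hom0.
- move=> a u v [g gP gE] [h hP hE].
  exists (fun x => a *: g x + h x); first exact: bimod_homD (bimod_homZ a gP) hP.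
  by move=> x; change (a *: u x + v x = a *: g (res_diff x) + h (res_diff x));
    rewrite gE hE.
Qed.

(** Of the two terms of a homotopy between the identity and [u], the cocycle [z] kills [d s], and
    [z s d] is a coboundary. *)
Lemma cocycle_homotopic N P (u : forall n, res_obj P n -> res_obj P n) i
    (z : res_obj P i -> N) :
  chain_map u -> (forall x, res_aug (u 0 x) = res_aug x) ->
  ext_cocycle z -> ext_coboundary (z - (fun x => z (u i x)) : res_obj P i -> N).
Proof.
move=> [uP ud] u1 [zP z0].
have [||s [sP s0 sS]] := @homotopy_exists P P (fun n x => x - u n x).
- split=> [n|n x]; first exact: bimod_homB (bimod_hom_id _) (uP n).
  by rewrite ud (homB (res_diff_hom P n)).
- by move=> x; rewrite (homB (res_aug_hom P)) u1 subrr.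
case: i z zP z0 => [|i] z zP z0 /=.
  move=> x; change (z x - z (u 0 x) = 0).
  by rewrite -(homB zP) s0 z0.
exists (fun x => z (s i x)); first exact: bimod_hom_comp.
move=> x; change (z x - z (u i.+1 x) = z (s i (res_diff x))).
by rewrite -(homB zP) sS (homD zP) z0 add0r.
Qed.

(** Chain maps in both directions compose to maps homotopic to the identity, so one resolution
    determines the dimension that [Ext_dim] demands of all of them. *)
Lemma Ext_dim_of_resolution N P i d :
  quotient_dim (@ext_cocycle _ _ M N P i) (@ext_coboundary _ _ M N P i) d ->
  Ext_dim M N i d.
Proof.
move=> dimP; split=> [|R]; first by exists.
have [f [fP f1]] := chain_map_exists P R.
have [g [gP g1]] := chain_map_exists R P.
have coc Q T (h : forall n, res_obj Q n -> res_obj T n) (z : res_obj T i -> N) :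
    chain_map h -> ext_cocycle z -> ext_cocycle (fun x => z (h i x)).
  move=> [hP hd] [zP z0]; split=> [|x]; first exact: bimod_hom_comp.
  by rewrite hd z0.
have cob Q T (h : forall n, res_obj Q n -> res_obj T n) (z : res_obj T i -> N) :
    chain_map h -> ext_coboundary z ->
    ext_coboundary (fun x => z (h i x)).
  move=> [hP hd]; case: {coc dimP} i z => [|j] z /=; first by move=> z0 x.
  move=> [w wP wE]; exists (fun x => w (h j x)); first exact: bimod_hom_comp.
  by move=> x; rewrite wE hd.
apply: (@quotient_dim_pull _ _ _
  (fun (z : res_obj R i -> N) => (fun x => z (f i x)) : res_obj P i -> N)) dimP.
- by [].
- exact: ext_cocycle_subspace.
- exact: ext_coboundary_subspace.
- by move=> z zP; exact: (coc _ _ f z fP zP).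
- move=> z zP; exists (fun x => z (g i x)); first exact: (coc _ _ g z gP zP).
  apply: (@cocycle_homotopic _ P (fun n x => g n (f n x))) => //.
    exact: chain_map_comp.
  by move=> x; rewrite g1 f1.
- by move=> z zB; exact: (cob _ _ f z fP zB).
- move=> z zP /(cob _ _ g _ gP) zB.
  have H : ext_coboundary (z - (fun x => z (f i (g i x))) : res_obj R i -> N).
    apply: (@cocycle_homotopic _ R (fun n x => f n (g n x))) => //.
      exact: chain_map_comp.
    by move=> x; rewrite f1 g1.
  have := subspaceD (ext_coboundary_subspace N R i) H zB.
  by rewrite subrK.
Qed.

End Comparison.

(** * The resolution of an algebra with PBW basis *)

(* Iterated polynomial rings are packed in this constant, since unification is
   slow on nested canonical structures. *)
Definition polyR (R : nzRingType) : nzRingType := {poly R}.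

Section PolyR.
Variable R : nzRingType.
Definition pconst (c : R) : polyR R := c%:P.
Definition pvar : polyR R := 'X.
Definition pterm (c : R) (n : nat) : polyR R := c%:P * 'X^n.

Lemma pconstD : {morph pconst : a b / a + b}. Proof. exact: polyCD. Qed.
Lemma pconstM : {morph pconst : a b / a * b}. Proof. exact: polyCM. Qed.
Lemma pconst1 : pconst 1 = 1. Proof. exact: polyC1. Qed.
Lemma ptermD n : {morph pterm^~ n : a b / a + b}.
Proof. by move=> a b; rewrite /pterm polyCD mulrDl. Qed.
Lemma pterm0 n : pterm 0 n = 0.
Proof. by rewrite /pterm polyC0 mul0r. Qed.
Lemma ptermB n : {morph pterm^~ n : a b / a - b}.
Proof. by move=> a b; rewrite /pterm polyCB mulrBl. Qed.
Lemma pconst_pterm c u n : pconst c * pterm u n = pterm (c * u) n.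
Proof. by rewrite /pterm /pconst polyCM; exact: mulrA. Qed.
Lemma pterm_pconst c u n : pterm u n * pconst c = pterm (u * c) n.
Proof.
rewrite /pterm /pconst -[LHS]mulrA -[RHS]/((u * c)%:P * 'X^n) polyCM -[RHS]mulrA.
by rewrite -[X in _ * X]commr_polyXn.
Qed.
Lemma pterm_pvar u n : pterm u n * pvar = pterm u n.+1.
Proof. by rewrite /pterm exprSr; exact: esym (mulrA _ _ _). Qed.

Lemma pterm_ind (P : polyR R -> Prop) :
  (forall p q, P p -> P q -> P (p + q)) -> P 0 ->
  (forall c n, P (pterm c n)) -> forall p, P p.
Proof.
move=> PD P0 Pt p; rewrite -[p]coefK poly_def; elim/big_ind: _ => // i _.
rewrite -mul_polyC; exact: Pt.
Qed.
End PolyR.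

Section PolySum.
Variables (R : nzRingType) (M : zmodType).

(** For [G] additive in the coefficient this is the additive map sending [pterm c i] to [G i c]; the
    maps out of [A (x) A] are built by iterating it. *)
Definition poly_sum (G : nat -> R -> M) (p : polyR R) : M :=
  \sum_(i < size (p : {poly R})) G i (p : {poly R})`_i.

Variable G : nat -> R -> M.
Hypothesis Gadd : forall i, {morph G i : a b / a + b}.

Lemma poly_sum_coef0 i : G i 0 = 0.
Proof. by apply: (addrI (G i 0)); rewrite -Gadd !addr0. Qed.

Lemma poly_sum_wide n (p : {poly R}) : (size p <= n)%N ->
  poly_sum G p = \sum_(i < n) G i p`_i.
Proof.
move=> le_pn; rewrite /poly_sum (big_ord_widen _ (fun i => G i p`_i) le_pn).
rewrite big_mkcond; apply: eq_bigr => i _; case: ltnP => // le_pi.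
by rewrite nth_default // poly_sum_coef0.
Qed.

Lemma poly_sumD : {morph poly_sum G : p q / p + q}.
Proof.
move=> p q; pose n := maxn (size p) (size q).
rewrite !(@poly_sum_wide n) ?leq_maxl ?leq_maxr ?(leq_trans (size_polyD _ _)) //.
by rewrite -big_split; apply: eq_bigr => i _; rewrite coefD Gadd.
Qed.

Lemma poly_sum_term c n : poly_sum G (pterm c n) = G n c.
Proof.
rewrite /pterm.
rewrite (@poly_sum_wide n.+1); last first.
  by apply: (leq_trans (size_polyMleq _ _)); rewrite size_polyXn addnS /= ;
    rewrite -[X in (_ <= X)%N]add1n leq_add2r size_polyC leq_b1.
rewrite big_ord_recr /= big1 ?add0r => [|i _]; rewrite coefCM coefXn ?eqxx ?mulr1 //.
by rewrite (ltn_eqF (ltn_ord i)) mulr0 poly_sum_coef0.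
Qed.

End PolySum.

(* The left [A]-module [A (x) A]: with the PBW basis on the right tensor factor,
   [term a i j p q] stands for [a (x) x^i y^j D^p E^q], the outermost polynomial
   variable being the one of [x]. *)
Definition tensR (R : nzRingType) : nzRingType := polyR (polyR (polyR (polyR R))).
Definition tens (k : fieldType) (A : algType k) : Type := tensR A.

Section Tens.
Variables (k : fieldType) (A : algType k).

HB.instance Definition _ := GRing.Zmodule.copy (tens A) (tensR A).

Fact tens_key : unit. Proof. exact: tt. Qed.

Definition smul : A -> tens A -> tens A := locked_with tens_key
  (fun a f => (pconst (pconst (pconst (pconst a))) : tensR A) * (f : tensR A)).
Definition term : A -> nat -> nat -> nat -> nat -> tens A :=
  locked_with tens_key (fun a i j p q => pterm (pterm (pterm (pterm a q) p) j) i).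

Lemma smulE a f :
  smul a f = (pconst (pconst (pconst (pconst a))) : tensR A) * (f : tensR A).
Proof. by rewrite /smul unlock. Qed.
Lemma termE a i j p q : term a i j p q = pterm (pterm (pterm (pterm a q) p) j) i.
Proof. by rewrite /term unlock. Qed.

Lemma smulDl f : {morph smul^~ f : a b / a + b}.
Proof. by move=> a b; rewrite !smulE !pconstD; exact: mulrDl. Qed.
Lemma smulDr a : {morph smul a : f g / f + g}.
Proof. by move=> f g; rewrite !smulE; exact: mulrDr. Qed.
Lemma smulA a b f : smul a (smul b f) = smul (a * b) f.
Proof. by rewrite !smulE !pconstM; exact: mulrA. Qed.
Lemma smul_term b a i j p q : smul b (term a i j p q) = term (b * a) i j p q.
Proof. by rewrite !termE smulE !pconst_pterm. Qed.

Lemma termD i j p q : {morph (fun a => term a i j p q) : a b / a + b}.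
Proof. by move=> a b; rewrite !termE !ptermD. Qed.

Lemma tens_ind (P : tens A -> Prop) :
  (forall f g, P f -> P g -> P (f + g)) ->
  (forall a i j p q, P (term a i j p q)) -> forall f, P f.
Proof.
move=> PD Pt.
have P0 : P 0 by have := Pt 0 0 0 0 0; rewrite termE !pterm0.
apply: pterm_ind => // c4 i.
elim/pterm_ind: c4 => [u v Pu Pv||c3 j].
- by rewrite !ptermD; exact: PD.
- by rewrite !pterm0.
elim/pterm_ind: c3 => [u v Pu Pv||c2 p].
- by rewrite !ptermD; exact: PD.
- by rewrite !pterm0.
elim/pterm_ind: c2 => [u v Pu Pv||a q].
- by rewrite !ptermD; exact: PD.
- by rewrite !pterm0.
by rewrite -termE; exact: Pt.
Qed.

Lemma smul1 f : smul 1 f = f.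
Proof.
elim/tens_ind: f => [f g IHf IHg|a i j p q]; first by rewrite smulDr IHf IHg.
by rewrite smul_term mul1r.
Qed.

Section Extension.
Variables (M : zmodType) (G : nat -> nat -> nat -> nat -> A -> M).
Definition term_ext : tens A -> M :=
  poly_sum (fun i => poly_sum (fun j => poly_sum (fun p => poly_sum (G i j p)))).
Hypothesis Gadd : forall i j p q, {morph G i j p q : a b / a + b}.

Lemma term_extD : {morph term_ext : f g / f + g}.
Proof. by do 4![apply: poly_sumD => ?]. Qed.
Lemma term_ext_term a i j p q : term_ext (term a i j p q) = G i j p q a.
Proof.
rewrite /term_ext termE poly_sum_term; last by do 3![move=> ?; apply: poly_sumD].
rewrite poly_sum_term; last by do 2![move=> ?; apply: poly_sumD].
rewrite poly_sum_term; last by move=> ?; apply: poly_sumD.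
by rewrite poly_sum_term.
Qed.
End Extension.

Definition tens_scale (c : k) (f : tens A) : tens A := smul (c%:A) f.

Lemma tens_scaleA a b f : tens_scale a (tens_scale b f) = tens_scale (a * b) f.
Proof. by rewrite /tens_scale smulA -scalerAl mul1r scalerA. Qed.
Lemma tens_scale1 : left_id 1 tens_scale.
Proof. by move=> f; rewrite /tens_scale scale1r smul1. Qed.
Lemma tens_scaleDr : right_distributive tens_scale +%R.
Proof. by move=> c f g; rewrite /tens_scale smulDr. Qed.
Lemma tens_scaleDl f : {morph tens_scale^~ f : a b / a + b}.
Proof. by move=> a b; rewrite /tens_scale scalerDl smulDl. Qed.

HB.instance Definition _ := GRing.Zmodule_isLmodule.Build k (tens A)
  tens_scaleA tens_scale1 tens_scaleDr tens_scaleDl.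

Lemma tens_scaleE c (f : tens A) : c *: f = smul (c%:A) f.
Proof. by []. Qed.

End Tens.

Definition pbw_mon (k : fieldType) (A : algType k) (x y D E : A) i j p q : A :=
  x ^+ i * y ^+ j * D ^+ p * E ^+ q.

(* [gD] and [gE] stand for the operators [y (x + y) d/dy] and [x d/dx + y d/dy]. *)
Record pbw_algebra (k : fieldType) (A : algType k) := PbwAlgebra {
  gx : A; gy : A; gD : A; gE : A;
  rel_xy : gx * gy = gy * gx;
  rel_Dx : gD * gx = gx * gD;
  rel_Dy : gD * gy = gy * gD + gy * gy + gx * gy;
  rel_Ex : gE * gx = gx * gE + gx;
  rel_Ey : gE * gy = gy * gE + gy;
  rel_ED : gE * gD = gD * gE + gD;
  pbw_span : forall P : A -> Prop, P 0 ->
    (forall c i j p q b, P b -> P (c *: pbw_mon gx gy gD gE i j p q + b)) ->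
    forall a, P a;
  pbw_coord : A -> tens A;
  pbw_coord_linear : linear pbw_coord;
  pbw_coord_mon : forall i j p q,
    pbw_coord (pbw_mon gx gy gD gE i j p q) = term 1 i j p q }.

Section FreeBimodule.
Variables (k : fieldType) (A : algType k) (H : pbw_algebra A).

Local Notation x := (gx H).
Local Notation y := (gy H).
Local Notation D := (gD H).
Local Notation E := (gE H).
Local Notation mo := (pbw_mon x y D E).
Local Notation io := (pbw_coord H : A -> tens A).

Lemma pbw_coordD a b : io (a + b) = io a + io b.
Proof. by have := pbw_coord_linear H 1 a b; rewrite !scale1r. Qed.
Lemma pbw_coord0 : io 0 = 0 :> tens A.
Proof. by apply: (addrI (io 0)); rewrite -pbw_coordD !addr0. Qed.
Lemma pbw_coordZ c a : io (c *: a) = c *: io a.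
Proof. by have := pbw_coord_linear H c a 0; rewrite pbw_coord0 !addr0. Qed.
(** [io b] is [1 (x) b]: the right action of [b] expands [x^i y^j D^p E^q b] again in the PBW
    basis. *)
Definition tens_ract (f : tens A) (b : A) : tens A :=
  term_ext (fun i j p q a => smul a (io (mo i j p q * b))) f.

Lemma tens_ractD b : {morph tens_ract^~ b : f g / f + g}.
Proof. by apply: term_extD => i j p q a c; rewrite smulDl. Qed.

Lemma tens_ract_term a i j p q b :
  tens_ract (term a i j p q) b = smul a (io (mo i j p q * b)).
Proof. by rewrite /tens_ract term_ext_term // => *a1 a2; rewrite smulDl. Qed.

Lemma tens_ract0 b : tens_ract 0 b = 0.
Proof. by apply: (addrI (tens_ract 0 b)); rewrite -tens_ractD !addr0. Qed.

Lemma tens_ract_smul c f b : tens_ract (smul c f) b = smul c (tens_ract f b).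
Proof.
elim/tens_ind: f => [f g IHf IHg|a i j p q].
  by rewrite smulDr !tens_ractD smulDr IHf IHg.
by rewrite smul_term !tens_ract_term smulA.
Qed.

(** In tensor notation, [(1 (x) b) c = 1 (x) bc]; with left linearity it gives the associativity of
    the right action, which the formula for [tens_ract] does not show. *)
Lemma tens_ract_coord b c : tens_ract (io b) c = io (b * c).
Proof.
elim/(@pbw_span _ _ H): b => [|c0 i j p q b IHb].
  by rewrite mul0r pbw_coord0 tens_ract0.
rewrite mulrDl !pbw_coordD tens_ractD IHb -scalerAl !pbw_coordZ !tens_scaleE pbw_coord_mon.
by rewrite tens_ract_smul tens_ract_term smul1.
Qed.

Lemma smul_scale a c (f : tens A) : smul a (c *: f) = c *: smul a f.
Proof.
by rewrite !tens_scaleE !smulA -scalerAl mul1r -scalerAr mulr1.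
Qed.

Definition free_bimodule : bimodule A.
Proof.
exists (tens A : lmodType k) (@smul k A) tens_ract.
- move=> f c a b; rewrite smulDl tens_scaleE smulA.
  by rewrite -scalerAl mul1r.
- by move=> a c f g; rewrite smulDr smul_scale.
- by move=> b c f g; rewrite tens_ractD tens_scaleE tens_ract_smul.
- move=> f c a b; elim/tens_ind: f => [f g IHf IHg|d i j p q].
    by rewrite !tens_ractD IHf IHg scalerDr addrACA.
  rewrite !tens_ract_term mulrDr -scalerAr pbw_coordD smulDr pbw_coordZ; congr (_ + _).
  exact: smul_scale.
- exact: smul1.
- move=> f; elim/tens_ind: f => [f g IHf IHg|d i j p q].
    by rewrite tens_ractD IHf IHg.
  by rewrite tens_ract_term mulr1 pbw_coord_mon smul_term mulr1.
- by move=> a b f; rewrite smulA.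
- move=> a b f; elim/tens_ind: f => [f g IHf IHg|d i j p q].
    by rewrite !tens_ractD IHf IHg.
  by rewrite !tens_ract_term tens_ract_smul tens_ract_coord mulrA.
- by move=> a b f; exact: tens_ract_smul.
Defined.

Local Notation F := free_bimodule.

Definition free_gen : F := term 1 0 0 0 0.

Lemma mon0 : mo 0 0 0 0 = 1. Proof. by rewrite /pbw_mon !expr0 !mulr1. Qed.

Lemma term_gen a i j p q :
  term a i j p q = ract (lact a free_gen) (mo i j p q) :> F.
Proof.
rewrite /= smul_term mulr1 tens_ract_term mon0 mul1r pbw_coord_mon smul_term.
by rewrite mulr1.
Qed.

Lemma pbw_coord_gen b : io b = ract free_gen b :> F.
Proof. by rewrite /= tens_ract_term mon0 mul1r smul1. Qed.

Section Universal.
Variables (N : bimodule A) (n : N).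

Definition free_map : F -> N :=
  term_ext (fun i j p q a => ract (lact a n) (mo i j p q)).

Lemma free_mapD : {morph free_map : f g / f + g}.
Proof. by apply: term_extD => i j p q a b; rewrite lactDl ractD. Qed.

Lemma free_map_term a i j p q :
  free_map (term a i j p q) = ract (lact a n) (mo i j p q).
Proof. by rewrite /free_map term_ext_term // => *a1 a2; rewrite lactDl ractD. Qed.

Lemma free_map_lact a (f : F) : free_map (lact a f) = lact a (free_map f).
Proof.
elim/tens_ind: f => [f g IHf IHg|b i j p q].
  by rewrite lactD !free_mapD lactD IHf IHg.
by rewrite /= smul_term !free_map_term lactM lract.
Qed.

Lemma lact_alg (M : bimodule A) c (m : M) : lact (c%:A) m = c *: m.
Proof. by have := lact_linearl m c 1 0; rewrite !addr0 lact1 lact0l addr0. Qed.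
Lemma free_mapZ c (f : F) : free_map (c *: f) = c *: free_map f.
Proof. by rewrite -!lact_alg free_map_lact. Qed.

(** Right linearity of [free_map] rests on this. The action on [F] expands a product in the PBW
    basis; the action on [N] is linear in [b], so the expansion makes no difference there. *)
Lemma free_map_coord b : free_map (io b) = ract n b.
Proof.
elim/(@pbw_span _ _ H): b => [|c i j p q b IHb].
  by rewrite pbw_coord0 ract0r; apply: (addrI (free_map 0)); rewrite -free_mapD !addr0.
rewrite pbw_coordD free_mapD IHb pbw_coordZ free_mapZ pbw_coord_mon free_map_term lact1.
by rewrite ract_linearr.
Qed.

Lemma free_map_hom : bimod_hom free_map.
Proof.
split=> [c f g|a f|f b]; last 1 first.
- elim/tens_ind: f => [f g IHf IHg|a i j p q].
    by rewrite ractD !free_mapD ractD IHf IHg.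
  rewrite {1}/ract /= tens_ract_term.
  have := free_map_lact a (io (mo i j p q * b)); rewrite /= => ->.
  by rewrite free_map_coord free_map_term ractM !lract.
- by rewrite free_mapD free_mapZ.
- exact: free_map_lact.
Qed.

Lemma free_map_gen : free_map free_gen = n.
Proof. by rewrite free_map_term mon0 lact1 ract1. Qed.

End Universal.

(** Since [1 (x) 1] generates [F], the commutation rules between the Koszul maps need only be
    checked on that element. *)
Lemma free_hom_ext (N : bimodule A) (f g : F -> N) :
  bimod_hom f -> bimod_hom g -> f free_gen = g free_gen -> f =1 g.
Proof.
move=> fP gP fg; elim/tens_ind => [u v IHu IHv|a i j p q].
  by rewrite (homD fP) (homD gP) IHu IHv.
have [_ fl fr] := fP; have [_ gl gr] := gP.
by rewrite term_gen fr gr fl gl fg.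
Qed.

Lemma free_projective : projective F.
Proof.
move=> M N g f gP gsurj fP; have [m mE] := gsurj (f free_gen).
exists (free_map m); first exact: free_map_hom.
apply: free_hom_ext => //; first exact: bimod_hom_comp gP (free_map_hom m).
by rewrite free_map_gen.
Qed.

End FreeBimodule.

(* [ring] needs a commutative ring: [abel] only decides the identities of abelian
   groups, its atoms being arbitrary terms. *)
Inductive zexp :=
  ZAtom of nat | ZZero | ZAdd of zexp & zexp | ZOpp of zexp | ZMuln of zexp & nat.

Section Abel.
Variable V : zmodType.

Fixpoint zeval (env : seq V) e : V :=
  match e with
  | ZAtom n => env`_n
  | ZZero => 0
  | ZAdd e1 e2 => zeval env e1 + zeval env e2
  | ZOpp e1 => - zeval env e1
  | ZMuln e1 n => zeval env e1 *+ n
  end.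

Fixpoint zcoef e (i : nat) : int :=
  match e with
  | ZAtom n => (i == n)%:Z
  | ZZero => 0
  | ZAdd e1 e2 => zcoef e1 i + zcoef e2 i
  | ZOpp e1 => - zcoef e1 i
  | ZMuln e1 n => zcoef e1 i * n%:Z
  end.

Lemma zevalE env e : zeval env e = \sum_(i < size env) env`_i *~ zcoef e i.
Proof.
elim: e => /= [n||e1 -> e2 ->|e1 ->|e1 -> n].
- have [ltn|len] := ltnP n (size env).
    rewrite (bigD1 (Ordinal ltn)) //= eqxx mulr1z big1 ?addr0 // => i.
    by rewrite -val_eqE /= => /negPf ->.
  rewrite nth_default // big1 // => i _.
  by rewrite (ltn_eqF (leq_trans (ltn_ord i) len)).
- by rewrite big1.
- by rewrite -big_split; apply: eq_bigr => i _; rewrite mulrzDr.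
- by rewrite -sumrN; apply: eq_bigr => i _; rewrite mulrNz.
- by rewrite -sumrMnl; apply: eq_bigr => i _; rewrite mulrzA.
Qed.

Lemma zeval_eq env n e1 e2 : size env = n ->
  all (fun i => zcoef e1 i == zcoef e2 i) (seq.iota 0 n) ->
  zeval env e1 = zeval env e2.
Proof.
move=> <- /allP ce; rewrite !zevalE; apply: eq_bigr => i _.
by rewrite (eqP (ce i _)) // mem_iota ltn_ord.
Qed.
End Abel.

(** Operands are compared recursively, so that atoms differing only in the inferred algebraic
    structure are identified. *)
Ltac z_eq a b :=
  first
    [ constr_eq a b
    | lazymatch a with
      | (?p *+ ?n)%R => lazymatch b with (?q *+ ?m)%R => constr_eq n m; z_eq p q end
      | (?p * ?n)%R => lazymatch b with (?q * ?m)%R => z_eq n m; z_eq p q end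
      | (?p + ?n)%R => lazymatch b with (?q + ?m)%R => z_eq n m; z_eq p q end
      | (?p ^+ ?n)%R => lazymatch b with (?q ^+ ?m)%R => constr_eq n m; z_eq p q end
      | (- ?p)%R => lazymatch b with (- ?q)%R => z_eq p q end
      | (?p *: ?n)%R => lazymatch b with (?q *: ?m)%R => constr_eq p q; z_eq n m end
      | ?f ?p => lazymatch b with ?g ?q => constr_eq f g; z_eq p q end
      end ].
Ltac z_add a l :=
  lazymatch l with
  | nil => constr:(cons a l)
  | cons ?b ?l' =>
      match constr:(Set) with
      | _ => let t := match constr:(Set) with _ => z_eq a b end in l
      | _ => let l2 := z_add a l' in constr:(cons b l2)
      end
  end.
Ltac z_isnum n :=
  lazymatch n with O => constr:(true) | S ?m => z_isnum m | _ => constr:(false) end.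
Ltac z_atoms t l :=
  lazymatch t with
  | (?a + ?b)%R => let l1 := z_atoms a l in z_atoms b l1
  | (- ?a)%R => z_atoms a l
  | (?a *+ ?n)%R =>
      let b := z_isnum n in
      lazymatch b with true => z_atoms a l | false => z_add t l end
  | 0%R => l
  | _ => z_add t l
  end.
Ltac z_index a l :=
  lazymatch l with
  | cons ?b ?l' =>
      match constr:(Set) with
      | _ => let t := match constr:(Set) with _ => z_eq a b end in constr:(O)
      | _ => let n := z_index a l' in constr:(S n)
      end
  end.
Ltac z_reify t l :=
  lazymatch t with
  | (?a + ?b)%R => let e1 := z_reify a l in let e2 := z_reify b l in constr:(ZAdd e1 e2)
  | (- ?a)%R => let e1 := z_reify a l in constr:(ZOpp e1)
  | (?a *+ ?n)%R =>
      let b := z_isnum n in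
      lazymatch b with
      | true => let e1 := z_reify a l in constr:(ZMuln e1 n)
      | false => let n1 := z_index t l in constr:(ZAtom n1)
      end
  | 0%R => constr:(ZZero)
  | _ => let n := z_index t l in constr:(ZAtom n)
  end.
Ltac z_size l :=
  lazymatch l with
  | nil => constr:(O)
  | cons _ ?l' => let n := z_size l' in constr:(S n)
  end.
Ltac abel :=
  match goal with
  | |- @eq ?V ?s ?t =>
    let l0 := z_atoms s (@nil V) in
    let l := z_atoms t l0 in
    let e1 := z_reify s l in
    let e2 := z_reify t l in
    let n := z_size l in
    refine (@zeval_eq V l n e1 e2 (erefl n) _);
    vm_cast_no_check (erefl true)
  end.

Section Products.
Variables (k : fieldType) (A : algType k).

Definition prod_bimodule (M N : bimodule A) : bimodule A.
Proof.
exists ((M * N)%type : lmodType k) (fun a u => (lact a u.1, lact a u.2))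
  (fun u a => (ract u.1 a, ract u.2 a)).
- by move=> m c a b; rewrite !lact_linearl.
- by move=> a c u v; rewrite !lact_linearr.
- by move=> a c u v; rewrite !ract_linearl.
- by move=> m c a b; rewrite !ract_linearr.
- by move=> [u v]; rewrite !lact1.
- by move=> [u v]; rewrite !ract1.
- by move=> a b m; rewrite !lactM.
- by move=> a b m; rewrite !ractM.
- by move=> a b m; rewrite !lract.
Defined.

Lemma rV0_eq (u v : 'rV[k]_0) : u = v.
Proof. by apply/matrixP => i []. Qed.

Definition zero_bimodule : bimodule A :=
  @Bimodule k A ('rV[k]_0 : lmodType k) (fun _ _ => 0) (fun _ _ => 0)
    (fun _ _ _ _ => rV0_eq _ _) (fun _ _ _ _ => rV0_eq _ _)
    (fun _ _ _ _ => rV0_eq _ _) (fun _ _ _ _ => rV0_eq _ _)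
    (fun _ => rV0_eq _ _) (fun _ => rV0_eq _ _)
    (fun _ _ _ => rV0_eq _ _) (fun _ _ _ => rV0_eq _ _) (fun _ _ _ => rV0_eq _ _).

Lemma zero_bimoduleE (u : zero_bimodule) : u = 0.
Proof. exact: rV0_eq. Qed.

Lemma prod_hom_pair (M N P : bimodule A) (f : P -> M) (g : P -> N) :
  bimod_hom f -> bimod_hom g ->
  bimod_hom (fun p => (f p, g p) : prod_bimodule M N).
Proof.
move=> [lf fl fr] [lg gl gr]; split.
- by move=> c u v; rewrite lf lg.
- by move=> a u; rewrite fl gl.
- by move=> u a; rewrite fr gr.
Qed.

Lemma prod_hom_fst (M N : bimodule A) :
  bimod_hom (fun u : prod_bimodule M N => u.1).
Proof. by split. Qed.
Lemma prod_hom_snd (M N : bimodule A) :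
  bimod_hom (fun u : prod_bimodule M N => u.2).
Proof. by split. Qed.

Lemma prod_hom_inl (M N : bimodule A) :
  bimod_hom (fun u : M => (u, 0) : prod_bimodule M N).
Proof. exact: prod_hom_pair (bimod_hom_id _) (bimod_hom0 _ _). Qed.
Lemma prod_hom_inr (M N : bimodule A) :
  bimod_hom (fun u : N => (0, u) : prod_bimodule M N).
Proof. exact: prod_hom_pair (bimod_hom0 _ _) (bimod_hom_id _). Qed.

Lemma prod_projective (M N : bimodule A) :
  projective M -> projective N -> projective (prod_bimodule M N).
Proof.
move=> prM prN P Q g f gP gsurj fP.
have [h1 h1P h1E] := prM P Q g _ gP gsurj (bimod_hom_comp fP (prod_hom_inl _ _)).
have [h2 h2P h2E] := prN P Q g _ gP gsurj (bimod_hom_comp fP (prod_hom_inr _ _)).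
exists (fun u => h1 u.1 + h2 u.2).
  exact: bimod_homD (bimod_hom_comp h1P (prod_hom_fst _ _))
                    (bimod_hom_comp h2P (prod_hom_snd _ _)).
move=> [u v]; rewrite (homD gP) h1E h2E -(homD fP); congr (f (_, _)).
  exact: addr0.
exact: add0r.
Qed.

Lemma zero_projective : projective zero_bimodule.
Proof.
move=> P Q g f gP gsurj fP; exists (fun=> 0); first exact: bimod_hom0.
by move=> u; rewrite (hom0 gP) (zero_bimoduleE u) (hom0 fP).
Qed.

End Products.

(** * The cone of an endomorphism of a complex *)

Section Cone.
Variables (k : fieldType) (A : algType k).

(* [C] is indexed so that [C n.+1] is the component of homological degree [n],
   and [C 0 = 0]; the cone has component [C n.+1 x C n] in degree [n]. *)
Variables (C : nat -> bimodule A) (d : forall n, C n.+1 -> C n).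
Variables (theta : forall n, C n -> C n) (X : zmodType) (eps : C 1 -> X).
Variables (phi : X -> X) (M : bimodule A) (pi : X -> M).
Hypothesis C0 : forall u : C 0, u = 0.
Hypothesis dP : forall n, bimod_hom (@d n).
Hypothesis thetaP : forall n, bimod_hom (@theta n).
Hypothesis dtheta : forall n (u : C n.+1), d (theta u) = theta (d u).
Hypothesis epsB : {morph eps : u v / u - v}.
Hypothesis eps_surj : forall t, exists u, eps u = t.
Hypothesis eps_exact : forall u, eps u = 0 <-> exists v, @d 1 v = u.
Hypothesis d_exact : forall n (u : C n.+2), d u = 0 <-> exists v, @d n.+2 v = u.
Hypothesis phi_inj : forall t, phi t = 0 -> t = 0.
Hypothesis eps_theta : forall u, eps (theta u) = phi (eps u).
Hypothesis piP : bimod_hom (fun u : C 1 => pi (eps u)).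
Hypothesis pi_surj : forall m, exists t, pi t = m.
Hypothesis pi_exact : forall t, pi t = 0 <-> exists s, phi s = t.
Hypothesis prC : forall n, projective (C n).

Definition cone_obj n : bimodule A := prod_bimodule (C n.+1) (C n).
(** The sign makes [d theta] and [theta d] cancel in the square. *)
Definition cone_diff n (u : cone_obj n.+1) : cone_obj n :=
  (d u.1 + theta u.2, - d u.2).

Lemma cone_diff_hom n : bimod_hom (@cone_diff n).
Proof.
apply: prod_hom_pair.
  apply: bimod_homD.
    exact: bimod_hom_comp (dP _) (prod_hom_fst _ _).
  exact: bimod_hom_comp (thetaP _) (prod_hom_snd _ _).
apply: bimod_homN.
exact: bimod_hom_comp (dP _) (prod_hom_snd _ _).
Qed.

Lemma d2 n (u : C n.+2) : d (d u) = 0.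
Proof.
case: n u => [|n] u; first exact: C0.
by apply/d_exact; exists u.
Qed.

Lemma eps_d (u : C 2) : eps (d u) = 0.
Proof. by apply/eps_exact; exists u. Qed.

Lemma epsD u v : eps (u + v) = eps u + eps v.
Proof.
have eps0 : eps 0 = 0 by rewrite -[0](subrr 0) epsB subrr.
by rewrite -[v]opprK epsB -[in RHS](add0r v) -[0 + v]opprK opprD oppr0 sub0r
  -[- v](sub0r v) !epsB eps0 !sub0r !opprK.
Qed.

Lemma cone_exact0 (u : cone_obj 0) :
  pi (eps u.1) = 0 <-> exists v, @cone_diff 0 v = u.
Proof.
case: u => a b /=; rewrite (C0 b) {b}; split.
  move=> /pi_exact[s sE]; have [w wE] := eps_surj s.
  have /eps_exact[v vE] : eps (a - theta w) = 0.
    by rewrite epsB eps_theta wE sE subrr.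
  by exists (v, w); rewrite /cone_diff /= vE subrK (C0 (d w)) oppr0.
case=> -[v w] /=; rewrite /cone_diff /= => -[<- _].
by rewrite epsD eps_d add0r eps_theta; apply/pi_exact; exists (eps w).
Qed.

Lemma cone_exactS n (u : cone_obj n.+1) :
  cone_diff u = 0 <-> exists v, @cone_diff n.+1 v = u.
Proof.
split; last first.
  case=> -[v w] <-; rewrite /cone_diff /=; congr pair.
    by rewrite (homD (dP _)) d2 add0r dtheta (homN (thetaP _)) subrr.
  by rewrite (homN (dP _)) d2 !oppr0.
case: u => a b; rewrite /cone_diff /= => -[dab /eqP].
rewrite oppr_eq0 => /eqP db.
have [w wE] : exists w, d w = b.
  case: n a b dab db => [|n] a b dab db; last exact/d_exact.
  (* In its lowest degree [C] has homology [X] instead of being exact. From [d a + theta b = 0]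
     follows [phi (eps b) = 0], and injectivity of [phi] makes [b] a boundary. *)
  apply/eps_exact; apply: phi_inj; rewrite -eps_theta.
  move/eqP: dab; rewrite addrC addr_eq0 => /eqP ->.
  by rewrite -[- d a]sub0r epsB -[0](subrr 0) epsB subrr sub0r eps_d oppr0.
have /d_exact[v vE] : d (a + theta w) = 0.
  by rewrite (homD (dP _)) dtheta wE.
exists (v, - w); rewrite /cone_diff /= vE (homN (thetaP _)) addrK.
by rewrite (homN (dP _)) opprK wE.
Qed.

(** [C] resolves [X], and [phi] is injective with cokernel [M], so the cone has homology [M] in
    degree 0 only. [X] can be a mere abelian group because only the composite [pi (eps u)] has to be
    a bimodule map. *)
Definition cone_resolution : proj_resolution M.
Proof.
apply: (@ProjResolution _ _ M cone_obj cone_diff (fun u => pi (eps u.1))).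
- by move=> n; exact: prod_projective.
- exact: cone_diff_hom.
- exact: bimod_hom_comp piP (prod_hom_fst _ _).
- move=> m; have [t tE] := pi_surj m; have [u uE] := eps_surj t.
  by exists (u, 0); rewrite /= uE.
- exact: cone_exact0.
- exact: cone_exactS.
Defined.

End Cone.

Section Evaluation.
Variable R : nzRingType.
Implicit Types (c r : R) (p : polyR R).

Definition peval c p : R := (p : {poly R}).[c].

Lemma pevalD c : {morph peval c : p q / p + q}.
Proof. by move=> p q; exact: hornerD. Qed.
Lemma pevalB c : {morph peval c : p q / p - q}.
Proof. by move=> p q; rewrite /peval -hornerN -hornerD. Qed.
Lemma peval_pterm c r n : peval c (pterm r n) = r * c ^+ n.
Proof.
rewrite /peval /pterm; elim: n => [|n IHn]; first by rewrite expr0 mulr1 hornerC mulr1.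
by rewrite !exprSr mulrA hornerMX IHn -mulrA.
Qed.
Lemma peval_pconst c r : peval c (pconst r) = r.
Proof. exact: hornerC. Qed.

(** The factor theorem over a noncommutative ring, with the sign of [z (x) 1 - 1 (x) z]. Evaluation
    puts the powers of [c] to the right of the coefficients, so its kernel is a left ideal. *)
Lemma peval_eq0 c p : peval c p = 0 <-> exists q, q * (pconst c - pvar R) = p.
Proof.
have E (q : {poly R}) : (- q) * (c%:P - 'X) = q * ('X - c%:P).
  by rewrite -[c%:P - 'X]opprB mulrNN.
split=> [/eqP/factor_theorem[q ->]|[q <-]]; first by exists (- q); exact: E.
apply/eqP/factor_theorem; exists (- (q : {poly R})).
by rewrite -E opprK.
Qed.

Lemma mulr_linear_eq0 c p : p * (pconst c - pvar R) = 0 -> p = 0.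
Proof.
have mX : ('X - c%:P : {poly R}) \is monic by exact: monicXsubC.
move=> p0; apply: (monic_rreg mX); rewrite mul0r; apply: oppr_inj.
by rewrite oppr0 -mulrN opprB.
Qed.

Lemma peval_mul_pconst c r p :
  c * r = r * c -> peval c (p * pconst r) = peval c p * r.
Proof.
move=> cr; elim/pterm_ind: p => [p q IHp IHq||a n].
- by rewrite mulrDl !pevalD mulrDl IHp IHq.
- by rewrite mul0r /peval horner0 mul0r.
rewrite pterm_pconst !peval_pterm -!mulrA; congr (_ * _).
exact: (commrX n (esym cr)).
Qed.

Lemma pconstXn c n : (pconst c : polyR R) ^+ n = pconst (c ^+ n).
Proof. by elim: n => [|n IHn]; rewrite ?pconst1 // !exprS IHn pconstM. Qed.

Lemma pterm_mul_pvar r n c :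
  pterm r n * (pconst c - pvar R) = pterm (r * c) n - pterm r n.+1.
Proof. by rewrite mulrBr pterm_pconst pterm_pvar. Qed.
End Evaluation.

(** * The maps of the Koszul complex *)

Section Koszul.
Variables (k : fieldType) (A : algType k) (H : pbw_algebra A).
Local Notation x := (gx H).
Local Notation y := (gy H).
Local Notation D := (gD H).
Local Notation E := (gE H).
Local Notation F := (free_bimodule H).
Local Notation u := (free_gen H).

(** The map [a (x) b |-> a z (x) b - a (x) z b], a commutator in the middle of the tensor. *)
Definition inner_map (z : A) : F -> F := free_map (lact z u - ract u z).
Local Notation X1 := (inner_map x).
Local Notation Y1 := (inner_map y).
Local Notation Th := (inner_map D).
(** The noncommutative partial derivative of the relator [Dy - yD - yy - xy] with respect to [y];
    that with respect to [x] is [- 1 (x) y], which gives [mixed_map] up to sign. *)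
Definition twist_map : F -> F :=
  free_map (lact D u - ract u D - lact y u - ract u y - lact x u).
Local Notation Ps := twist_map.
Definition mixed_map : F -> F := free_map (ract u y).
Local Notation rho := mixed_map.
(** The generator in degree [n] stands for a product of [n] elements of weight one. Subtracting [n]
    accounts for its own weight and makes the operator commute with the differentials. *)
Definition weight_map n : F -> F := free_map (lact E u - ract u E - u *+ n).
Local Notation Wt := weight_map.

Lemma inner_map_hom z : bimod_hom (inner_map z). Proof. exact: free_map_hom. Qed.
Lemma twist_map_hom : bimod_hom Ps. Proof. exact: free_map_hom. Qed.
Lemma mixed_map_hom : bimod_hom rho. Proof. exact: free_map_hom. Qed.
Lemma weight_map_hom n : bimod_hom (Wt n). Proof. exact: free_map_hom. Qed.

Section Expand.
Variables (N : bimodule A) (n : N).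
Lemma free_mapN (f : F) : free_map n (- f) = - free_map n f.
Proof. exact: (homN (free_map_hom H n)). Qed.
Lemma free_map_ract (f : F) a : free_map n (ract f a) = ract (free_map n f) a.
Proof. by case: (free_map_hom H n). Qed.
Lemma free_mapMn (f : F) m : free_map n (f *+ m) = free_map n f *+ m.
Proof.
elim: m => [|m IHm]; last by rewrite !mulrS free_mapD IHm.
by rewrite !mulr0n (hom0 (free_map_hom H n)).
Qed.
Lemma lactMn a m : lact a (n *+ m) = lact a n *+ m.
Proof. by elim: m => [|m IHm]; rewrite ?lact0 // !mulrS lactD IHm. Qed.
Lemma ractMn a m : ract (n *+ m) a = ract n a *+ m.
Proof. by elim: m => [|m IHm]; rewrite ?ract0 // !mulrS ractD IHm. Qed.
End Expand.

Local Definition expandE := (free_mapD, free_mapN, free_map_lact, free_map_ract,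
  free_mapMn, free_map_gen, lactD, lactN, ractD, ractN, lactMn, ractMn, lract,
  lactDl, ractDr, lactNl, ractNr).

Ltac on_generator :=
  apply: free_hom_ext;
  [ do ?[exact: free_map_hom | apply: bimod_homB | apply: bimod_hom_comp]
  | do ?[exact: free_map_hom | apply: bimod_homB | apply: bimod_hom_comp]
  | rewrite /inner_map /twist_map /mixed_map /weight_map !expandE -?lactM -?ractM ].

Lemma X1Y1 : (fun f => X1 (Y1 f)) =1 (fun f => Y1 (X1 f)).
Proof. by on_generator; rewrite -(rel_xy H); abel. Qed.
Lemma X1Th : (fun f => X1 (Th f)) =1 (fun f => Th (X1 f)).
Proof. by on_generator; rewrite (rel_Dx H); abel. Qed.
Lemma X1Ps : (fun f => X1 (Ps f)) =1 (fun f => Ps (X1 f)).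
Proof. by on_generator; rewrite (rel_Dx H) (rel_xy H); abel. Qed.
Lemma X1rho : (fun f => X1 (rho f)) =1 (fun f => rho (X1 f)).
Proof. by on_generator; rewrite (rel_xy H); abel. Qed.
(** Of the middle commutators with [x], [y] and [D], only those with [y] and [D] fail to commute.
    This corrected rule is what makes the square of the Koszul differential vanish. *)
Lemma ThY1 : (fun f => Th (Y1 f)) =1 (fun f => Y1 (Ps f) - rho (X1 f)).
Proof.
by on_generator; rewrite (rel_Dy H) (rel_xy H) !expandE -?lactM -?ractM; abel.
Qed.
Lemma X1Wt n : (fun f => X1 (Wt n.+1 f)) =1 (fun f => Wt n (X1 f)).
Proof. by on_generator; rewrite (rel_Ex H) !mulrS !expandE ?mulrnDl ?mulNrn; abel. Qed.
Lemma Y1Wt n : (fun f => Y1 (Wt n.+1 f)) =1 (fun f => Wt n (Y1 f)).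
Proof. by on_generator; rewrite (rel_Ey H) !mulrS !expandE ?mulrnDl ?mulNrn; abel. Qed.
Lemma ThWt n : (fun f => Th (Wt n.+1 f)) =1 (fun f => Wt n (Th f)).
Proof. by on_generator; rewrite (rel_ED H) !mulrS !expandE ?mulrnDl ?mulNrn; abel. Qed.
Lemma rhoWt n : (fun f => rho (Wt n.+1 f)) =1 (fun f => Wt n (rho f)).
Proof. by on_generator; rewrite (rel_Ey H) !mulrS !expandE ?mulrnDl ?mulNrn; abel. Qed.
Lemma PsWt n : (fun f => Ps (Wt n.+1 f)) =1 (fun f => Wt n (Ps f)).
Proof.
by on_generator; rewrite (rel_ED H) (rel_Ey H) (rel_Ex H) !mulrS !expandE ?mulrnDl ?mulNrn; abel.
Qed.

End Koszul.

(** * Exactness through evaluation of one variable at a time *)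

Section KoszulExact.
Variables (k : fieldType) (A : algType k) (H : pbw_algebra A).
Local Notation x := (gx H).
Local Notation y := (gy H).
Local Notation D := (gD H).
Local Notation E := (gE H).
Local Notation mo := (pbw_mon x y D E).
Local Notation F := (free_bimodule H).
Local Notation X1 := (@inner_map _ _ H x).
Local Notation Y1 := (@inner_map _ _ H y).
Local Notation Th := (@inner_map _ _ H D).
Local Notation Wt := (@weight_map _ _ H).
Local Notation R1 := (polyR A).
Local Notation R2 := (polyR (polyR A)).
Local Notation R3 := (polyR (polyR (polyR A))).

(* [ev1] pushes [A (x) A] to [A (x)_{k[x]} A], [ev2] to [A (x)_S A],
   [ev3] to [A (x)_B A], where [B] is generated by [x], [y] and [D]. *)
Definition ev1 (f : F) : R3 := peval (pconst (pconst (pconst x))) (f : tensR A).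
Definition ev2 (f : F) : R2 := peval (pconst (pconst y)) (ev1 f).
Definition ev3 (f : F) : R1 := peval (pconst D) (ev2 f).
Definition ev4 (p : R1) : A := peval E p.

Lemma ev1B : {morph ev1 : f g / f - g}. Proof. exact: pevalB. Qed.
Lemma ev2B : {morph ev2 : f g / f - g}.
Proof. by move=> f g; rewrite /ev2 ev1B pevalB. Qed.
Lemma ev3B : {morph ev3 : f g / f - g}.
Proof. by move=> f g; rewrite /ev3 ev2B pevalB. Qed.
Lemma ev1D : {morph ev1 : f g / f + g}. Proof. exact: pevalD. Qed.
Lemma ev2D : {morph ev2 : f g / f + g}.
Proof. by move=> f g; rewrite /ev2 ev1D pevalD. Qed.
Lemma ev3D : {morph ev3 : f g / f + g}.
Proof. by move=> f g; rewrite /ev3 ev2D pevalD. Qed.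

Lemma ev1_term a i j p q :
  ev1 (term a i j p q) = pterm (pterm (pterm (a * x ^+ i) q) p) j.
Proof. by rewrite /ev1 termE peval_pterm !pconstXn !pterm_pconst. Qed.
Lemma ev2_term a i j p q :
  ev2 (term a i j p q) = pterm (pterm (a * x ^+ i * y ^+ j) q) p.
Proof. by rewrite /ev2 ev1_term peval_pterm !pconstXn !pterm_pconst. Qed.
Lemma ev3_term a i j p q :
  ev3 (term a i j p q) = pterm (a * x ^+ i * y ^+ j * D ^+ p) q.
Proof. by rewrite /ev3 ev2_term peval_pterm !pconstXn !pterm_pconst. Qed.

Lemma inner_map_term z a i j p q :
  @inner_map _ _ H z (term a i j p q : F) =
  (term (a * z) i j p q : F) - smul a (pbw_coord H (z * mo i j p q)).
Proof.
rewrite /inner_map free_map_term lactD ractD lactN ractN -lactM -term_gen.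
congr (_ - _); rewrite lract -ractM.
by rewrite -(pbw_coord_gen H).
Qed.

Lemma smul_coord_mon a i j p q :
  smul a (pbw_coord H (mo i j p q)) = term a i j p q.
Proof. by rewrite pbw_coord_mon smul_term mulr1. Qed.

Lemma commr_expr_step (R : nzRingType) (a b : R) n : a * b = b * a ->
  a * b ^+ n = b ^+ n * a.
Proof. exact: commrX. Qed.

Lemma x_mon i j p q : x * mo i j p q = mo i.+1 j p q.
Proof. by rewrite /pbw_mon exprS !mulrA. Qed.
Lemma y_mon i j p q : y * mo i j p q = mo i j.+1 p q.
Proof.
rewrite /pbw_mon !mulrA (commr_expr_step i (esym (rel_xy H))) exprS.
by rewrite !mulrA.
Qed.

Lemma D_yn j : D * y ^+ j = y ^+ j * D + (y ^+ j.+1 + x * y ^+ j) *+ j.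
Proof.
elim: j => [|j IHj]; first by rewrite expr0 mulr1 mul1r mulr0n addr0.
rewrite exprSr mulrA IHj !mulrDl -mulrA rel_Dy mulrnAl !mulrDr mulrDl.
have -> : y ^+ j * (x * y) = x * y ^+ j.+1.
  by rewrite mulrA -(commr_expr_step j (rel_xy H)) -mulrA -exprSr.
rewrite !mulrA -!(mulrA x) -!exprSr [in RHS]mulrSr.
abel.
Qed.

Lemma D_mon i j p q :
  D * mo i j p q = mo i j p.+1 q + (mo i j.+1 p q + mo i.+1 j p q) *+ j.
Proof.
rewrite /pbw_mon !mulrA (commr_expr_step i (rel_Dx H)) -(mulrA _ D) D_yn.
rewrite mulrDr mulrnAr mulrDr !mulrDl !mulrnAl !mulrDl.
congr (_ + (_ + _) *+ _); first by rewrite !mulrA -(mulrA _ D) -exprS.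
by rewrite !mulrA -exprSr.
Qed.

Lemma E_expr (z : A) n : E * z = z * E + z -> E * z ^+ n = z ^+ n * E + z ^+ n *+ n.
Proof.
move=> Ez; elim: n => [|n IHn]; first by rewrite expr0 mulr1 mul1r mulr0n addr0.
rewrite exprSr mulrA IHn mulrDl -mulrA Ez mulrDr mulrnAl mulrA -exprSr mulrSr.
abel.
Qed.

Lemma E_mon i j p q :
  E * mo i j p q = mo i j p q.+1 + mo i j p q *+ (i + j + p).
Proof.
rewrite /pbw_mon !mulrA (E_expr i (rel_Ex H)) !mulrDl -(mulrA _ E (y ^+ j)).
rewrite (E_expr j (rel_Ey H)) mulrDr !mulrDl mulrA -(mulrA _ E (D ^+ p)).
rewrite (E_expr p (rel_ED H)) mulrDr !mulrDl mulrA -(mulrA _ E (E ^+ q)) -exprS.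
rewrite !(mulrnAr, mulrnAl) !mulrnDr.
abel.
Qed.

(** As [x] comes first in the PBW order, [x] times a basis monomial is again a basis monomial, and
    only the outermost variable is affected. [Y1_mul] holds likewise because [y] passes the powers
    of [x]. *)
Lemma X1_mul (f : F) : X1 f =
  (f : tensR A) * (pconst (pconst (pconst (pconst x))) - pvar _) :> tensR A.
Proof.
elim/tens_ind: f => [f g IHf IHg|a i j p q].
  by rewrite (homD (inner_map_hom H x)) IHf IHg; symmetry; exact: mulrDl.
rewrite inner_map_term x_mon smul_coord_mon !termE pterm_mul_pvar.
by rewrite !pterm_pconst.
Qed.

Lemma Y1_mul (f : F) : Y1 f =
  (f : tensR A) * pconst (pconst (pconst (pconst y)) - pvar _) :> tensR A.
Proof.
elim/tens_ind: f => [f g IHf IHg|a i j p q].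
  by rewrite (homD (inner_map_hom H y)) IHf IHg; symmetry; exact: mulrDl.
rewrite inner_map_term y_mon smul_coord_mon !termE pterm_pconst pterm_mul_pvar.
by rewrite ptermB !pterm_pconst.
Qed.

Lemma X1_inj (f : F) : X1 f = 0 -> f = 0.
Proof. by rewrite X1_mul; exact: mulr_linear_eq0. Qed.

Lemma ev1_eq0 (f : F) : ev1 f = 0 <-> exists g, X1 g = f.
Proof.
split=> [/peval_eq0[g gE]|[g <-]].
  by exists (g : F); rewrite X1_mul.
by apply/peval_eq0; exists (g : tensR A); rewrite X1_mul.
Qed.

Lemma ev1_surj t : exists f, ev1 f = t.
Proof. by exists (pconst t : tensR A); exact: peval_pconst. Qed.
Lemma ev2_surj t : exists f, ev2 f = t.
Proof.
have [f fE] := ev1_surj (pconst t); exists f.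
by rewrite /ev2 fE peval_pconst.
Qed.
Lemma ev3_surj t : exists f, ev3 f = t.
Proof.
have [f fE] := ev2_surj (pconst t); exists f.
by rewrite /ev3 fE peval_pconst.
Qed.
Lemma ev4_surj t : exists p, ev4 p = t.
Proof. by exists (pconst t); exact: peval_pconst. Qed.

Lemma ev1_Y1 f : ev1 (Y1 f) = ev1 f * (pconst (pconst (pconst y)) - pvar _).
Proof.
rewrite /ev1 Y1_mul peval_mul_pconst //.
rewrite mulrBr mulrBl -!pconstM (rel_xy H); congr (_ - _).
exact: commr_polyX.
Qed.

Lemma ev2_X1 f : ev2 (X1 f) = 0.
Proof.
rewrite /ev2; have -> : ev1 (X1 f) = 0 by apply/ev1_eq0; exists f.
exact: horner0.
Qed.
Lemma ev2_Y1 f : ev2 (Y1 f) = 0.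
Proof. by apply/peval_eq0; exists (ev1 f); rewrite ev1_Y1. Qed.
Lemma ev3_0 f : ev2 f = 0 -> ev3 f = 0.
Proof. by rewrite /ev3 => ->; exact: horner0. Qed.

(** Division in two steps: a lift [b] of the quotient in the variable of [y] is used first, and the
    remainder vanishes under [ev1], hence is divisible by the factor of [x]. *)
Lemma ev2_eq0 f : ev2 f = 0 -> exists a b, X1 a + Y1 b = f.
Proof.
move=> /peval_eq0[s sE]; have [b bE] := ev1_surj s.
have /ev1_eq0[a aE] : ev1 (f - Y1 b) = 0.
  by rewrite ev1B ev1_Y1 bE sE subrr.
by exists a, b; rewrite aE subrK.
Qed.

(** Moving [D] past [y^j] creates extra terms in both factors of the tensor. They cancel once [x]
    and [y] are identified on the two sides, which is why this holds only after [ev2]. *)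
Lemma ev2_Th f : ev2 (Th f) = ev2 f * (pconst (pconst D) - pvar _).
Proof.
elim/tens_ind: f => [f g IHf IHg|a i j p q].
  by rewrite (homD (inner_map_hom H D)) !ev2D IHf IHg mulrDl.
rewrite inner_map_term D_mon.
have -> : smul a (pbw_coord H (mo i j p.+1 q + (mo i j.+1 p q + mo i.+1 j p q) *+ j))
    = term a i j p.+1 q + (term a i j.+1 p q + term a i.+1 j p q) *+ j :> F.
  rewrite pbw_coordD smulDr smul_coord_mon; congr (_ + _).
  rewrite -[_ *+ j]scaler_nat pbw_coordZ smul_scale pbw_coordD smulDr !smul_coord_mon.
  by rewrite scaler_nat.
rewrite ev2B ev2D !ev2_term pterm_mul_pvar pterm_pconst.
have -> : ev2 ((term a i j.+1 p q + term a i.+1 j p q : F) *+ j) =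
   pterm (pterm (a * x ^+ i * (y ^+ j.+1 + x * y ^+ j) *+ j) q) p.
  have ev2Mn (f : F) m : ev2 (f *+ m) = ev2 f *+ m.
    elim: m => [|m IHm]; last by rewrite !mulrS ev2D IHm.
    by rewrite !mulr0n -(subrr (0 : F)) ev2B subrr.
  rewrite ev2Mn ev2D !ev2_term -ptermD -ptermD.
  have termMn (R : nzRingType) (r : R) n m : pterm r n *+ m = pterm (r *+ m) n.
    elim: m => [|m IHm]; first by rewrite !mulr0n pterm0.
    by rewrite !mulrS IHm ptermD.
  by rewrite !termMn mulrDr (exprSr x) !mulrA.
rewrite opprD addrCA [RHS]addrC; congr (_ + _).
rewrite -!ptermB; congr (pterm (pterm _ q) p).
rewrite -[a * D * _]mulrA (commr_expr_step i (rel_Dx H)) -!mulrA D_yn.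
by rewrite !mulrDr !mulrnAr !mulrDr !mulrA addrK.
Qed.

Lemma ev3_X1 f : ev3 (X1 f) = 0. Proof. exact/ev3_0/ev2_X1. Qed.
Lemma ev3_Y1 f : ev3 (Y1 f) = 0. Proof. exact/ev3_0/ev2_Y1. Qed.
Lemma ev3_Th f : ev3 (Th f) = 0.
Proof. by apply/peval_eq0; exists (ev2 f); rewrite ev2_Th. Qed.

Lemma ev3_eq0 f : ev3 f = 0 -> exists a b c, X1 a + Y1 b + Th c = f.
Proof.
move=> /peval_eq0[s sE]; have [c cE] := ev2_surj s.
have /ev2_eq0[a [b abE]] : ev2 (f - Th c) = 0.
  by rewrite ev2B ev2_Th cE sE subrr.
by exists a, b, c; rewrite abE subrK.
Qed.

(** As for [D]: the terms with the factor [i + j + p] that arise on both sides when [E] crosses a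
    monomial cancel after [ev3]. *)
Lemma ev3_Wt f : ev3 (Wt 0 f) = ev3 f * (pconst E - pvar _).
Proof.
have -> : Wt 0 f = @inner_map _ _ H E f.
  by rewrite /weight_map mulr0n subr0.
elim/tens_ind: f => [f g IHf IHg|a i j p q].
  by rewrite (homD (inner_map_hom H E)) !ev3D IHf IHg mulrDl.
rewrite inner_map_term E_mon.
have -> : smul a (pbw_coord H (mo i j p q.+1 + mo i j p q *+ (i + j + p)))
    = term a i j p q.+1 + term (a *+ (i + j + p)) i j p q :> F.
  rewrite pbw_coordD smulDr smul_coord_mon; congr (_ + _).
  rewrite -scaler_nat pbw_coordZ smul_scale smul_coord_mon tens_scaleE smul_term.
  by rewrite -scalerAl mul1r scaler_nat.
rewrite ev3B ev3D !ev3_term pterm_mul_pvar.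
rewrite opprD addrCA [RHS]addrC; congr (_ + _).
rewrite -ptermB; congr (pterm _ q).
have E_b : E * (x ^+ i * y ^+ j * D ^+ p) =
    x ^+ i * y ^+ j * D ^+ p * E + x ^+ i * y ^+ j * D ^+ p *+ (i + j + p).
  by have := E_mon i j p 0; rewrite /pbw_mon expr0 expr1 mulr1.
rewrite -!mulrA mulrA -[in LHS](mulrA a E).
move: E_b; rewrite -!mulrA => ->.
by rewrite mulrDr mulrnAr mulrnAl !mulrA addrK.
Qed.

End KoszulExact.

Section KoszulComplex.
Variables (k : fieldType) (A : algType k) (H : pbw_algebra A).
Local Notation x := (gx H).
Local Notation y := (gy H).
Local Notation D := (gD H).
Local Notation E := (gE H).
Local Notation F := (free_bimodule H).
Local Notation X1 := (@inner_map _ _ H x).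
Local Notation Y1 := (@inner_map _ _ H y).
Local Notation Th := (@inner_map _ _ H D).
Local Notation Ps := (@twist_map _ _ H).
Local Notation rho := (@mixed_map _ _ H).
Local Notation Wt := (@weight_map _ _ H).
Local Notation F3 := (prod_bimodule (prod_bimodule F F) F).

(* The resolution of [A (x)_B A]: the components of [B_obj 2] belong to the
   generators [x], [y], [D] and those of [B_obj 3] to the relations between
   [x, y], [x, D] and [y, D]; homological degrees are shifted by one. *)
Definition B_obj (n : nat) : bimodule A :=
  match n with 1 | 4 => F | 2 | 3 => F3 | _ => zero_bimodule A end.

(** The matrix in case [2] consists of the noncommutative partial derivatives of the relators
    [xy - yx], [Dx - xD] and [Dy - yD - yy - xy]; case [3] is the single relation between these
    relations. *)
Definition B_diff n : B_obj n.+1 -> B_obj n :=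
  match n return B_obj n.+1 -> B_obj n with
  | 0 => fun _ => 0
  | 1 => fun v : F3 => X1 v.1.1 + Y1 v.1.2 + Th v.2
  | 2 => fun v : F3 =>
      ((- Y1 v.1.1 + Th v.1.2 - rho v.2, X1 v.1.1 + Ps v.2),
       - (X1 v.1.2 + Y1 v.2)) : F3
  | 3 => fun s : F => ((Ps s, Y1 s), - X1 s) : F3
  | n.+4 => fun _ => 0
  end.

Definition B_weight n : B_obj n -> B_obj n :=
  match n return B_obj n -> B_obj n with
  | 1 => Wt 0
  | 2 => fun v : F3 => ((Wt 1 v.1.1, Wt 1 v.1.2), Wt 1 v.2) : F3
  | 3 => fun v : F3 => ((Wt 2 v.1.1, Wt 2 v.1.2), Wt 2 v.2) : F3
  | 4 => Wt 3
  | _ => fun _ => 0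
  end.

Lemma B_diff_hom n : bimod_hom (@B_diff n).
Proof.
pose P11 := bimod_hom_comp (prod_hom_fst F F) (prod_hom_fst (prod_bimodule F F) F).
pose P12 := bimod_hom_comp (prod_hom_snd F F) (prod_hom_fst (prod_bimodule F F) F).
pose P2 := prod_hom_snd (prod_bimodule F F) F.
pose hX := inner_map_hom H x; pose hY := inner_map_hom H y.
pose hT := inner_map_hom H D; pose hP := twist_map_hom H; pose hr := mixed_map_hom H.
case: n => [|[|[|[|n]]]].
- exact: bimod_hom0.
- exact (bimod_homD (bimod_homD (bimod_hom_comp hX P11) (bimod_hom_comp hY P12))
    (bimod_hom_comp hT P2)).
- apply: prod_hom_pair; first apply: prod_hom_pair.
  + exact (bimod_homB (bimod_homD (bimod_homN (bimod_hom_comp hY P11))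
      (bimod_hom_comp hT P12)) (bimod_hom_comp hr P2)).
  + exact (bimod_homD (bimod_hom_comp hX P11) (bimod_hom_comp hP P2)).
  + exact (bimod_homN (bimod_homD (bimod_hom_comp hX P12) (bimod_hom_comp hY P2))).
- exact (prod_hom_pair (prod_hom_pair hP hY) (bimod_homN hX)).
- exact: bimod_hom0.
Qed.

Lemma prod3_hom (f : F -> F) : bimod_hom f ->
  bimod_hom (fun v : F3 => ((f v.1.1, f v.1.2), f v.2) : F3).
Proof.
move=> [lf fl fr]; split.
- by move=> c v w; rewrite /= !lf.
- by move=> a v; rewrite /= !fl.
- by move=> v a; rewrite /= !fr.
Qed.

Lemma B_weight_hom n : bimod_hom (@B_weight n).
Proof.
case: n => [|[|[|[|[|n]]]]].
- exact: bimod_hom0.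
- exact: weight_map_hom.
- exact: prod3_hom (weight_map_hom H 1).
- exact: prod3_hom (weight_map_hom H 2).
- exact: weight_map_hom.
- exact: bimod_hom0.
Qed.

Local Definition mapE := (homD (inner_map_hom H x), homN (inner_map_hom H x),
  homD (inner_map_hom H y), homN (inner_map_hom H y),
  homD (inner_map_hom H D), homN (inner_map_hom H D),
  homD (twist_map_hom H), homN (twist_map_hom H),
  homD (mixed_map_hom H), homN (mixed_map_hom H),
  (fun n => homD (weight_map_hom H n)), (fun n => homN (weight_map_hom H n))).

Lemma B_diff_weight n (v : B_obj n.+1) : B_diff (B_weight v) = B_weight (B_diff v).
Proof.
have WX := @X1Wt _ _ H; have WY := @Y1Wt _ _ H; have WT := @ThWt _ _ H.
have WP := @PsWt _ _ H; have Wr := @rhoWt _ _ H.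
case: n v => [|[|[|[|n]]]] v //=.
- by rewrite !mapE (WX 0) (WY 0) (WT 0).
- by rewrite !mapE !(WX 1, WY 1, WT 1, WP 1, Wr 1).
- by rewrite !mapE !(WX 2, WY 2, WT 2, WP 2, Wr 2).
- case: n v => [|n] v //=; exact: esym (hom0 (weight_map_hom H 3)).
Qed.

Lemma B_obj_projective n : projective (B_obj n).
Proof.
have pF := free_projective (H := H).
by case: n => [|[|[|[|[|n]]]]] /=;
  do ?[exact: zero_projective | exact: pF | apply: prod_projective].
Qed.

Lemma ev3_exact (f : B_obj 1) :
  ev3 (f : F) = 0 <-> exists v : B_obj 2, B_diff v = f.
Proof.
split=> [/ev3_eq0[a [b [c <-]]]|[v <-]]; first by exists ((a, b), c).
by rewrite /= !ev3D ev3_X1 ev3_Y1 ev3_Th !addr0.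
Qed.

(** [x], [y], [D] act as a regular sequence: [X1], then [Y1] under [ev1], then [Th] under [ev2], is
    multiplication by a linear polynomial and hence cancellable. The components of a cycle are
    solved for in the reverse order, [D] first, and the commutation rules carry the corrections over
    to the remaining components. *)
Lemma B_exact n (v : B_obj n.+2) :
  B_diff v = 0 <-> exists w : B_obj n.+3, B_diff w = v.
Proof.
have YX f : Y1 (X1 f) = X1 (Y1 f) by rewrite (@X1Y1 _ _ H f).
have TX f : Th (X1 f) = X1 (Th f) by rewrite (@X1Th _ _ H f).
have PX f : Ps (X1 f) = X1 (Ps f) by rewrite (@X1Ps _ _ H f).
have rX f : rho (X1 f) = X1 (rho f) by rewrite (@X1rho _ _ H f).
have TY f : Th (Y1 f) = Y1 (Ps f) - rho (X1 f) by rewrite (@ThY1 _ _ H f).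
split; last first.
  move=> [w <-]; case: n w {v} => [|[|[|n]]] w //=.
  - by rewrite !mapE TY YX !TX rX; abel.
  - rewrite !mapE TY PX YX !opprK; congr (_, _, _).
    + abel.
    + abel.
    + abel.
  - by rewrite (hom0 (twist_map_hom H))
      !(hom0 (inner_map_hom H _)) oppr0.
case: n v => [|[|[|n]]] v /=.
- case: v => -[a b] c /= abc0.
  have : ev2 c = 0.
    apply: (mulr_linear_eq0 (c := pconst D)); rewrite -ev2_Th.
    by have := congr1 (@ev2 _ _ H) abc0; rewrite /= !ev2D ev2_X1 ev2_Y1 !add0r => ->;
      rewrite -(subrr (0 : F)) ev2B subrr.
  move=> /ev2_eq0[q [r cE]].
  have abE : X1 (a + Th q - rho r) + Y1 (b + Ps r) = 0.
    by rewrite -abc0 -cE !mapE TY TX rX; abel.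
  have /ev1_eq0[p pE] : ev1 (b + Ps r) = 0.
    apply: (mulr_linear_eq0 (c := pconst (pconst y))); rewrite -ev1_Y1.
    have := congr1 (@ev1 _ _ H) abE; rewrite ev1D.
    have /ev1_eq0 -> : exists g, X1 g = X1 (a + Th q - rho r) by exists (a + Th q - rho r).
    by rewrite add0r => ->; rewrite -(subrr (0 : F)) ev1B subrr.
  have aE : a + Th q - rho r + Y1 p = 0.
    by apply: X1_inj; rewrite (homD (inner_map_hom H x)) (@X1Y1 _ _ H p) pE.
  exists ((p, - q), - r); rewrite /= !mapE !opprK; congr (_, _, _).
  + transitivity (a - (a + Th q - rho r + Y1 p)); first abel.
    by rewrite aE subr0.
  + by rewrite pE; abel.
  + by rewrite -cE; abel.
- case: v => -[p q] r /= -[E1 E2 E3].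
  have /ev1_eq0[s sE] : ev1 r = 0.
    apply: (mulr_linear_eq0 (c := pconst (pconst y))); rewrite -ev1_Y1.
    move/eqP: E3; rewrite oppr_eq0 addr_eq0 => /eqP E3.
    by apply/ev1_eq0; exists (- q); rewrite !mapE E3 opprK.
  have qE : q + Y1 s = 0.
    apply: X1_inj; rewrite (homD (inner_map_hom H x)) (@X1Y1 _ _ H s) sE.
    by apply: oppr_inj; rewrite E3 oppr0.
  have pE : p + Ps s = 0.
    by apply: X1_inj; rewrite (homD (inner_map_hom H x)) (@X1Ps _ _ H s) sE.
  exists (- s); rewrite /= !mapE opprK sE; congr (_, _, _).
    by apply/eqP; rewrite eq_sym -addr_eq0 pE.
  by apply/eqP; rewrite eq_sym -addr_eq0 qE.
- move=> -[_ _ /eqP]; rewrite oppr_eq0 => /eqP /X1_inj v0.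
  by exists 0; rewrite v0.
- by move=> _; exists 0; rewrite [v]zero_bimoduleE.
Qed.

(** [A (x)_B A] is [polyR A], on which the weight operator becomes multiplication by [E] minus the
    variable. That map is injective, and evaluation at [E] identifies its cokernel with [A]. *)
Definition K_resolution : proj_resolution (regular_bimodule A).
Proof.
apply: (@cone_resolution k A B_obj B_diff B_weight (polyR A) (@ev3 _ _ H)
  (fun p => p * (pconst E - pvar A)) (regular_bimodule A) (ev4 H)).
- exact: zero_bimoduleE.
- exact: B_diff_hom.
- exact: B_weight_hom.
- exact: B_diff_weight.
- exact: ev3B.
- exact: ev3_surj.
- exact: ev3_exact.
- exact: B_exact.
- exact: mulr_linear_eq0.
- exact: ev3_Wt.
(* The four evaluations together are the multiplication [A (x) A -> A], a bimodule map by the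
   universal property of [F]. *)
- have E1 : @free_map _ _ H (regular_bimodule A) 1 =1 (fun f : F => ev4 H (ev3 f)).
    elim/tens_ind => [f g IHf IHg|a i j p q].
      by rewrite free_mapD ev3D /ev4 pevalD IHf IHg.
    by rewrite free_map_term ev3_term /ev4 peval_pterm /= mulr1 /pbw_mon !mulrA.
  exact: bimod_hom_eq E1 (free_map_hom _ _).
- exact: ev4_surj.
- by move=> t; exact: peval_eq0.
- exact: B_obj_projective.
Defined.

End KoszulComplex.

(** * Cochains of weight zero *)

Section Difference.
Variable k : fieldType.
Hypothesis char0 : [pchar k] =i pred0.
Implicit Types p q : {poly k}.

Lemma natr_neq0 n : (n.+1%:R : k) != 0.
Proof. by have /pcharf0P -> := char0. Qed.

Lemma natr_inj0 : injective (fun n : nat => n%:R : k).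
Proof.
have aux m n : (m <= n)%N -> m%:R = n%:R :> k -> m = n.
  move=> lemn /eqP; rewrite eq_sym -subr_eq0 -natrB // => /eqP E.
  apply/eqP; rewrite eqn_leq lemn /= -subn_eq0.
  by case: (n - m)%N E => // d /eqP; rewrite (negPf (natr_neq0 d)).
by move=> m n /= E; case/orP: (leq_total m n) => /aux; [exact | move=> /(_ (esym E))].
Qed.

(** Since [E z = z (E + 1)] for [z = x, y, D], a polynomial in [E] that crosses such a [z] from left
    to right undergoes this substitution. *)
Definition shift p : {poly k} := p \Po ('X + 1%:P).

Lemma shiftD p q : shift (p + q) = shift p + shift q.
Proof. exact: comp_polyD. Qed.
Lemma shiftN p : shift (- p) = - shift p.
Proof. by rewrite -[- p]mulN1r -polyCN /shift comp_polyM comp_polyC polyCN mulN1r. Qed.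
Lemma shift0 : shift 0 = 0. Proof. exact: comp_poly0. Qed.
Lemma shiftC c : shift c%:P = c%:P. Proof. exact: comp_polyC. Qed.
Lemma shiftB p q : shift (p - q) = shift p - shift q.
Proof. by rewrite shiftD shiftN. Qed.
Lemma shiftZ c p : shift (c *: p) = c *: shift p.
Proof. exact: comp_polyZ. Qed.

Lemma horner_nat_eq0 p : (forall n : nat, p.[n%:R] = 0) -> p = 0.
Proof.
move=> p0; apply/eqP; apply/negPn/negP => nz.
have := @max_poly_roots _ p [seq (i%:R : k) | i <- seq.iota 0 (size p)] nz.
rewrite size_map size_iota ltnn => H; suff: false by []; apply: H.
  by apply/allP => _ /mapP[i _ ->]; rewrite /root p0.
rewrite map_inj_uniq ?iota_uniq //; exact: natr_inj0.
Qed.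

(** A polynomial of period one takes its value at 0 at every natural number, and these are
    infinitely many points in characteristic zero. *)
Lemma shift_fixed p : shift p = p -> exists c, p = c%:P.
Proof.
move=> sp; exists p.[0]; apply/eqP; rewrite -subr_eq0; apply/eqP.
apply: horner_nat_eq0 => n; rewrite hornerD hornerN hornerC.
suff -> : p.[n%:R] = p.[0] by rewrite subrr.
elim: n => // n <-; rewrite -{2}sp /shift horner_comp !hornerE.
by rewrite natr1.
Qed.

Lemma coef_shiftXn m i : (shift 'X^m)`_i = ('C(m, i))%:R.
Proof.
rewrite /shift comp_Xn_poly addrC exprDn.
have -> : \sum_(j < m.+1) (1%:P ^+ (m - j) * 'X^j) *+ 'C(m, j) =
    \poly_(j < m.+1) (('C(m, j))%:R : k).
  rewrite poly_def; apply: eq_bigr => j _.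
  by rewrite polyC1 expr1n mul1r scaler_nat.
by rewrite coef_poly; case: ltnP => // lt_mi; rewrite bin_small.
Qed.

(** The difference of [X^(n+1)] has leading term [(n + 1) X^n]. Dividing by [n + 1] cancels the top
    coefficient of [p], and induction on the size does the rest. *)
Lemma shift_sub_surj p : exists q, shift q - q = p.
Proof.
have [n] := ubnP (size p); elim: n p => // n IHn p lt_p.
case: n IHn lt_p => [|n] IHn lt_p.
  exists 0; rewrite shift0 subr0; apply/esym/eqP.
  by rewrite -size_poly_eq0 -leqn0 -ltnS.
pose c := p`_n / n.+1%:R; pose q0 : {poly k} := c *: 'X^(n.+1).
have [|q qE] := IHn (p - (shift q0 - q0)); last first.
  by exists (q + q0); rewrite shiftD opprD addrACA qE subrK.
rewrite ltnS; apply/leq_sizeP => j le_nj.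
rewrite /q0 shiftZ -scalerBr coefB coefZ coefB coef_shiftXn coefXn.
case: (ltngtP j n.+1) => [lt_jn|lt_nj|->]; last 1 first.
- rewrite binn subrr mulr0 subr0; apply: (leq_sizeP _ _ _ _ (leqnn _)).
  by rewrite -ltnS.
- have -> : j = n by apply/eqP; rewrite eqn_leq le_nj -ltnS lt_jn.
  rewrite binSn /c subr0 divfK ?subrr //; exact: natr_neq0.
- rewrite bin_small // subrr mulr0 subr0.
  by apply: (leq_sizeP _ _ _ _ (ltnW lt_nj)); rewrite -ltnS.
Qed.

End Difference.

Section PolyCoef.
Variable R : nzRingType.
Definition pcoef n (p : polyR R) : R := (p : {poly R})`_n.
Lemma pcoefD n : {morph pcoef n : p q / p + q}.
Proof. by move=> p q; exact: coefD. Qed.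
Lemma pcoef0 n : pcoef n 0 = 0.
Proof. exact: coef0. Qed.
Lemma pcoef_pterm n m a : pcoef n (pterm a m) = if n == m then a else 0.
Proof.
by rewrite /pcoef /pterm coefCM coefXn; case: eqP; rewrite ?mulr1 ?mulr0.
Qed.
Lemma pcoef_eq0 (p : polyR R) : (forall n, pcoef n p = 0) -> p = 0.
Proof. by move=> p0; apply/polyP => n; rewrite coef0; exact: p0. Qed.
End PolyCoef.

Section Forms.
Variables (k : fieldType) (A : algType k) (H : pbw_algebra A).
Local Notation x := (gx H).
Local Notation y := (gy H).
Local Notation D := (gD H).
Local Notation E := (gE H).
Local Notation mo := (pbw_mon x y D E).
Implicit Types (r : {poly k}) (a : A).

Definition polE r : A := horner_alg E r.

Lemma polED : {morph polE : r s / r + s}. Proof. exact: rmorphD. Qed.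
Lemma polEN : {morph polE : r / - r}. Proof. exact: rmorphN. Qed.
Lemma polEC c : polE c%:P = c%:A. Proof. exact: horner_algC. Qed.
Lemma polEX : polE 'X = E. Proof. exact: horner_algX. Qed.
Lemma polEXn n : polE 'X^n = E ^+ n.
Proof. by rewrite /polE rmorphXn /= horner_algX. Qed.
Lemma polEM r s : polE (r * s) = polE r * polE s. Proof. exact: rmorphM. Qed.
Lemma polEZ c r : polE (c *: r) = c *: polE r.
Proof. by rewrite -mul_polyC polEM polEC -scalerAl mul1r. Qed.

Lemma polE_comm z r : E * z = z * E + z -> polE r * z = z * polE (shift r).
Proof.
move=> Ez; elim/poly_ind: r => [|r c IHr].
  by rewrite shift0 -polyC0 polEC scale0r mul0r mulr0.
rewrite shiftD shiftC /shift comp_polyM comp_polyX -/(shift r).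
rewrite !polED !polEM !polED !polEX !polEC scale1r mulrDl -mulrA Ez.
rewrite mulrDr mulrA IHr -scalerAl mul1r.
by rewrite !mulrDr -!scalerAr !mulr1 !mulrA; congr (_ + _).
Qed.

Lemma E_polE r : E * polE r = polE r * E.
Proof. by rewrite -polEX -!polEM mulrC. Qed.

(** The last place holds a whole polynomial in [E] because multiplication by [x], [y] or [D] on the
    right merely shifts it. *)
Definition mf i j p r : A := x ^+ i * y ^+ j * D ^+ p * polE r.

Lemma mfD i j p r s : mf i j p (r + s) = mf i j p r + mf i j p s.
Proof. by rewrite /mf polED mulrDr. Qed.
Lemma mfN i j p r : mf i j p (- r) = - mf i j p r.
Proof. by rewrite /mf polEN mulrN. Qed.
Lemma mf0 i j p : mf i j p 0 = 0.
Proof. by apply: (addrI (mf i j p 0)); rewrite -mfD !addr0. Qed.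
Lemma mfZ i j p c r : mf i j p (c *: r) = c *: mf i j p r.
Proof. by rewrite /mf polEZ scalerAr. Qed.
Lemma mo_mf i j p q : mo i j p q = mf i j p 'X^q.
Proof. by rewrite /mf polEXn. Qed.
Lemma mfMn i j p r n : mf i j p (r *+ n) = mf i j p r *+ n.
Proof. by elim: n => [|n IHn]; rewrite ?mulr0n ?mf0 // !mulrS mfD IHn. Qed.

Lemma x_mf i j p r : x * mf i j p r = mf i.+1 j p r.
Proof. by rewrite /mf exprS !mulrA. Qed.
Lemma y_mf i j p r : y * mf i j p r = mf i j.+1 p r.
Proof.
rewrite /mf !mulrA (commr_expr_step i (esym (rel_xy H))) exprS.
by rewrite !mulrA.
Qed.
Lemma D_mf i j p r :
  D * mf i j p r = mf i j p.+1 r + (mf i j.+1 p r + mf i.+1 j p r) *+ j.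
Proof.
have E0 := D_mon H i j p 0; rewrite /pbw_mon expr0 !mulr1 in E0.
rewrite /mf mulrA E0.
by rewrite mulrDl mulrnAl mulrDl.
Qed.
Lemma E_mf i j p r : E * mf i j p r = mf i j p r * E + mf i j p r *+ (i + j + p).
Proof.
have E0 := E_mon H i j p 0; rewrite /pbw_mon expr0 expr1 !mulr1 in E0.
rewrite /mf mulrA E0.
by rewrite mulrDl mulrnAl -!mulrA E_polE.
Qed.
Lemma mf_D i j p r : mf i j p r * D = mf i j p.+1 (shift r).
Proof. by rewrite /mf -mulrA (polE_comm r (rel_ED H)) mulrA exprSr !mulrA. Qed.
Lemma mf_x i j p r : mf i j p r * x = mf i.+1 j p (shift r).
Proof.
rewrite /mf -mulrA (polE_comm r (rel_Ex H)) mulrA; congr (_ * _).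
rewrite -!mulrA -(commr_expr_step p (esym (rel_Dx H))).
by rewrite !mulrA -(mulrA _ (y ^+ j)) -(commr_expr_step j (rel_xy H)) mulrA -exprSr.
Qed.
Lemma mf_y0 i j r : mf i j 0 r * y = mf i j.+1 0 (shift r).
Proof. by rewrite /mf expr0 !mulr1 -mulrA (polE_comm r (rel_Ey H)) mulrA exprSr !mulrA. Qed.

Lemma mf_shiftD i j p r z : mf i j p r * z = x ^+ i * y ^+ j * (mf 0 0 p r * z).
Proof. by rewrite /mf !mul1r !mulrA. Qed.
Lemma mf_xy i j i' j' p r : x ^+ i * y ^+ j * mf i' j' p r = mf (i' + i) (j' + j) p r.
Proof.
have Ey : y ^+ j * mf i' j' p r = mf i' (j' + j) p r.
  elim: j => [|j IHj]; first by rewrite mul1r addn0.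
  by rewrite exprS -mulrA IHj y_mf addnS.
rewrite -mulrA Ey; elim: i => [|i IHi]; first by rewrite mul1r addn0.
by rewrite exprS -mulrA IHi x_mf addnS.
Qed.

Lemma mf_y1 i j r : mf i j 1 r * y =
  mf i j.+1 1 (shift r) + mf i j.+2 0 (shift r) + mf i.+1 j.+1 0 (shift r).
Proof.
rewrite mf_shiftD.
have -> : mf 0 0 1 r * y = mf 0 1 1 (shift r) + mf 0 2 0 (shift r) + mf 1 1 0 (shift r).
  rewrite {1}/mf -mulrA (polE_comm r (rel_Ey H)) mulrA !mul1r expr1 rel_Dy.
  by rewrite !mulrDl /mf !mulr1 !mul1r !expr1.
by rewrite !mulrDr !mf_xy ?add0n ?add1n ?add2n.
Qed.

(** From [D^2 y = y D^2 + 2 (y^2 + x y) D + (2 y^3 + 3 x y^2 + x^2 y)], where the last bracket is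
    [y (x + y) d/dy] applied twice to [y]. *)
Lemma mf_y2 i j r : mf i j 2 r * y =
  mf i j.+1 2 (shift r) + mf i j.+2 1 (shift r) *+ 2 + mf i.+1 j.+1 1 (shift r) *+ 2
  + mf i j.+3 0 (shift r) *+ 2 + mf i.+1 j.+2 0 (shift r) *+ 3
  + mf i.+2 j.+1 0 (shift r).
Proof.
rewrite mf_shiftD.
have -> : mf 0 0 2 r * y = mf 0 1 2 (shift r) + mf 0 2 1 (shift r) *+ 2
  + mf 1 1 1 (shift r) *+ 2 + mf 0 3 0 (shift r) *+ 2 + mf 1 2 0 (shift r) *+ 3
  + mf 2 1 0 (shift r).
  rewrite {1}/mf -mulrA (polE_comm r (rel_Ey H)) mulrA !mul1r exprS expr1.
  have -> : D * D * y * polE (shift r) = D * (mf 0 0 1 1 * y) * polE (shift r).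
    by rewrite /mf -[polE 1]/(polE 1%:P) polEC scale1r !mul1r mulr1 !mulrA.
  rewrite mf_y1 shiftC !mulrDr !D_mf !mulrDl ?mulrnAl ?mulrDl.
  have E1 i1 j1 p1 : mf i1 j1 p1 1%:P * polE (shift r) = mf i1 j1 p1 (shift r).
    by rewrite /mf polEC scale1r mulr1.
  rewrite !E1; abel.
by rewrite !mulrDr ?mulrnAr !mf_xy ?(addSn, add0n); abel.
Qed.

Definition cfp i j p a : polyR A :=
  pcoef p (pcoef j (pcoef i (pbw_coord H a : tensR A))).
Definition scalar_poly r : polyR A := map_poly (in_alg A) r.

Lemma cfpD i j p : {morph cfp i j p : a b / a + b}.
Proof. by move=> a b; rewrite /cfp pbw_coordD !pcoefD. Qed.
Lemma cfp0 i j p : cfp i j p 0 = 0.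
Proof. by apply: (addrI (cfp i j p 0)); rewrite -cfpD !addr0. Qed.
Lemma scalar_polyD : {morph scalar_poly : r s / r + s}.
Proof. exact: rmorphD. Qed.
Lemma scalar_poly_inj : injective scalar_poly.
Proof. exact: map_poly_inj. Qed.

Lemma coord_mf i j p r : pbw_coord H (mf i j p r) =
  pterm (pterm (pterm (scalar_poly r) p) j) i :> tensR A.
Proof.
elim/(@pterm_ind k): r => [r s IHr IHs||c q].
- by rewrite mfD pbw_coordD IHr IHs scalar_polyD !ptermD.
- by rewrite mf0 pbw_coord0 /scalar_poly rmorph0 !pterm0.
rewrite /pterm mul_polyC mfZ -mo_mf pbw_coordZ pbw_coord_mon tens_scaleE.
rewrite smul_term mulr1 termE; congr (pterm (pterm (pterm _ p) j) i).
by rewrite /scalar_poly -mul_polyC rmorphM /= map_polyC map_polyXn.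
Qed.

Lemma cfp_mf i j p i' j' p' r : cfp i j p (mf i' j' p' r) =
  if [&& i == i', j == j' & p == p'] then scalar_poly r else 0.
Proof.
rewrite /cfp coord_mf pcoef_pterm; case: (i == i') => /=; last by rewrite !pcoef0.
rewrite pcoef_pterm; case: (j == j') => /=; last by rewrite !pcoef0.
by rewrite pcoef_pterm.
Qed.

End Forms.

(** * Weights and homogeneous forms *)

Section Weights.
Variables (k : fieldType) (A : algType k) (H : pbw_algebra A).
Hypothesis char0 : [pchar k] =i pred0.
Local Notation x := (gx H).
Local Notation y := (gy H).
Local Notation D := (gD H).
Local Notation E := (gE H).
Local Notation mo := (pbw_mon x y D E).
Local Notation mf := (@mf k A H).
Local Notation cfp := (@cfp k A H).
Local Notation sh := (@shift k).
Implicit Types (r : {poly k}) (a : A).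

Definition wt n a : A := E * a - a * E - a *+ n.

Lemma wtD n : {morph wt n : a b / a + b}.
Proof. by move=> a b; rewrite /wt mulrDl mulrDr mulrnDl; abel. Qed.
Lemma wt0 n : wt n 0 = 0.
Proof. by apply: (addrI (wt n 0)); rewrite -wtD !addr0. Qed.
Lemma wtZ n c a : wt n (c *: a) = c *: wt n a.
Proof. by rewrite /wt -scalerAr -scalerAl scalerMnr !scalerBr. Qed.

Lemma wt_mf n i j p r :
  wt n (mf i j p r) = ((i + j + p)%:R - n%:R) *: mf i j p r.
Proof. by rewrite /wt E_mf scalerBl !scaler_nat [_ * E + _]addrC addrK. Qed.

Lemma cfp_wt n i j p a :
  cfp i j p (wt n a) = (((i + j + p)%:R - n%:R : k)%:A)%:P * (cfp i j p a : {poly A}).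
Proof.
elim/(@pbw_span _ _ H): a => [|c i' j' p' q b IHb].
  by rewrite wt0 cfp0; symmetry; exact: mulr0.
rewrite wtD cfpD IHb [in RHS]cfpD [RHS]mulrDr; congr (_ + _).
rewrite mo_mf -mfZ wt_mf -mfZ !cfp_mf.
case: ifP => [/and3P[/eqP -> /eqP -> /eqP ->]|_]; last by rewrite mulr0.
by rewrite /scalar_poly -mul_polyC rmorphM /= map_polyC.
Qed.

Lemma cfp_ext a : (forall i j p, cfp i j p a = 0) -> a = 0.
Proof.
move=> a0; have c0 : pbw_coord H a = 0.
  apply: (@pcoef_eq0 (polyR (polyR (polyR A)))) => i.
  apply: (@pcoef_eq0 (polyR (polyR A))) => j.
  by apply: (@pcoef_eq0 (polyR A)) => p; exact: a0.
have := free_map_coord H (N := regular_bimodule A) 1 a.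
rewrite c0 /= mul1r => <-.
exact: (hom0 (free_map_hom H (N := regular_bimodule A) 1)).
Qed.

(** By [cfp_wt] the operator is diagonal in PBW coordinates, and a scalar whose square kills a
    coordinate already kills it. *)
Lemma wt_ss n a : wt n (wt n a) = 0 -> wt n a = 0.
Proof.
move=> w0; apply: cfp_ext => i j p.
have := congr1 (cfp i j p) w0; rewrite cfp0 !cfp_wt.
have [->|nz] := eqVneq ((i + j + p)%:R - n%:R : k) 0.
  by move=> _; rewrite scale0r polyC0; exact: mul0r.
move=> /(congr1 (fun t : {poly A} => (((i + j + p)%:R - n%:R)^-1 : k)%:A%:P * t)).
rewrite mulr0 mulrA -polyCM -scalerAl mul1r scalerA mulVf // scale1r polyC1.
by rewrite mul1r.
Qed.

Section Split.
Variables (n : nat) (P : A -> Prop).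
Hypotheses (P0 : P 0) (PD : forall c a b, P a -> P b -> P (c *: a + b)).
Hypothesis Pmon : forall i j p q, (i + j + p)%N = n -> P (mo i j p q).

(** Monomials of weight other than [n] are eigenvectors with nonzero eigenvalue, hence values of
    [wt n]; characteristic zero enters here. [P] is any subspace containing the monomials of weight
    [n]. *)
Lemma wt_split a : exists a0 a', [/\ P a0, wt n a0 = 0 & a = a0 + wt n a'].
Proof.
elim/(@pbw_span _ _ H): a => [|c i j p q b [b0 [b' [Pb wb ->]]]].
  by exists 0, 0; rewrite wt0 addr0.
have [ijp|ne] := eqVneq (i + j + p)%N n.
  exists (c *: mo i j p q + b0), b'; split; last by rewrite addrA.
    exact: PD (Pmon _ ijp) Pb.
  by rewrite wtD wtZ mo_mf wt_mf ijp subrr scale0r scaler0 add0r.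
exists b0, (c *: (((i + j + p)%:R - n%:R)^-1 *: mo i j p q) + b'); split=> //.
have nz : (i + j + p)%:R - n%:R != 0 :> k.
  by rewrite subr_eq0; apply: contra ne => /eqP /(natr_inj0 char0) ->.
rewrite wtD !wtZ mo_mf wt_mf [_^-1 *: _]scalerA mulVf // scale1r.
by rewrite addrCA.
Qed.

Lemma wt_form a : wt n a = 0 -> P a.
Proof.
have [a0 [a' [Pa w0 ->]]] := wt_split a; rewrite wtD w0 add0r => /wt_ss ->.
by rewrite addr0.
Qed.
End Split.

(* In [form1], [form2], [form3] the coefficients are those of the monomials of
   degree 1, 2, 3 in [x], [y], [D], in lexicographic order. *)
Definition form0 r := mf 0 0 0 r.
Definition form1 r1 r2 r3 := mf 1 0 0 r1 + mf 0 1 0 r2 + mf 0 0 1 r3.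
Definition form2 r1 r2 r3 r4 r5 r6 :=
  mf 2 0 0 r1 + mf 1 1 0 r2 + mf 1 0 1 r3 + mf 0 2 0 r4 + mf 0 1 1 r5 + mf 0 0 2 r6.
Definition form3 r1 r2 r3 r4 r5 r6 r7 r8 r9 r10 :=
  mf 3 0 0 r1 + mf 2 1 0 r2 + mf 2 0 1 r3 + mf 1 2 0 r4 + mf 1 1 1 r5 + mf 1 0 2 r6
  + mf 0 3 0 r7 + mf 0 2 1 r8 + mf 0 1 2 r9 + mf 0 0 3 r10.

Lemma f0P a : wt 0 a = 0 <-> exists r, a = form0 r.
Proof.
split=> [|[r ->]]; last by rewrite wt_mf subrr scale0r.
apply: (@wt_form 0 (fun a => exists r, a = form0 r)) => [|c _ _ [r ->] [s ->]|i j p q].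
- by exists 0; rewrite /form0 mf0.
- by exists (c *: r + s); rewrite /form0 mfD mfZ.
- move/eqP; rewrite !addn_eq0 => /andP[/andP[/eqP -> /eqP ->] /eqP ->].
  by exists 'X^q; rewrite mo_mf.
Qed.

Lemma f1P a : wt 1 a = 0 <-> exists r1 r2 r3, a = form1 r1 r2 r3.
Proof.
split=> [|[r1 [r2 [r3 ->]]]]; last first.
  by rewrite /form1 !wtD !wt_mf !subrr !scale0r !addr0.
apply: (@wt_form 1 (fun a => exists r1 r2 r3, a = form1 r1 r2 r3)) =>
    [|c _ _ [r1 [r2 [r3 ->]]] [s1 [s2 [s3 ->]]]|i j p q].
- by exists 0, 0, 0; rewrite /form1 !mf0 !addr0.
- exists (c *: r1 + s1), (c *: r2 + s2), (c *: r3 + s3).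
  by rewrite /form1 !mfD !mfZ !scalerDr; abel.
- case: i => [|[|i]]; case: j => [|[|j]]; case: p => [|[|p]] //= _; rewrite mo_mf.
  + by exists 0, 0, 'X^q; rewrite /form1 !mf0 !add0r.
  + by exists 0, 'X^q, 0; rewrite /form1 !mf0 add0r addr0.
  + by exists 'X^q, 0, 0; rewrite /form1 !mf0 !addr0.
Qed.

Lemma f2P a : wt 2 a = 0 <-> exists r1 r2 r3 r4 r5 r6, a = form2 r1 r2 r3 r4 r5 r6.
Proof.
split=> [|[r1 [r2 [r3 [r4 [r5 [r6 ->]]]]]]]; last first.
  by rewrite /form2 !wtD !wt_mf !subrr !scale0r !addr0.
apply: (@wt_form 2 (fun a =>
    exists r1 r2 r3 r4 r5 r6, a = form2 r1 r2 r3 r4 r5 r6)) => [|c _ _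
    [r1 [r2 [r3 [r4 [r5 [r6 ->]]]]]]
    [s1 [s2 [s3 [s4 [s5 [s6 ->]]]]]]|i j p q].
- by exists 0, 0, 0, 0, 0, 0; rewrite /form2 !mf0 !addr0.
- exists (c *: r1 + s1), (c *: r2 + s2), (c *: r3 + s3).
  exists (c *: r4 + s4), (c *: r5 + s5), (c *: r6 + s6).
  by rewrite /form2 !mfD !mfZ !scalerDr; abel.
- case: i => [|[|[|i]]]; case: j => [|[|[|j]]]; case: p => [|[|[|p]]] //= _;
    rewrite mo_mf.
  + by exists 0, 0, 0, 0, 0, 'X^q; rewrite /form2 !mf0 !add0r.
  + by exists 0, 0, 0, 0, 'X^q, 0; rewrite /form2 !mf0 ?add0r ?addr0.
  + by exists 0, 0, 0, 'X^q, 0, 0; rewrite /form2 !mf0 ?add0r ?addr0.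
  + by exists 0, 0, 'X^q, 0, 0, 0; rewrite /form2 !mf0 ?add0r ?addr0.
  + by exists 0, 'X^q, 0, 0, 0, 0; rewrite /form2 !mf0 ?add0r ?addr0.
  + by exists 'X^q, 0, 0, 0, 0, 0; rewrite /form2 !mf0 !addr0.
Qed.

Lemma f3P a : wt 3 a = 0 -> exists r1 r2 r3 r4 r5 r6 r7 r8 r9 r10,
  a = form3 r1 r2 r3 r4 r5 r6 r7 r8 r9 r10.
Proof.
apply: (@wt_form 3 (fun a => exists r1 r2 r3 r4 r5 r6 r7 r8 r9 r10,
    a = form3 r1 r2 r3 r4 r5 r6 r7 r8 r9 r10)) => [|c _ _
    [r1 [r2 [r3 [r4 [r5 [r6 [r7 [r8 [r9 [r10 ->]]]]]]]]]]
    [s1 [s2 [s3 [s4 [s5 [s6 [s7 [s8 [s9 [s10 ->]]]]]]]]]]|i j p q].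
- by exists 0, 0, 0, 0, 0, 0, 0, 0, 0, 0; rewrite /form3 !mf0 !addr0.
- exists (c *: r1 + s1), (c *: r2 + s2), (c *: r3 + s3).
  exists (c *: r4 + s4), (c *: r5 + s5), (c *: r6 + s6).
  exists (c *: r7 + s7), (c *: r8 + s8), (c *: r9 + s9), (c *: r10 + s10).
  by rewrite /form3 !mfD !mfZ !scalerDr; abel.
- case: i => [|[|[|[|i]]]]; case: j => [|[|[|[|j]]]]; case: p => [|[|[|[|p]]]] //= _;
    rewrite mo_mf.
  + by exists 0, 0, 0, 0, 0, 0, 0, 0, 0, 'X^q; rewrite /form3 !mf0 ?add0r ?addr0.
  + by exists 0, 0, 0, 0, 0, 0, 0, 0, 'X^q, 0; rewrite /form3 !mf0 ?add0r ?addr0.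
  + by exists 0, 0, 0, 0, 0, 0, 0, 'X^q, 0, 0; rewrite /form3 !mf0 ?add0r ?addr0.
  + by exists 0, 0, 0, 0, 0, 0, 'X^q, 0, 0, 0; rewrite /form3 !mf0 ?add0r ?addr0.
  + by exists 0, 0, 0, 0, 0, 'X^q, 0, 0, 0, 0; rewrite /form3 !mf0 ?add0r ?addr0.
  + by exists 0, 0, 0, 0, 'X^q, 0, 0, 0, 0, 0; rewrite /form3 !mf0 ?add0r ?addr0.
  + by exists 0, 0, 0, 'X^q, 0, 0, 0, 0, 0, 0; rewrite /form3 !mf0 ?add0r ?addr0.
  + by exists 0, 0, 'X^q, 0, 0, 0, 0, 0, 0, 0; rewrite /form3 !mf0 ?add0r ?addr0.
  + by exists 0, 'X^q, 0, 0, 0, 0, 0, 0, 0, 0; rewrite /form3 !mf0 ?add0r ?addr0.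
  + by exists 'X^q, 0, 0, 0, 0, 0, 0, 0, 0, 0; rewrite /form3 !mf0 ?add0r ?addr0.
Qed.

Lemma cfp_f0 r : cfp 0 0 0 (form0 r) = scalar_poly A r.
Proof. by rewrite /form0 cfp_mf. Qed.

Lemma f0_inj r s : form0 r = form0 s -> r = s.
Proof. by move=> /(congr1 (cfp 0 0 0)); rewrite !cfp_f0 => /scalar_poly_inj. Qed.

Lemma f2_inj r1 r2 r3 r4 r5 r6 s1 s2 s3 s4 s5 s6 :
  form2 r1 r2 r3 r4 r5 r6 = form2 s1 s2 s3 s4 s5 s6 ->
  [/\ r1 = s1, r2 = s2 & r3 = s3] /\ [/\ r4 = s4, r5 = s5 & r6 = s6].
Proof.
move=> rs; have Q i j p := congr1 (cfp i j p) rs.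
have := Q 2 0 0; have := Q 1 1 0; have := Q 1 0 1; have := Q 0 2 0.
have := Q 0 1 1; have := Q 0 0 2.
rewrite /form2 !cfpD !cfp_mf /= !addr0 !add0r.
by do 6![move=> /scalar_poly_inj ->].
Qed.

Lemma f1_inj r1 r2 r3 s1 s2 s3 :
  form1 r1 r2 r3 = form1 s1 s2 s3 -> [/\ r1 = s1, r2 = s2 & r3 = s3].
Proof.
move=> rs; have Q i j p := congr1 (cfp i j p) rs.
have := Q 1 0 0; have := Q 0 1 0; have := Q 0 0 1.
rewrite /form1 !cfpD !cfp_mf /= !addr0 !add0r.
by do 3![move=> /scalar_poly_inj ->].
Qed.

Lemma f3_inj r1 r2 r3 r4 r5 r6 r7 r8 r9 r10 s1 s2 s3 s4 s5 s6 s7 s8 s9 s10 :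
  form3 r1 r2 r3 r4 r5 r6 r7 r8 r9 r10 = form3 s1 s2 s3 s4 s5 s6 s7 s8 s9 s10 ->
  [/\ r1 = s1, r2 = s2, r3 = s3, r4 = s4 & r5 = s5] /\
  [/\ r6 = s6, r7 = s7, r8 = s8, r9 = s9 & r10 = s10].
Proof.
move=> rs; have Q i j p := congr1 (cfp i j p) rs.
have := Q 3 0 0; have := Q 2 1 0; have := Q 2 0 1; have := Q 1 2 0.
have := Q 1 1 1; have := Q 1 0 2; have := Q 0 3 0; have := Q 0 2 1.
have := Q 0 1 2; have := Q 0 0 3.
rewrite /form3 !cfpD !cfp_mf /= !addr0 !add0r.
by do 10![move=> /scalar_poly_inj ->].
Qed.

Lemma x_f0 r : x * form0 r = form1 r 0 0.
Proof. by rewrite /form0 /form1 x_mf !mf0 !addr0. Qed.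
Lemma f0_x r : form0 r * x = form1 (sh r) 0 0.
Proof. by rewrite /form0 /form1 mf_x !mf0 !addr0. Qed.
Lemma y_f0 r : y * form0 r = form1 0 r 0.
Proof. by rewrite /form0 /form1 y_mf !mf0 add0r addr0. Qed.
Lemma f0_y r : form0 r * y = form1 0 (sh r) 0.
Proof. by rewrite /form0 /form1 mf_y0 !mf0 add0r addr0. Qed.
Lemma D_f0 r : D * form0 r = form1 0 0 r.
Proof. by rewrite /form0 /form1 D_mf mulr0n !mf0 !add0r addr0. Qed.
Lemma f0_D r : form0 r * D = form1 0 0 (sh r).
Proof. by rewrite /form0 /form1 mf_D !mf0 !add0r. Qed.

Lemma x_f1 r1 r2 r3 : x * form1 r1 r2 r3 = form2 r1 r2 r3 0 0 0.
Proof. by rewrite /form1 /form2 !mulrDr !x_mf !mf0 !addr0. Qed.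
Lemma f1_x r1 r2 r3 : form1 r1 r2 r3 * x = form2 (sh r1) (sh r2) (sh r3) 0 0 0.
Proof. by rewrite /form1 /form2 !mulrDl !mf_x !mf0 !addr0. Qed.
Lemma y_f1 r1 r2 r3 : y * form1 r1 r2 r3 = form2 0 r1 0 r2 r3 0.
Proof. by rewrite /form1 /form2 !mulrDr !y_mf !mf0; abel. Qed.
Lemma f1_y r1 r2 r3 :
  form1 r1 r2 r3 * y = form2 0 (sh r1 + sh r3) 0 (sh r2 + sh r3) (sh r3) 0.
Proof. by rewrite /form1 /form2 !mulrDl !mf_y0 mf_y1 !mf0 !mfD; abel. Qed.
Lemma D_f1 r1 r2 r3 : D * form1 r1 r2 r3 = form2 0 r2 r1 r2 r2 r3.
Proof. by rewrite /form1 /form2 !mulrDr !D_mf !mf0; abel. Qed.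
Lemma f1_D r1 r2 r3 : form1 r1 r2 r3 * D = form2 0 0 (sh r1) 0 (sh r2) (sh r3).
Proof. by rewrite /form1 /form2 !mulrDl !mf_D !mf0; abel. Qed.

Section FormProducts.
Variables r1 r2 r3 r4 r5 r6 : {poly k}.
Lemma x_f2 : x * form2 r1 r2 r3 r4 r5 r6 = form3 r1 r2 r3 r4 r5 r6 0 0 0 0.
Proof. by rewrite /form3 /form2 !mulrDr !x_mf !mf0 !addr0. Qed.
Lemma f2_x : form2 r1 r2 r3 r4 r5 r6 * x =
  form3 (sh r1) (sh r2) (sh r3) (sh r4) (sh r5) (sh r6) 0 0 0 0.
Proof. by rewrite /form3 /form2 !mulrDl !mf_x !mf0 !addr0. Qed.
Lemma y_f2 : y * form2 r1 r2 r3 r4 r5 r6 = form3 0 r1 0 r2 r3 0 r4 r5 r6 0.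
Proof. by rewrite /form3 /form2 !mulrDr !y_mf !mf0; abel. Qed.
Lemma f2_y : form2 r1 r2 r3 r4 r5 r6 * y =
  form3 0 (sh r1 + sh r3 + sh r6) 0 (sh r2 + sh r3 + sh r5 + sh r6 *+ 3)
     (sh r3 + sh r6 *+ 2) 0 ((sh r4) + (sh r5) + (sh r6) *+ 2) ((sh r5) + (sh r6) *+ 2) (sh r6) 0.
Proof.
rewrite /form3 /form2 !mulrDl !mf_y0 !mf_y1 mf_y2 !mf0 !mfD.
by rewrite ?mfMn; abel.
Qed.
Lemma D_f2 : D * form2 r1 r2 r3 r4 r5 r6 =
  form3 0 r2 r1 (r2 + r4 *+ 2) (r2 + r5) r3 (r4 *+ 2) (r4 + r5) r5 r6.
Proof.
by rewrite /form3 /form2 !mulrDr !D_mf !mf0 !mfD ?mfMn; abel.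
Qed.
Lemma f2_D : form2 r1 r2 r3 r4 r5 r6 * D =
  form3 0 0 (sh r1) 0 (sh r2) (sh r3) 0 (sh r4) (sh r5) (sh r6).
Proof. by rewrite /form3 /form2 !mulrDl !mf_D !mf0; abel. Qed.
End FormProducts.

End Weights.

Section Linear.
Variable V : zmodType.
Implicit Types X Y l r : V.
(** Derives an equation from others: the last premise exhibits [X - Y] as a combination of their
    differences, an identity within reach of [abel]. *)
Lemma lin1 X Y l r : l = r -> X - Y = l - r -> X = Y.
Proof. by move=> ->; rewrite subrr => /eqP; rewrite subr_eq0 => /eqP. Qed.
Lemma lin2 X Y l1 r1 l2 r2 :
  l1 = r1 -> l2 = r2 -> X - Y = (l1 - r1) + (l2 - r2) -> X = Y.
Proof. by move=> -> ->; rewrite !subrr addr0 => /eqP; rewrite subr_eq0 => /eqP. Qed.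
Lemma lin3 X Y l1 r1 l2 r2 l3 r3 : l1 = r1 -> l2 = r2 -> l3 = r3 ->
  X - Y = (l1 - r1) + (l2 - r2) + (l3 - r3) -> X = Y.
Proof.
by move=> -> -> ->; rewrite !subrr !addr0 => /eqP; rewrite subr_eq0 => /eqP.
Qed.
End Linear.

Lemma linear_at0 (k : fieldType) (U V : lmodType k) (f : U -> V) :
  linear f -> f 0 = 0.
Proof. by move=> lf; rewrite -(subrr 0) (linear_sub _ _ lf) subrr. Qed.

Lemma linear_add (k : fieldType) (U V : lmodType k) (f : U -> V) u v :
  linear f -> f (u + v) = f u + f v.
Proof. by move=> lf; have := lf 1 u v; rewrite !scale1r. Qed.

Lemma quotient_dim_basis (k : fieldType) (cochain : lmodType k) (Z B : set cochain) d
    (e : 'I_d -> cochain) : subspace B -> (forall i, Z (e i)) ->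
  (forall z, Z z -> exists c : 'I_d -> k, B (z - \sum_i c i *: e i)) ->
  (forall c : 'I_d -> k, B (\sum_i c i *: e i) -> forall i, c i = 0) ->
  quotient_dim Z B d.
Proof.
move=> sB Ze span indep; exists e; split=> // z /span[c cP].
exists [ffun i => c i]; split; first by under eq_bigr do rewrite ffunE.
move=> c2 c2P; apply/ffunP => i; rewrite ffunE; apply/eqP.
rewrite -subr_eq0; apply/eqP; move: i.
apply: indep; have := subspaceB sB c2P cP; rewrite opprB addrC addrA subrK.
by rewrite -sumrB; under eq_bigr do rewrite -scalerBl.
Qed.

Section Cochains.
Variables (k : fieldType) (A : algType k) (H : pbw_algebra A).
Local Notation x := (gx H).
Local Notation y := (gy H).
Local Notation D := (gD H).
Local Notation E := (gE H).
Local Notation wt := (@wt k A H).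

Definition br (a b : A) : A := a * b - b * a.

(* [cochain n] is [Hom(B_obj n, A)], given by the values on the generators; the
   degrees are shifted by one as in [B_obj]. *)
Definition cochain (n : nat) : lmodType k :=
  match n with
  | 1 | 4 => (A : lmodType k)
  | 2 | 3 => (A * A * A)%type : lmodType k
  | _ => 'rV[k]_0 : lmodType k
  end.

(** The transpose of [B_diff], as [vals_diff] shows. Case [2] consists of the linearised relations
    for [xy], [Dx] and [Dy], so the values of a derivation on [x], [y], [D] lie in its kernel. *)
Definition codiff n : cochain n -> cochain n.+1 :=
  match n return cochain n -> cochain n.+1 with
  | 1 => fun a : A => (br x a, br y a, br D a)
  | 2 => fun v : A * A * A =>
      (br x v.1.2 - br y v.1.1, br D v.1.1 - br x v.2,
       br D v.1.2 - y * v.1.2 - v.1.2 * y - x * v.1.2 - v.1.1 * y - br y v.2)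
  | 3 => fun v : A * A * A =>
      br D v.1.1 - y * v.1.1 - v.1.1 * y - x * v.1.1 + br y v.1.2 - br x v.2
  | _ => fun _ => 0
  end.

Definition wt3 n (v : A * A * A) : A * A * A := (wt n v.1.1, wt n v.1.2, wt n v.2).

Definition wtop n : cochain n -> cochain n :=
  match n return cochain n -> cochain n with
  | 1 => wt 0
  | 2 => wt3 1
  | 3 => wt3 2
  | 4 => wt 3
  | _ => fun _ => 0
  end.

Definition cocycle0 n : set (cochain n) := fun v => wtop v = 0 /\ codiff v = 0.
Definition coboundary0 n : set (cochain n) :=
  match n return set (cochain n) with
  | 0 => fun v => v = 0
  | m.+1 => fun v => exists2 g : cochain m, wtop g = 0 & v = codiff g
  end.
(** Indices are shifted: these are the dimensions 1, 2, 4 in cohomological degrees 0, 1, 2, and 0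
    elsewhere, in particular at index [0], that is, in degree -1. *)
Definition dim0 n : nat := match n with 1 => 1 | 2 => 2 | 3 => 4 | _ => 0 end.

Lemma brD a b c : br a (b + c) = br a b + br a c.
Proof. by rewrite /br mulrDr mulrDl; abel. Qed.
Lemma brZ a c b : br a (c *: b) = c *: br a b.
Proof. by rewrite /br -scalerAr -scalerAl scalerBr. Qed.

Lemma delta_linear n : linear (@codiff n).
Proof.
case: n => [|[|[|[|n]]]] c u v //=; try by rewrite scaler0 addr0.
- by congr (_, _, _); rewrite brD brZ.
- case: u v => [[u1 u2] u3] [[v1 v2] v3] /=; congr (_, _, _);
    rewrite /= /br !(mulrDr, mulrDl) -!scalerAr -!scalerAl
      !(scalerBr, scalerDr); abel.
- case: u v => [[u1 u2] u3] [[v1 v2] v3] /=.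
  by rewrite /br !(mulrDr, mulrDl) -!scalerAr -!scalerAl !(scalerBr, scalerDr); abel.
Qed.

Lemma wtop_linear n : linear (@wtop n).
Proof.
case: n => [|[|[|[|[|n]]]]] c u v //=; try by rewrite scaler0 addr0.
- by rewrite wtD wtZ.
- by congr (_, _, _); rewrite wtD wtZ.
- by congr (_, _, _); rewrite wtD wtZ.
- by rewrite wtD wtZ.
Qed.

Lemma B0_subspace n : subspace (@coboundary0 n).
Proof.
case: n => [|n]; split=> //=.
- by move=> a _ _ -> ->; rewrite scaler0 addr0.
- by exists 0; rewrite linear_at0 //; [exact: wtop_linear | exact: delta_linear].
- move=> a _ _ [g g0 ->] [h h0 ->]; exists (a *: g + h).
    by rewrite wtop_linear g0 h0 scaler0 addr0.
  by rewrite delta_linear.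
Qed.

Local Notation F := (free_bimodule H).
Local Notation u := (free_gen H).
Local Notation C := (B_obj H).
Local Notation R := (regular_bimodule A).
Local Notation F3 := (prod_bimodule (prod_bimodule F F) F).

Definition vals n : (C n -> A) -> cochain n :=
  match n return (C n -> A) -> cochain n with
  | 1 | 4 => fun h => h u
  | 2 | 3 => fun h : F3 -> A => (h (u, 0, 0), h (0, u, 0), h (0, 0, u))
  | _ => fun _ => 0
  end.

Lemma vals_linear n : linear (@vals n).
Proof.
by case: n => [|[|[|[|[|n]]]]] c h g //=; rewrite scaler0 addr0.
Qed.

Lemma prod3_eq (v : F3) :
  v = (v.1.1, 0, 0) + (0, v.1.2, 0) + (0, 0, v.2) :> (F * F * F)%type.
Proof.
by case: v => -[a b] c; congr (_, _, _); rewrite /= ?addr0 ?add0r.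
Qed.

Lemma hom3E (N : bimodule A) (h : F3 -> N) : bimod_hom h -> forall v,
  h v = h (v.1.1, 0, 0) + h (0, v.1.2, 0) + h (0, 0, v.2).
Proof. by move=> hP v; rewrite {1}[v]prod3_eq !(homD hP). Qed.

Lemma hom3_i1 : bimod_hom (fun f : F => (f, 0, 0) : F3).
Proof. exact: bimod_hom_comp (prod_hom_inl _ _) (prod_hom_inl _ _). Qed.
Lemma hom3_i2 : bimod_hom (fun f : F => (0, f, 0) : F3).
Proof. exact: bimod_hom_comp (prod_hom_inl _ _) (prod_hom_inr _ _). Qed.
Lemma hom3_i3 : bimod_hom (fun f : F => (0, 0, f) : F3).
Proof. exact: prod_hom_inr. Qed.

Lemma hom_inner (h : F -> R) z : bimod_hom h -> h (inner_map z u) = br z (h u).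
Proof.
move=> hP; have [_ hl hr] := hP.
by rewrite /inner_map free_map_gen (homB hP) hl hr.
Qed.
Lemma hom_twist (h : F -> R) : bimod_hom h ->
  h (twist_map u) = br D (h u) - y * h u - h u * y - x * h u.
Proof.
move=> hP; have [_ hl hr] := hP.
by rewrite /twist_map free_map_gen !(homB hP) !hl !hr.
Qed.
Lemma hom_mixed (h : F -> R) : bimod_hom h -> h (mixed_map u) = h u * y.
Proof.
by move=> hP; have [_ hl hr] := hP; rewrite /mixed_map free_map_gen hr.
Qed.
Lemma homMn (M N : bimodule A) (h : M -> N) m n :
  bimod_hom h -> h (m *+ n) = h m *+ n.
Proof.
move=> hP; elim: n => [|n IHn]; first by rewrite !mulr0n (hom0 hP).
by rewrite !mulrS (homD hP) IHn.
Qed.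
Lemma hom_weight (h : F -> R) n : bimod_hom h -> h (weight_map n u) = wt n (h u).
Proof.
move=> hP; have [_ hl hr] := hP.
by rewrite /weight_map free_map_gen !(homB hP) hl hr (homMn _ _ hP).
Qed.

Lemma maps0 : (forall z, inner_map z (0 : F) = 0) /\
  (twist_map (0 : F) = 0 /\ (mixed_map (0 : F) = 0 /\
   forall n, weight_map n (0 : F) = 0)).
Proof.
split=> [z|]; first exact: hom0 (inner_map_hom H z).
split; first exact: hom0 (twist_map_hom H).
split=> [|n]; first exact: hom0 (mixed_map_hom H).
exact: hom0 (weight_map_hom H n).
Qed.

Lemma vals_diff n (h : C n -> R) : bimod_hom h ->
  vals (fun v => h (B_diff v)) = codiff (vals h).
Proof.
have [i0 [t0 [m0 w0]]] := maps0.
case: n h => [|[|[|[|n]]]] h hP.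
- exact: hom0 hP.
- rewrite /vals /codiff /B_diff /= !i0 !(addr0, add0r).
  by rewrite !(hom_inner _ hP).
- have h1 := bimod_hom_comp hP hom3_i1.
  have h2 := bimod_hom_comp hP hom3_i2.
  have h3 := bimod_hom_comp hP hom3_i3.
  rewrite /vals /codiff /B_diff /= !i0 !t0 !m0 !(addr0, add0r, oppr0).
  congr (_, _, _); rewrite (hom3E hP) /=.
  + rewrite (homN h1) (hom_inner _ h1) (hom_inner _ h2) (hom0 h3).
    by rewrite addr0 addrC.
  + rewrite (hom_inner _ h1) (hom0 h2) (homN h3) (hom_inner _ h3).
    by rewrite addr0.
  + rewrite (homN h1) (hom_mixed h1) (hom_twist h2) (homN h3).
    by rewrite (hom_inner _ h3) /=; abel.
- have h1 := bimod_hom_comp hP hom3_i1.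
  have h2 := bimod_hom_comp hP hom3_i2.
  have h3 := bimod_hom_comp hP hom3_i3.
  rewrite /vals /codiff /B_diff /= (hom3E hP) /= (hom_twist h1) (hom_inner _ h2).
  by rewrite (homN h3) (hom_inner _ h3).
- by case: n h hP => [|n] h hP //=; exact: (hom0 hP).
Qed.

Lemma vals_weight n (h : C n -> R) : bimod_hom h ->
  vals (fun v => h (B_weight v)) = wtop (vals h).
Proof.
have [i0 [t0 [m0 w0]]] := maps0.
case: n h => [|[|[|[|[|n]]]]] h hP //=.
- exact: hom_weight.
- have h1 := bimod_hom_comp hP hom3_i1.
  have h2 := bimod_hom_comp hP hom3_i2.
  have h3 := bimod_hom_comp hP hom3_i3.
  rewrite !w0; congr (_, _, _).
  + exact: (hom_weight 1 h1).
  + exact: (hom_weight 1 h2).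
  + exact: (hom_weight 1 h3).
- have h1 := bimod_hom_comp hP hom3_i1.
  have h2 := bimod_hom_comp hP hom3_i2.
  have h3 := bimod_hom_comp hP hom3_i3.
  rewrite !w0; congr (_, _, _).
  + exact: (hom_weight 2 h1).
  + exact: (hom_weight 2 h2).
  + exact: (hom_weight 2 h3).
- exact: hom_weight.
Qed.

Lemma vals_inj n (h g : C n -> R) : bimod_hom h -> bimod_hom g ->
  vals h = vals g -> h = g.
Proof.
have three (h1 g1 : F3 -> R) : bimod_hom h1 -> bimod_hom g1 ->
    (h1 (u, 0, 0), h1 (0, u, 0), h1 (0, 0, u)) =
    (g1 (u, 0, 0), g1 (0, u, 0), g1 (0, 0, u)) -> h1 = g1.
  move=> hP gP [E1 E2 E3]; apply: funext => v; rewrite (hom3E hP) (hom3E gP).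
  congr (_ + _ + _).
  - exact: (free_hom_ext (bimod_hom_comp hP hom3_i1) (bimod_hom_comp gP hom3_i1)).
  - exact: (free_hom_ext (bimod_hom_comp hP hom3_i2) (bimod_hom_comp gP hom3_i2)).
  - exact: (free_hom_ext (bimod_hom_comp hP hom3_i3) (bimod_hom_comp gP hom3_i3)).
case: n h g => [|[|[|[|[|n]]]]] h g hP gP E.
- by apply: funext => v; rewrite [v]zero_bimoduleE (hom0 hP) (hom0 gP).
- by apply: funext; exact: free_hom_ext.
- exact: three.
- exact: three.
- by apply: funext; exact: free_hom_ext.
- by apply: funext => v; rewrite [v]zero_bimoduleE (hom0 hP) (hom0 gP).
Qed.

Lemma vals_surj n (v : cochain n) : exists2 h : C n -> R, bimod_hom h & vals h = v.
Proof.
have three (w : A * A * A) : exists2 h : F3 -> R, bimod_hom h &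
    (h (u, 0, 0), h (0, u, 0), h (0, 0, u)) = w.
  case: w => -[a b] c; pose fm a : F -> R := free_map (N := R) a.
  have fm0 t : fm t 0 = 0 by exact: hom0 (free_map_hom H (N := R) t).
  have fmu t : fm t u = t by exact: (free_map_gen H (N := R) t).
  exists (fun w : F3 => fm a w.1.1 + fm b w.1.2 + fm c w.2).
    apply: bimod_homD; first apply: bimod_homD.
    - exact: bimod_hom_comp (free_map_hom H _)
        (bimod_hom_comp (prod_hom_fst F F) (prod_hom_fst (prod_bimodule F F) F)).
    - exact: bimod_hom_comp (free_map_hom H _)
        (bimod_hom_comp (prod_hom_snd F F) (prod_hom_fst (prod_bimodule F F) F)).
    - exact: bimod_hom_comp (free_map_hom H _) (prod_hom_snd (prod_bimodule F F) F).
  by rewrite /= !fm0 !fmu !(addr0, add0r).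
case: n v => [|[|[|[|[|n]]]]] v.
- by exists (fun=> 0); [exact: bimod_hom0 | exact/esym/zero_bimoduleE].
- by exists (free_map (N := R) v); [exact: free_map_hom | exact: (free_map_gen H (N := R) v)].
- exact: three.
- exact: three.
- by exists (free_map (N := R) v); [exact: free_map_hom | exact: (free_map_gen H (N := R) v)].
- by exists (fun=> 0); [exact: bimod_hom0 | exact/esym/zero_bimoduleE].
Qed.

(** Inherited from the complex of bimodules, every cochain being the list of values of a
    homomorphism; no computation in [A] is involved. *)
Lemma delta_delta n (v : cochain n) : codiff (codiff v) = 0.
Proof.
have [h hP <-] := vals_surj v.
have dP := bimod_hom_comp hP (B_diff_hom H n).
rewrite -vals_diff // -vals_diff //.
have -> : (fun w => h (B_diff (B_diff w))) = (fun=> 0) :> (C n.+2 -> R).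
  apply: funext => w; rewrite (_ : B_diff (B_diff w) = 0) ?(hom0 hP) //.
  exact: (d2 (@zero_bimoduleE _ A) (@B_exact _ _ H)).
by rewrite (linear_at0 (@vals_linear _)).
Qed.

Lemma delta_lam n (v : cochain n) : codiff (wtop v) = wtop (codiff v).
Proof.
have [h hP <-] := vals_surj v.
rewrite -vals_weight // -!vals_diff //; first last.
- exact: bimod_hom_comp hP (B_weight_hom H n).
rewrite -vals_weight; last exact: bimod_hom_comp hP (B_diff_hom H n).
congr vals; apply: funext => w; by rewrite B_diff_weight.
Qed.

End Cochains.

(** * Elimination in degrees zero, one and three *)

Section WeightZero.
Variables (k : fieldType) (A : algType k) (H : pbw_algebra A).
Hypothesis char0 : [pchar k] =i pred0.
Local Notation E := (gE H).
Local Notation sh := (@shift k).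
Local Notation f0 := (@form0 k A H).
Local Notation f1 := (@form1 k A H).
Local Notation f2 := (@form2 k A H).
Local Notation f3 := (@form3 k A H).
Local Notation wt := (@wt k A H).

Local Notation W := (cochain A).
Local Notation delta n := (@codiff k A H n).
Local Notation lam n := (@wtop k A H n).
Local Notation Z0 n := (@cocycle0 k A H n).
Local Notation B0 n := (@coboundary0 k A H n).
Local Opaque shift mf.

Section Delta2.
Variables a1 a2 a3 b1 b2 b3 c1 c2 c3 : {poly k}.
Lemma delta2_f1 : delta 2 (f1 a1 a2 a3, f1 b1 b2 b3, f1 c1 c2 c3) =
  (f2 (b1 - sh b1) (b2 - sh b2 - a1 + sh a1 + sh a3) (b3 - sh b3)
      (- a2 + sh a2 + sh a3) (- a3 + sh a3) 0,
   f2 (- c1 + sh c1) (a2 - c2 + sh c2) (a1 - sh a1 - c3 + sh c3)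
      a2 (a2 - sh a2) (a3 - sh a3),
   f2 (- b1)
      (- b1 - sh b1 - sh b3 - sh a1 - sh a3 - c1 + sh c1 + sh c3)
      (b1 - sh b1 - b3)
      (- sh b2 - sh b3 - sh a2 - sh a3 - c2 + sh c2 + sh c3)
      (b2 - sh b2 - b3 - sh b3 - sh a3 - c3 + sh c3)
      (b3 - sh b3)).
Proof.
rewrite /= /br !x_f1 !f1_x !y_f1 !f1_y !D_f1 !f1_D.
by congr (_, _, _); rewrite /form2 !(mfD, mfN, mf0); abel.
Qed.
End Delta2.

Lemma delta3_f2 p6 q4 q5 q6 r1 r2 r3 r4 r5 r6 :
  delta 3 (f2 0 0 0 0 0 p6, f2 0 0 0 q4 q5 q6, f2 r1 r2 r3 r4 r5 r6) =
  f3 (sh r1 - r1) (- sh p6 - sh q6 + sh r2 - r2) (sh r3 - r3)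
     (- (sh p6 *+ 3) - sh q5 - sh q6 *+ 3 + sh r4 - r4)
     (- (sh p6 *+ 2) - sh q6 *+ 2 + sh r5 - r5) (- p6 + sh r6 - r6)
     (- (sh p6 *+ 2) + q4 - sh q4 - sh q5 - sh q6 *+ 2)
     (- (sh p6 *+ 2) + q5 - sh q5 - sh q6 *+ 2)
     (- p6 - sh p6 + q6 - sh q6) (p6 - sh p6).
Proof.
rewrite /= /br D_f2 f2_D !y_f2 !f2_y !x_f2 f2_x !shift0.
by rewrite /form3 !(mfD, mfN, mf0, mfMn); abel.
Qed.

Lemma delta1_f0 p : delta 1 (f0 p) =
  (f1 (p - sh p) 0 0, f1 0 (p - sh p) 0, f1 0 0 (p - sh p)).
Proof.
rewrite /= /br x_f0 f0_x y_f0 f0_y D_f0 f0_D.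
by congr (_, _, _); rewrite /form1 !(mfD, mfN, mf0); abel.
Qed.

Lemma tripleB (a b c a' b' c' : A) :
  (a, b, c) - (a', b', c') = (a - a', b - b', c - c') :> (A * A * A)%type.
Proof. by []. Qed.
Lemma tripleD (a b c a' b' c' : A) :
  (a, b, c) + (a', b', c') = (a + a', b + b', c + c') :> (A * A * A)%type.
Proof. by []. Qed.
Lemma tripleZ t (a b c : A) :
  t *: (a, b, c) = (t *: a, t *: b, t *: c) :> (A * A * A)%type.
Proof. by []. Qed.

Ltac forms :=
  rewrite ?tripleB ?tripleD; congr (_, _, _);
  rewrite /form0 /form1 /form2 ?(mfD, mfN, mf0); abel.

Lemma wt3_eq0 n a b c :
  wt3 H n (a, b, c) = 0 <-> [/\ wt n a = 0, wt n b = 0 & wt n c = 0].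
Proof.
rewrite /wt3 /=; split=> [[-> -> ->] //|[-> -> ->] //].
Qed.

Lemma lam_f1 a1 a2 a3 b1 b2 b3 c1 c2 c3 :
  lam 2 (f1 a1 a2 a3, f1 b1 b2 b3, f1 c1 c2 c3) = 0.
Proof.
by apply/wt3_eq0; split; apply/(f1P H char0); [exists a1, a2, a3 |
  exists b1, b2, b3 | exists c1, c2, c3].
Qed.
Lemma lam_f2 a1 a2 a3 a4 a5 a6 b1 b2 b3 b4 b5 b6 c1 c2 c3 c4 c5 c6 :
  lam 3 (f2 a1 a2 a3 a4 a5 a6, f2 b1 b2 b3 b4 b5 b6, f2 c1 c2 c3 c4 c5 c6) = 0.
Proof.
by apply/wt3_eq0; split; apply/(f2P H char0); [exists a1, a2, a3, a4, a5, a6 |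
  exists b1, b2, b3, b4, b5, b6 | exists c1, c2, c3, c4, c5, c6].
Qed.
Lemma lam_f2_inv (v : W 3) : lam _ v = 0 ->
  exists a1 a2 a3 a4 a5 a6 b1 b2 b3 b4 b5 b6 c1 c2 c3 c4 c5 c6,
  v = (f2 a1 a2 a3 a4 a5 a6, f2 b1 b2 b3 b4 b5 b6, f2 c1 c2 c3 c4 c5 c6).
Proof.
case: v => -[a b] c /wt3_eq0[].
move=> /(f2P H char0)[a1 [a2 [a3 [a4 [a5 [a6 ->]]]]]].
move=> /(f2P H char0)[b1 [b2 [b3 [b4 [b5 [b6 ->]]]]]].
move=> /(f2P H char0)[c1 [c2 [c3 [c4 [c5 [c6 ->]]]]]].
by exists a1, a2, a3, a4, a5, a6, b1, b2, b3, b4, b5, b6, c1, c2, c3, c4, c5, c6.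
Qed.
Lemma lam_f1_inv (v : W 2) : lam _ v = 0 ->
  exists a1 a2 a3 b1 b2 b3 c1 c2 c3,
  v = (f1 a1 a2 a3, f1 b1 b2 b3, f1 c1 c2 c3).
Proof.
case: v => -[a b] c /wt3_eq0[].
move=> /(f1P H char0)[a1 [a2 [a3 ->]]] /(f1P H char0)[b1 [b2 [b3 ->]]].
move=> /(f1P H char0)[c1 [c2 [c3 ->]]].
by exists a1, a2, a3, b1, b2, b3, c1, c2, c3.
Qed.

Lemma f0_0 : f0 0 = 0. Proof. by rewrite /form0 mf0. Qed.
Lemma f1_0 : f1 0 0 0 = 0. Proof. by rewrite /form1 !mf0 !addr0. Qed.
Lemma f2_0 : f2 0 0 0 0 0 0 = 0. Proof. by rewrite /form2 !mf0 !addr0. Qed.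
Lemma f3_0 : f3 0 0 0 0 0 0 0 0 0 0 = 0.
Proof. by rewrite /form3 !mf0 !addr0. Qed.

Lemma fixed_const p : p - sh p = 0 -> exists c, p = c%:P.
Proof.
move=> /eqP; rewrite subr_eq0 => /eqP E; apply: shift_fixed => //.
Qed.

Lemma unshift p : exists q, q - sh q = p.
Proof.
have [q qE] := shift_sub_surj char0 (- p); exists q.
by rewrite -opprB qE opprK.
Qed.

Lemma H0_const (z : W 1) : Z0 1 z -> exists c, z = f0 c%:P.
Proof.
move=> [/(f0P H char0)[r ->]]; rewrite delta1_f0 => -[E _ _].
have [/fixed_const[c ->] _ _] := f1_inj (etrans E (esym f1_0)).
by exists c.
Qed.

Lemma H0_dim1 : quotient_dim (Z0 1) (B0 1) 1.
Proof.
apply: (quotient_dim_basis (e := fun _ => f0 1%:P : W 1)).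
- exact: B0_subspace.
- move=> _; split; first by apply/(f0P H char0); exists 1%:P.
  rewrite delta1_f0 shiftC subrr -[RHS]/(0, 0, 0) -f1_0.
  by [].
- move=> _ /H0_const[c ->]; exists (fun=> c); exists 0; first by [].
  rewrite big_ord_recl big_ord0 addr0 /=.
  by rewrite /form0 -mfZ -mul_polyC mulr1 subrr.
- move=> c [g _]; rewrite big_ord_recl big_ord0 addr0 /= => E i.
  have : f0 (c ord0)%:P = f0 0.
    by rewrite f0_0 -E /form0 -mfZ -mul_polyC mulr1.
  by move=> /f0_inj /polyC_inj c0; rewrite (ord1 i).
Qed.

(** The surjective difference operator removes [a1] by a coboundary. The cocycle equations then
    annihilate all other coefficients except those of [x] and [y] in the value on [D], which they
    force to be constant. *)
Lemma H1_rep (v : W 2) : Z0 _ v -> exists p s t,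
  v = (delta _ (f0 p : W 1) : W 2) + (f1 0 0 0, f1 0 0 0, f1 s%:P t%:P 0).
Proof.
move=> [/lam_f1_inv[a1 [a2 [a3 [b1 [b2 [b3 [c1 [c2 [c3 ->]]]]]]]]]].
(* The coboundary of [form0 p] has [p - p(E + 1)] in the place of [a1], and likewise in those of
   [b2] and [c3]. *)
have [p pE] := unshift a1.
have E0 : (f1 a1 a2 a3, f1 b1 b2 b3, f1 c1 c2 c3) =
    (delta _ (f0 p : W 1) : W 2) +
    (f1 0 a2 a3, f1 b1 (b2 - (p - sh p)) b3, f1 c1 c2 (c3 - (p - sh p))).
  by rewrite delta1_f0 -pE; forms.
rewrite E0 (linear_add _ _ (delta_linear H (n := 2))) delta_delta add0r.
set b2' := b2 - _; set c3' := c3 - _; rewrite delta2_f1.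
move=> -[EP EQ ER].
have [[P1 P2 P3] [P4 P5 _]] := f2_inj (etrans EP (esym f2_0)).
have [[Q1 Q2 Q3] [Q4 Q5 _]] := f2_inj (etrans EQ (esym f2_0)).
have [[R1 R2 R3] [R4 _ _]] := f2_inj (etrans ER (esym f2_0)).
(* This is [Q4], the coefficient of [y^2] in the equation for [Dx]. *)
have a20 : a2 = 0 by [].
rewrite a20 shift0 in P4.
have sa3 : sh a3 = 0 by rewrite -P4; abel.
have a30 : a3 = 0 by apply: (lin2 sa3 (esym P5)); abel.
rewrite a20 a30 !shift0 in P1 P2 P3 P4 P5 Q1 Q2 Q3 R1 R2 R3 R4.
have b10 : b1 = 0 by apply: (lin1 (esym R1)); abel.
have b30 : b3 = 0 by apply: (lin2 P1 (esym R3)); abel.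
have c3s : c3' - sh c3' = 0 by apply: (lin1 (esym Q3)); abel.
rewrite b10 b30 !shift0 in R2 R4 R3 P1.
have Q1' : c1 - sh c1 = 0 by apply: (lin1 (esym Q1)); abel.
have c30 : c3' = 0 by apply: (lin3 R2 c3s Q1'); abel.
rewrite c30 shift0 in R4.
have b20 : b2' = 0 by apply: (lin3 P2 (esym R4) Q2); abel.
have [s sE] := fixed_const Q1'.
have Q2' : c2 - sh c2 = 0 by apply: (lin1 (esym Q2)); abel.
have [t tE] := fixed_const Q2'.
by exists p, s, t; rewrite a20 a30 b10 b20 b30 c30 sE tE.
Qed.

Lemma H0_dim2 : quotient_dim (Z0 2) (B0 2) 2.
Proof.
pose e (i : 'I_2) : W 2 := (f1 0 0 0, f1 0 0 0, f1 (i == ord0)%:R (i != ord0)%:R 0).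
have eE (c : 'I_2 -> k) : \sum_i c i *: e i =
    (f1 0 0 0, f1 0 0 0, f1 (c ord0)%:P (c (lift ord0 ord0))%:P 0).
  rewrite !big_ord_recl big_ord0 addr0 /e !tripleZ tripleD f1_0 !scaler0 !addr0.
  congr (_, _, _); rewrite /form1 /= !mf0 !(addr0, add0r).
  by rewrite -!mfZ -!mul_polyC !mulr1.
have Cs (b : bool) : sh b%:R = b%:R by case: b; rewrite ?shift0 // -polyC1 shiftC.
apply: (quotient_dim_basis (e := e)).
- exact: B0_subspace.
- move=> i; split; first exact: lam_f1.
  rewrite /e delta2_f1 !shift0 !Cs -[RHS]/(0, 0, 0) -f2_0.
  by congr (_, _, _); congr f2; abel.
- move=> z /H1_rep[p [s [t ->]]].
  exists (fun i => if i == ord0 then s else t); exists (f0 p).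
    by apply/(f0P H char0); exists p.
  by rewrite eE /= addrK.
- move=> c [g /(f0P H char0)[p ->]]; rewrite eE delta1_f0 => -[_ _ E].
  have [/polyC_inj c0 /polyC_inj c1 _] := f1_inj E.
  move=> i; case: (unliftP ord0 i) => [j ->|-> //].
  by rewrite (ord1 j).
Qed.

Lemma f3_congr h1 h2 h3 h4 h5 h6 h7 h8 h9 h10 s1 s2 s3 s4 s5 s6 s7 s8 s9 s10 :
  h1 = s1 -> h2 = s2 -> h3 = s3 -> h4 = s4 -> h5 = s5 ->
  h6 = s6 -> h7 = s7 -> h8 = s8 -> h9 = s9 -> h10 = s10 ->
  f3 h1 h2 h3 h4 h5 h6 h7 h8 h9 h10 = f3 s1 s2 s3 s4 s5 s6 s7 s8 s9 s10.
Proof. by do 10![move=> ->]. Qed.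

(** Every 3-cochain of weight zero is a coboundary. The system is triangular: starting from the
    coefficient [h10] of [D^3], each unknown [q] satisfies an equation [q - q(E + 1) = r] with [r]
    already known. *)
Lemma H0_dim4 : quotient_dim (Z0 4) (B0 4) 0.
Proof.
apply: quotient_dim0 => h [/(f3P char0)].
move=> [h1 [h2 [h3 [h4 [h5 [h6 [h7 [h8 [h9 [h10 ->]]]]]]]]]] _.
have [p6 p6E] := unshift h10.
have [q6 q6E] := unshift (h9 + p6 + sh p6).
have [q5 q5E] := unshift (h8 + sh p6 *+ 2 + sh q6 *+ 2).
have [q4 q4E] := unshift (h7 + sh p6 *+ 2 + sh q5 + sh q6 *+ 2).
have [r1 r1E] := unshift (- h1).
have [r2 r2E] := unshift (- h2 - sh p6 - sh q6).
have [r3 r3E] := unshift (- h3).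
have [r4 r4E] := unshift (- h4 - sh p6 *+ 3 - sh q5 - sh q6 *+ 3).
have [r5 r5E] := unshift (- h5 - sh p6 *+ 2 - sh q6 *+ 2).
have [r6 r6E] := unshift (- h6 - p6).
exists (f2 0 0 0 0 0 p6, f2 0 0 0 q4 q5 q6, f2 r1 r2 r3 r4 r5 r6).
  exact: lam_f2.
rewrite delta3_f2; apply: f3_congr; apply: esym.
- by apply: (lin1 (esym r1E)); abel.
- by apply: (lin1 (esym r2E)); abel.
- by apply: (lin1 (esym r3E)); abel.
- by apply: (lin1 (esym r4E)); abel.
- by apply: (lin1 (esym r5E)); abel.
- by apply: (lin1 (esym r6E)); abel.
- by apply: (lin1 q4E); abel.
- by apply: (lin1 q5E); abel.
- by apply: (lin1 q6E); abel.
- by apply: (lin1 p6E); abel.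
Qed.
End WeightZero.

(** * Elimination in degree two *)

Section SecondCohomology.
Variables (k : fieldType) (A : algType k) (H : pbw_algebra A).
Hypothesis char0 : [pchar k] =i pred0.
Local Notation x := (gx H).
Local Notation D := (gD H).
Local Notation E := (gE H).
Local Notation sh := (@shift k).
Local Notation f1 := (@form1 k A H).
Local Notation f2 := (@form2 k A H).
Local Notation wt := (@wt k A H).
Local Notation W := (cochain A).
Local Notation delta n := (@codiff k A H n).
Local Notation lam n := (@wtop k A H n).
Local Notation Z0 n := (@cocycle0 k A H n).
Local Notation B0 n := (@coboundary0 k A H n).
Local Opaque shift mf.
Ltac forms :=
  rewrite ?tripleB ?tripleD; congr (_, _, _);
  rewrite /form0 /form1 /form2 ?(mfD, mfN, mf0); abel.

(** The two hypotheses are the coefficients of [D^3] and [y D^2] in the cocycle equation. The other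
    coefficients form a triangular system for the remaining unknowns, solvable by [unshift]. *)
Lemma H2_cocycle p6 q6 : sh p6 = p6 -> q6 - sh q6 = p6 *+ 2 ->
  exists q4 q5 r1 r2 r3 r4 r5 r6,
  delta 3 (f2 0 0 0 0 0 p6, f2 0 0 0 q4 q5 q6, f2 r1 r2 r3 r4 r5 r6) = 0.
Proof.
move=> sp6 q6E.
have [q5 q5E] := unshift char0 (sh p6 *+ 2 + sh q6 *+ 2).
have [q4 q4E] := unshift char0 (sh p6 *+ 2 + sh q5 + sh q6 *+ 2).
have [r2 r2E] := unshift char0 (- sh p6 - sh q6).
have [r4 r4E] := unshift char0 (- (sh p6 *+ 3) - sh q5 - sh q6 *+ 3).
have [r5 r5E] := unshift char0 (- (sh p6 *+ 2) - sh q6 *+ 2).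
have [r6 r6E] := unshift char0 (- p6).
exists q4, q5, 0, r2, 0, r4, r5, r6; rewrite delta3_f2; apply: etrans (f3_0 H); apply: f3_congr.
- by rewrite shift0 subrr.
- by apply: (lin1 (esym r2E)); abel.
- by rewrite shift0 subrr.
- by apply: (lin1 (esym r4E)); abel.
- by apply: (lin1 (esym r5E)); abel.
- by apply: (lin1 (esym r6E)); abel.
- by apply: (lin1 q4E); abel.
- by apply: (lin1 q5E); abel.
- by apply: (lin2 q6E (esym sp6)); abel.
- by rewrite sp6 subrr.
Qed.

(* Modulo coboundaries, a 2-cocycle of weight zero can be chosen with only [D^2]
   in the first component and without multiples of [x] in the second. *)
Lemma H2_reduce (v : W 3) : Z0 _ v -> exists g p6 q4 q5 q6 r1 r2 r3 r4 r5 r6,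
  [/\ lam 2 g = 0,
      v = (delta 2 g : W 3) +
       (f2 0 0 0 0 0 p6, f2 0 0 0 q4 q5 q6, f2 r1 r2 r3 r4 r5 r6) &
      delta 3 (f2 0 0 0 0 0 p6, f2 0 0 0 q4 q5 q6, f2 r1 r2 r3 r4 r5 r6) = 0].
Proof.
move=> [/(lam_f2_inv char0)].
move=> [p1 [p2 [p3 [p4 [p5 [p6 [q1 [q2 [q3 [q4 [q5 [q6 Hr]]]]]]]]]]]].
move: Hr => [r1 [r2 [r3 [r4 [r5 [r6 ->]]]]]].
(* In [delta2_f1], [a3] and [a2] account for [yD] and [y^2] in the first component, the [b]s for its
   multiples of [x], and the [c]s for the multiples of [x] in the second; [a1] is taken to be 0. *)
have [a3 a3E] := unshift char0 (- p5).
have [a2 a2E] := unshift char0 (- p4 + sh a3).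
have [b1 b1E] := unshift char0 p1.
have [b2 b2E] := unshift char0 (p2 - sh a3).
have [b3 b3E] := unshift char0 p3.
have [c1 c1E] := unshift char0 (- q1).
have [c2 c2E] := unshift char0 (a2 - q2).
have [c3 c3E] := unshift char0 (- q3).
have p1E : p1 = b1 - sh b1 by apply: esym.
have p2E : p2 = b2 - sh b2 + sh a3 by apply: (lin1 (esym b2E)); abel.
have p3E : p3 = b3 - sh b3 by apply: esym.
have p4E : p4 = - a2 + sh a2 + sh a3 by apply: (lin1 a2E); abel.
have p5E : p5 = - a3 + sh a3 by apply: (lin1 a3E); abel.
have q1E : q1 = - c1 + sh c1 by apply: (lin1 c1E); abel.
have q2E : q2 = a2 - c2 + sh c2 by apply: (lin1 c2E); abel.
have q3E : q3 = - c3 + sh c3 by apply: (lin1 c3E); abel.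
pose s1 := r1 + b1.
pose s2 := r2 - (- b1 - sh b1 - sh b3 - sh a3 - c1 + sh c1 + sh c3).
pose s3 := r3 - (b1 - sh b1 - b3).
pose s4 := r4 - (- sh b2 - sh b3 - sh a2 - sh a3 - c2 + sh c2 + sh c3).
pose s5 := r5 - (b2 - sh b2 - b3 - sh b3 - sh a3 - c3 + sh c3).
pose s6 := r6 - (b3 - sh b3).
pose t4 := q4 - a2; pose t5 := q5 - (a2 - sh a2); pose t6 := q6 - (a3 - sh a3).
have E0 : (f2 p1 p2 p3 p4 p5 p6, f2 q1 q2 q3 q4 q5 q6, f2 r1 r2 r3 r4 r5 r6) =
   (delta 2 (f1 0 a2 a3, f1 b1 b2 b3, f1 c1 c2 c3) : W 3) +
   (f2 0 0 0 0 0 p6, f2 0 0 0 t4 t5 t6, f2 s1 s2 s3 s4 s5 s6).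
  rewrite delta2_f1 p1E p2E p3E p4E p5E q1E q2E q3E !shift0.
  rewrite /s1 /s2 /s3 /s4 /s5 /s6 /t4 /t5 /t6; forms.
move=> dv; exists (f1 0 a2 a3, f1 b1 b2 b3, f1 c1 c2 c3), p6, t4, t5, t6.
exists s1, s2, s3, s4, s5, s6; split; [exact: lam_f1 | exact: E0 |].
by move: dv; rewrite E0 (linear_add _ _ (delta_linear H (n := 3))) delta_delta add0r.
Qed.

(** The cocycle equation makes all coefficients constant. Coboundaries with constant coefficients
    then remove [x^2], [xy], [xD] and [y^2], so that [yD] and [D^2] survive. *)
Lemma H2_const r1 r2 r3 r4 r5 r6 :
  delta 3 (f2 0 0 0 0 0 0, f2 0 0 0 0 0 0, f2 r1 r2 r3 r4 r5 r6) = 0 ->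
  exists g s t, lam 2 g = 0 /\
  (f2 0 0 0 0 0 0, f2 0 0 0 0 0 0, f2 r1 r2 r3 r4 r5 r6) = (delta 2 g : W 3) +
  (f2 0 0 0 0 0 0, f2 0 0 0 0 0 0, f2 0 0 0 0 s%:P t%:P).
Proof.
rewrite delta3_f2 => Ef; have := f3_inj (etrans Ef (esym (f3_0 H))).
rewrite !shift0 => -[[E1 E2 E3 E4 E5] [E6 _ _ _ _]].
have const r : sh r - r = 0 -> exists c, r = c%:P.
  by move=> E; apply: fixed_const => //; rewrite -opprB E oppr0.
have [c1 ->] := const _ E1.
have [c2 ->] : exists c, r2 = c%:P by apply: const; apply: (lin1 E2); abel.
have [c3 ->] := const _ E3.
have [c4 ->] : exists c, r4 = c%:P by apply: const; apply: (lin1 E4); abel.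
have [c5 ->] : exists c, r5 = c%:P by apply: const; apply: (lin1 E5); abel.
have [c6 ->] : exists c, r6 = c%:P by apply: const; apply: (lin1 E6); abel.
(* The witnesses solve [delta2_f1] for the coefficients of [x^2], [xD], [xy] and [y^2]. Their
   coboundary also contains [2 c3] times [yD], which is subtracted from [c5]. *)
pose c := c2 - c1 *+ 2 - c3.
exists (f1 0 0 0, f1 (- c1)%:P (c - - c3 - c4)%:P (- c3)%:P, f1 0 0 c%:P).
exists (c5 - c3 *+ 2), c6; split; first exact: lam_f1.
rewrite delta2_f1 !shift0 !shiftC /c.
rewrite !(polyCD, polyCN, polyCMn).
set e1 := c1%:P; set e2 := c2%:P; set e3 := c3%:P; set e4 := c4%:P.
by set e5 := c5%:P; set e6 := c6%:P; forms.
Qed.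

Lemma H2_normal q4 q5 r1 r2 r3 r4 r5 r6 :
  delta 3 (f2 0 0 0 0 0 0, f2 0 0 0 q4 q5 0, f2 r1 r2 r3 r4 r5 r6) = 0 ->
  exists g s t, lam 2 g = 0 /\
  (f2 0 0 0 0 0 0, f2 0 0 0 q4 q5 0, f2 r1 r2 r3 r4 r5 r6) = (delta 2 g : W 3) +
  (f2 0 0 0 0 0 0, f2 0 0 0 0 0 0, f2 0 0 0 0 s%:P t%:P).
Proof.
move=> dN; have := dN; rewrite delta3_f2 => Ef.
have := f3_inj (etrans Ef (esym (f3_0 H))); rewrite !shift0.
move=> [_ [_ E7 E8 _ _]].
have q5E : sh q5 = q5 by apply: (lin1 (esym E8)); abel.
have q4E : q4 = sh q4 + q5 by apply: (lin2 E7 q5E); abel.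
have [b2 b2E] := unshift char0 (- sh q5).
have [c2 c2E] := unshift char0 q4.
(* With [a2 = q4] and [a3 = q5] the coboundary has the required second component, because the
   cocycle equations say [q4 - q4(E + 1) = q5 = q5(E + 1)]. [b2] and [c2] cancel the coefficients of
   [xy] that arise in the first two components. *)
pose g : W 2 := (f1 0 q4 q5, f1 0 b2 0, f1 0 c2 0).
have [s1 [s2 [s3 [s4 [s5 [s6 E0]]]]]] : exists s1 s2 s3 s4 s5 s6,
    (f2 0 0 0 0 0 0, f2 0 0 0 q4 q5 0, f2 r1 r2 r3 r4 r5 r6) = (delta 2 g : W 3) +
    (f2 0 0 0 0 0 0, f2 0 0 0 0 0 0, f2 s1 s2 s3 s4 s5 s6).
  rewrite /g delta2_f1 !shift0.
  have -> : b2 - sh b2 - 0 + 0 + sh q5 = 0 by apply: (lin1 b2E); abel.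
  have -> : - q4 + sh q4 + sh q5 = 0 by rewrite q5E; apply: (lin1 (esym q4E)); abel.
  have -> : - q5 + sh q5 = 0 by rewrite q5E; abel.
  have -> : q5 - sh q5 = 0 by rewrite q5E; abel.
  have -> : q4 - c2 + sh c2 = 0 by apply: (lin1 (esym c2E)); abel.
  have -> : q4 - sh q4 = q5 by apply: (lin1 q4E); abel.
  exists r1, (r2 - (- sh q5 + 0 + 0)), r3, (r4 - (- sh b2 - sh q4 - sh q5 - c2 + sh c2)),
    (r5 - (b2 - sh b2 - sh q5)), r6.
  forms.
have dM : delta 3 (f2 0 0 0 0 0 0, f2 0 0 0 0 0 0, f2 s1 s2 s3 s4 s5 s6) = 0.
  by move: dN; rewrite E0 (linear_add _ _ (delta_linear H (n := 3))) delta_delta add0r.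
have [g' [s [t [lg' E1]]]] := H2_const dM.
exists (g + g'), s, t; split.
  by rewrite (linear_add _ _ (wtop_linear H (n := 2))) lg' addr0; exact: lam_f1.
by rewrite E0 E1 (linear_add _ _ (delta_linear H (n := 2))) addrA.
Qed.

(** Two dimensions come from the possible pairs [(p6, q6)], two from the constants that [H2_normal]
    leaves when that pair vanishes. *)
Lemma H0_dim3 : quotient_dim (Z0 3) (B0 3) 4.
Proof.
have [w wE] := unshift char0 (1%:P *+ 2 : {poly k}).
have [|u4 [u5 [u [u2 [u3 [u6 [u7 [u8 dE3]]]]]]]] := @H2_cocycle 0 1%:P (shift0 k).
  by rewrite shiftC subrr mul0rn.
have [|v4 [v5 [v [v2 [v3 [v6 [v7 [v8 dE4]]]]]]]] := @H2_cocycle 1%:P w (shiftC 1).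
  exact: wE.
(* On the [D^2]-coefficients [p6], [q6] of the first two components the cocycle
   equation reads [q6 - q6(E + 1) = 2 p6] with [p6] constant: [E3] and [E4] complete
   its solutions [(0, 1)] and [(1, w)]. *)
pose E1 : W 3 := (f2 0 0 0 0 0 0, f2 0 0 0 0 0 0, f2 0 0 0 0 0 1%:P).
pose E2 : W 3 := (f2 0 0 0 0 0 0, f2 0 0 0 0 0 0, f2 0 0 0 0 1%:P 0).
pose E3 : W 3 := (f2 0 0 0 0 0 0, f2 0 0 0 u4 u5 1%:P, f2 u u2 u3 u6 u7 u8).
pose E4 : W 3 := (f2 0 0 0 0 0 1%:P, f2 0 0 0 v4 v5 w, f2 v v2 v3 v6 v7 v8).
pose e (i : 'I_4) : W 3 := nth 0 [:: E1; E2; E3; E4] i.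
have sumE (c : 'I_4 -> k) : \sum_i c i *: e i =
    c ord0 *: E1 + (c (lift ord0 ord0) *: E2 + (c (lift ord0 (lift ord0 ord0)) *: E3 +
    c (lift ord0 (lift ord0 (lift ord0 ord0))) *: E4)).
  by rewrite !big_ord_recl big_ord0 addr0 /e.
have mfC i j p (c : k) : mf H i j p c%:P = c *: mf H i j p 1%:P.
  by rewrite -mfZ -mul_polyC mulr1.
have comb (c1 c2 c3 c4 : k) : c1 *: E1 + (c2 *: E2 + (c3 *: E3 + c4 *: E4)) =
    (f2 0 0 0 0 0 c4%:P,
     f2 0 0 0 (c3 *: u4 + c4 *: v4) (c3 *: u5 + c4 *: v5) (c3%:P + c4 *: w),
     f2 (c3 *: u + c4 *: v) (c3 *: u2 + c4 *: v2) (c3 *: u3 + c4 *: v3)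
        (c3 *: u6 + c4 *: v6) (c2%:P + c3 *: u7 + c4 *: v7)
        (c1%:P + c3 *: u8 + c4 *: v8)).
  rewrite /E1 /E2 /E3 /E4 !tripleZ !tripleD; congr (_, _, _);
    by rewrite /= /form2 !(mfD, mf0, mfZ) ?(mfC _ _ _ c1) ?(mfC _ _ _ c2)
      ?(mfC _ _ _ c3) ?(mfC _ _ _ c4) !scalerDr !scaler0; abel.
have dconst p : p - sh p = 0 -> sh p = p.
  by move=> E; apply: (lin1 (esym E)); abel.
apply: (quotient_dim_basis (e := e)).
- exact: B0_subspace.
- move=> i; rewrite /e; case: i => -[|[|[|[|//]]]] /= _; split;
    try exact: lam_f2; try by [].
  + rewrite delta3_f2; apply: etrans (f3_0 H); rewrite !shift0 !shiftC.
    by apply: f3_congr; abel.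
  + rewrite delta3_f2; apply: etrans (f3_0 H); rewrite !shift0 !shiftC.
    by apply: f3_congr; abel.
- move=> z /H2_reduce[g [p6 [q4 [q5 [q6 [r1 [r2 [r3 [r4 [r5 [r6 [lg -> dN]]]]]]]]]]]].
  have := dN; rewrite delta3_f2 => Ef.
  have [_ [_ _ _ E9 E10]] := f3_inj (etrans Ef (esym (f3_0 H))).
  have [c4 c4E] := fixed_const char0 E10.
  (* [q6] and [c4 *: w] solve the same difference equation, hence differ by a constant. *)
  have [c3 c3E] : exists c, q6 - c4 *: w = c%:P.
    apply: fixed_const => //; rewrite shiftB shiftZ.
    have wE4 : c4 *: w - c4 *: sh w = p6 *+ 2.
      by rewrite -scalerBr wE c4E -scalerMnr -mul_polyC -polyCM mulr1.
    by apply: (lin3 E9 (esym wE4) (dconst _ E10)); abel.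
  set N : W 3 := (f2 _ _ _ _ _ p6, _, _) in dN *.
  (* The zero multiples of [E1] and [E2] bring the combination into the shape of [comb]. *)
  have ME : N - (0 *: E1 + (0 *: E2 + (c3 *: E3 + c4 *: E4))) =
      (f2 0 0 0 0 0 0,
       f2 0 0 0 (q4 - (c3 *: u4 + c4 *: v4)) (q5 - (c3 *: u5 + c4 *: v5)) 0,
       f2 (r1 - (c3 *: u + c4 *: v)) (r2 - (c3 *: u2 + c4 *: v2))
          (r3 - (c3 *: u3 + c4 *: v3)) (r4 - (c3 *: u6 + c4 *: v6))
          (r5 - (c3 *: u7 + c4 *: v7)) (r6 - (c3 *: u8 + c4 *: v8))).
    rewrite comb /N -c4E -c3E polyC0; forms.
  have dM : delta 3 (N - (0 *: E1 + (0 *: E2 + (c3 *: E3 + c4 *: E4)))) = 0.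
    rewrite (linear_sub _ _ (delta_linear H (n := 3))) dN !scale0r !add0r.
    rewrite (linear_add _ _ (delta_linear H (n := 3))).
    have dZ c (t : W 3) : delta 3 t = 0 -> delta 3 (c *: t) = 0.
      move=> t0; have := delta_linear H (n := 3) c t 0.
      by rewrite !addr0 t0 scaler0 (linear_at0 (delta_linear H (n := 3))) addr0.
    by rewrite !dZ // addr0 oppr0.
  rewrite ME in dM; have [g' [s [t [lg' E0]]]] := H2_normal dM.
  exists (fun i => nth 0 [:: t; s; c3; c4] i); exists (g + g').
    by rewrite (linear_add _ _ (wtop_linear H (n := 2))) lg lg' addr0.
  have -> : \sum_(i < 4) nth 0 [:: t; s; c3; c4] i *: e i =
      t *: E1 + (s *: E2 + (c3 *: E3 + c4 *: E4)) by rewrite sumE.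
  rewrite (linear_add _ _ (delta_linear H (n := 2))).
  have -> : N = (N - (0 *: E1 + (0 *: E2 + (c3 *: E3 + c4 *: E4)))) +
       (c3 *: E3 + c4 *: E4) by rewrite !scale0r !add0r subrK.
  rewrite ME E0.
  have -> : (f2 0 0 0 0 0 0, f2 0 0 0 0 0 0, f2 0 0 0 0 s%:P t%:P) =
      t *: E1 + (s *: E2 + (0 *: E3 + 0 *: E4)) :> W 3.
    by rewrite comb !scale0r !addr0 polyC0.
  by rewrite !scale0r !addr0; abel.
- move=> c [g /(lam_f1_inv char0)].
  move=> [a1 [a2 [a3 [b1 [b2 [b3 [c1 [c2 [c3 ->]]]]]]]]].
  rewrite sumE comb delta2_f1.
  set d0 := c ord0; set d1 := c (lift ord0 ord0).
  set d2 := c (lift ord0 (lift ord0 ord0)).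
  set d3 := c (lift ord0 (lift ord0 (lift ord0 ord0))) => -[EP EQ ER].
  have [[P1 P2 P3] [P4 P5 P6]] := f2_inj EP.
  have [[Q1 Q2 Q3] [Q4 Q5 Q6]] := f2_inj EQ.
  have [[R1 R2 R3] [R4 R5 R6]] := f2_inj ER.
  (* A coboundary has no [D^2] in its first component. In the second it has [a3 - a3(E + 1)], which
     the coefficient of [yD] in the first forces to vanish; so [d3] and then [d2] are zero. *)
  have d30 : d3 = 0 by apply: polyC_inj; rewrite P6.
  rewrite d30 !scale0r !addr0 in Q1 Q2 Q3 Q4 Q5 Q6 R3 R5 R6.
  have d20 : d2 = 0.
    by apply: polyC_inj; rewrite polyC0; apply: (lin2 Q6 P5); abel.
  rewrite d20 !scale0r ?addr0 in Q4 R3 R5 R6.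
  rewrite -Q4 shift0 in P4.
  have sa3 : sh a3 = 0 by rewrite P4; abel.
  have a30 : a3 = 0 by apply: (lin2 sa3 P5); abel.
  rewrite a30 shift0 in P2 R5.
  have d00 : d0 = 0.
    by apply: polyC_inj; rewrite polyC0; apply: (lin2 R6 (esym P3)); abel.
  have b30 : b3 = 0 by apply: (lin2 R3 (esym P1)); abel.
  rewrite b30 !shift0 in R5.
  have d10 : d1 = 0.
    apply: polyC_inj; rewrite polyC0; apply: (lin3 R5 (esym P2) (esym Q3)); abel.
  move=> i; case: i => -[|[|[|[|//]]]] lti; rewrite /=.
  + by rewrite -d00; congr c; apply: val_inj.
  + by rewrite -d10; congr c; apply: val_inj.
  + by rewrite -d20; congr c; apply: val_inj.
  + by rewrite -d30; congr c; apply: val_inj.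
Qed.

Lemma H0_dim n : quotient_dim (Z0 n) (B0 n) (dim0 n).
Proof.
have rV0 (B : set 'rV[k]_0) : B 0 -> forall v, B v.
  by move=> B0 v; rewrite [v]thinmx0.
case: n => [|[|[|[|[|n]]]]].
- by apply: quotient_dim0 => z _; exact: (rV0 (B0 0)).
- exact: H0_dim1.
- exact: H0_dim2.
- exact: H0_dim3.
- exact: H0_dim4.
- apply: quotient_dim0 => z _; apply: (rV0 (B0 n.+4.+1)).
  exact: (proj1 (B0_subspace H n.+4.+1)).
Qed.
End SecondCohomology.

(** * The cone of the weight operator *)

Section TotalComplex.
Variables (k : fieldType) (A : algType k) (H : pbw_algebra A).
Hypothesis char0 : [pchar k] =i pred0.
Local Notation W := (cochain A).
Local Notation delta n := (@codiff k A H n).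
Local Notation lam n := (@wtop k A H n).
Local Notation Z0 n := (@cocycle0 k A H n).
Local Notation R := (regular_bimodule A).

Let dlin n : linear (delta n) := @delta_linear _ _ H n.
Let llin n : linear (lam n) := @wtop_linear _ _ H n.

Let d0E n : delta n 0 = 0. Proof. by rewrite (linear_at0 (@dlin n)). Qed.
Let l0E n : lam n 0 = 0. Proof. by rewrite (linear_at0 (@llin n)). Qed.

Lemma wtop_split n (v : W n) : exists v0 v', lam n v0 = 0 /\ v = v0 + lam n v'.
Proof.
have sp m (a : A) : exists a0 a', wt H m a0 = 0 /\ a = a0 + wt H m a'.
  have [||c i j p q|a0 [a' [_ w0 aE]]] := @wt_split _ _ H char0 m (fun=> True) _ _ _ a => //.
  by exists a0, a'.
have sp3 m (w : A * A * A) : exists w0 w', wt3 H m w0 = 0 /\ w = w0 + wt3 H m w'.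
  case: w => -[a b] c; have [a0 [a' [wa ->]]] := sp m a.
  have [b0 [b' [wb ->]]] := sp m b; have [c0 [c' [wc ->]]] := sp m c.
  by exists (a0, b0, c0), (a', b', c'); rewrite /wt3 /= wa wb wc.
case: n v => [|[|[|[|[|n]]]]] v.
- by exists v, 0; rewrite addr0.
- exact: sp.
- exact: sp3.
- exact: sp3.
- exact: sp.
- by exists v, 0; rewrite addr0.
Qed.

Lemma wtop_ss n (v : W n) : lam n (lam n v) = 0 -> lam n v = 0.
Proof.
case: n v => [|[|[|[|[|n]]]]] v //=; try exact: wt_ss.
- by move=> [/wt_ss E1 /wt_ss E2 /wt_ss E3]; rewrite /wt3 E1 E2 E3.
- by move=> [/wt_ss E1 /wt_ss E2 /wt_ss E3]; rewrite /wt3 E1 E2 E3.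
Qed.

Local Arguments codiff : simpl never.
Local Arguments wtop : simpl never.
Local Arguments cochain : simpl never.
Local Arguments B_obj : simpl never.
Local Arguments B_diff : simpl never.
Local Arguments B_weight : simpl never.

(** The transpose of [cone_diff] sends [(v1, v2)] to [(delta v1, lam v1 - delta v2)]; [v1] has
    cohomological degree [n], and [v2] has degree [n - 1]. *)
Definition total_cocycle n : set (W n.+1 * W n)%type :=
  fun v => delta _ v.1 = 0 /\ lam _ v.1 = delta _ v.2.
Definition total_coboundary n : set (W n.+1 * W n)%type :=
  match n return set (W n.+1 * W n)%type with
  | 0 => fun v => v = 0
  | m.+1 => fun v => exists g1 g2,
      v.1 = delta m.+1 g1 /\ v.2 = lam _ g1 - delta m g2
  end.

Lemma cochain0_eq0 (v : W 0) : v = 0.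
Proof. exact: thinmx0. Qed.

Lemma total_coboundary_subspace n : subspace (@total_coboundary n).
Proof.
case: n => [|n]; split=> //=.
- by move=> a _ _ -> ->; rewrite scaler0 addr0.
- by exists 0, 0; split; rewrite ?d0E ?l0E ?subr0.
- move=> a u v [g1 [g2 [E1 E2]]] [h1 [h2 [F1 F2]]].
  exists (a *: g1 + h1), (a *: g2 + h2); split.
    by change (a *: u.1 + v.1 = delta n.+1 (a *: g1 + h1)); rewrite E1 F1 dlin.
  change (a *: u.2 + v.2 = lam n.+1 (a *: g1 + h1) - delta n (a *: g2 + h2)).
  by rewrite E2 F2 dlin llin scalerBr; abel.
Qed.

Lemma cocycle0_subspace n : subspace (Z0 n).
Proof.
split; first by split; [exact: l0E | exact: d0E].
by move=> a u v [u1 u2] [v1 v2]; split;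
  rewrite ?llin ?dlin ?u1 ?u2 ?v1 ?v2 scaler0 addr0.
Qed.

(** If [w = w0 + lam w'] with [w0] of weight zero, then [lam (v - delta w') = delta w0] has weight
    zero as well. By semisimplicity it vanishes, so both components are weight-zero cocycles. *)
Lemma total_cocycle_split n (v : W n.+1) (w : W n) : total_cocycle (v, w) ->
  exists w0 w', [/\ Z0 _ (v - delta _ w'), Z0 _ w0 & w = w0 + lam _ w'].
Proof.
move=> [/= dv lv]; have [w0 [w' [lw0 wE]]] := wtop_split w.
have lv1 : lam _ (v - delta _ w') = delta _ w0.
  rewrite (linear_sub _ _ (@llin _)) lv wE (linear_add _ _ (@dlin _)).
  by rewrite delta_lam addrK.
have lv0 : lam _ (v - delta _ w') = 0.
  by apply: wtop_ss; rewrite lv1 -delta_lam lw0 d0E.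
exists w0, w'; split=> //; split=> //; last by rewrite -lv1.
by rewrite (linear_sub _ _ (@dlin _)) dv delta_delta subr0.
Qed.

(** On the weight-zero part [lam] vanishes, so pairs of weight-zero cocycles are total cocycles.
    Their inclusion is an isomorphism on cohomology by [wtop_split] and [wtop_ss], and the
    dimensions add up. *)
Lemma total_dim n :
  quotient_dim (@total_cocycle n) (@total_coboundary n) (dim0 n.+1 + dim0 n).
Proof.
have := quotient_dim_prod (cocycle0_subspace n.+1) (cocycle0_subspace n)
  (H0_dim H char0 n.+1) (H0_dim H char0 n).
apply: (@quotient_dim_push _ _ _ (fun v : (W n.+1 * W n)%type => v)).
- by [].
- split; first by split; exact: (proj1 (cocycle0_subspace _)).
  move=> a u v [u1 u2] [v1 v2]; split; exact: (proj2 (cocycle0_subspace _)).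
- exact: total_coboundary_subspace.
- by move=> v [[l1 e1] [l2 e2]]; split; rewrite // l1 e2.
- case=> v w /total_cocycle_split[w0 [w' [vP wP wE]]].
  exists (v - delta _ w', w0); first by split.
  have -> : (v, w) - (v - delta _ w', w0) = (delta _ w', lam _ w') :> (_ * _)%type.
    by congr pair; rewrite /= ?wE; abel.
  case: n v w w0 w' vP wP wE => [|n] v w w0 w' _ _ _ /=.
    by rewrite (cochain0_eq0 w') !(d0E, l0E).
  by exists w', 0; rewrite ?(d0E, l0E) // subr0.
- case=> v w [/= [g lg ->]].
  case: n v w g lg => [|n] v w g lg /=.
    by move=> ->; rewrite (cochain0_eq0 g) d0E.
  move=> [g' lg' ->]; exists g, (- g'); split=> //.
  by rewrite lg -[- g']sub0r (linear_sub _ _ (@dlin _)) d0E !sub0r opprK.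
- case=> v w [[/= lv dv] [lw dw]].
  case: n v w lv dv lw dw => [|n] v w lv dv lw dw /=.
    by move=> [-> ->]; split=> //; exists 0; rewrite ?(d0E, l0E).
  move=> [g1 [g2 [vE wE]]].
  have [p0 [p' [lp0 pE]]] := wtop_split g1.
  have [q0 [q' [lq0 qE]]] := wtop_split g2.
  split.
    exists p0 => //; move: lv; rewrite vE pE (linear_add _ _ (@dlin _)).
    rewrite (linear_add _ _ (@llin _)) -delta_lam lp0 d0E add0r.
    by rewrite delta_lam => /wtop_ss ->; rewrite addr0.
  exists (- q0).
    by rewrite -[- q0]sub0r (linear_sub _ _ (@llin _)) ?(d0E, l0E) // lq0 subrr.
  have E1 : w = lam _ (g1 - delta _ q') - delta _ q0.
    rewrite wE qE (linear_add _ _ (@dlin _)) (linear_sub _ _ (@llin _)) delta_lam.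
    by abel.
  have : lam _ (lam _ (g1 - delta _ q')) = 0.
    move: lw; rewrite E1 (linear_sub _ _ (@llin _)) -[lam _ (delta _ q0)]delta_lam.
    by rewrite lq0 d0E subr0.
  move=> /wtop_ss E2; rewrite E1 E2 -[- q0]sub0r (linear_sub _ _ (@dlin _)).
  by rewrite d0E.
Qed.

Lemma hom_pairE (M N P : bimodule A) (h : prod_bimodule M N -> P) :
  bimod_hom h -> forall a b, h (a, b) = h (a, 0) + h (0, b).
Proof.
move=> hP a b; rewrite -(homD hP); congr (h (_, _)); first exact: esym (addr0 _).
exact: esym (add0r _).
Qed.

Local Notation C := (B_obj H).
Local Notation K := (K_resolution H).

Definition total_vals n (h : cone_obj C n -> R) : (W n.+1 * W n)%type :=
  (vals (fun c : C n.+1 => h (c, 0)), vals (fun b : C n => h (0, b))).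

Section Hom.
Variables (n : nat) (h : cone_obj C n -> R).
Hypothesis hP : bimod_hom h.
Lemma hom_fst : bimod_hom (fun c : C n.+1 => h (c, 0) : R).
Proof. exact: bimod_hom_comp hP (prod_hom_inl _ _). Qed.
Lemma hom_snd : bimod_hom (fun b : C n => h (0, b) : R).
Proof. exact: bimod_hom_comp hP (prod_hom_inr _ _). Qed.

Lemma total_vals_diff :
  total_vals (fun v : cone_obj C n.+1 => h (cone_diff (@B_diff _ _ H) (@B_weight _ _ H) v)) =
  (delta _ (total_vals h).1, lam _ (total_vals h).1 - delta _ (total_vals h).2).
Proof.
have d0 m : B_diff (0 : C m.+1) = 0 := hom0 (B_diff_hom H m).
have w0 m : B_weight (0 : C m) = 0 := hom0 (B_weight_hom H m).
rewrite /total_vals /=; congr pair.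
  rewrite -(vals_diff hom_fst); congr vals; apply: funext => c.
  by rewrite /cone_diff /= d0 w0 addr0 oppr0.
rewrite -(vals_diff hom_snd) -(vals_weight hom_fst).
rewrite -(linear_sub _ _ (@vals_linear _ _ H n.+1)); congr vals; apply: funext => b.
rewrite /cone_diff /= d0 add0r (hom_pairE hP).
have := homN hom_snd (B_diff b); rewrite /= => ->; by [].
Qed.
End Hom.

Lemma total_vals_inj n (h g : cone_obj C n -> R) : bimod_hom h -> bimod_hom g ->
  total_vals h = total_vals g -> forall v, h v = g v.
Proof.
move=> hP gP [/(vals_inj (hom_fst hP) (hom_fst gP)) E1].
move=> /(vals_inj (hom_snd hP) (hom_snd gP)) E2 [a b].
rewrite (hom_pairE hP) (hom_pairE gP).
by rewrite (congr1 (fun f => f a) E1) (congr1 (fun f => f b) E2).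
Qed.

Lemma total_vals_surj n (v : (W n.+1 * W n)%type) :
  exists2 h : cone_obj C n -> R, bimod_hom h & total_vals h = v.
Proof.
case: v => v1 v2; have [h1 h1P <-] := @vals_surj _ _ H _ v1.
have [h2 h2P <-] := @vals_surj _ _ H _ v2.
exists (fun v => h1 v.1 + h2 v.2).
  exact: bimod_homD (bimod_hom_comp h1P (prod_hom_fst _ _))
    (bimod_hom_comp h2P (prod_hom_snd _ _)).
by rewrite /total_vals; congr (_, _); congr vals; apply: funext => c;
  rewrite /= ?(hom0 h1P) ?(hom0 h2P) ?addr0 ?add0r.
Qed.

Lemma total_vals_linear n : linear (@total_vals n).
Proof.
move=> c h g; have L m := @vals_linear _ _ H m c.
exact: (congr2 pair (L _ (fun w => h (w, 0)) (fun w => g (w, 0)))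
  (L _ (fun w => h (0, w)) (fun w => g (0, w)))).
Qed.

Lemma total_vals0 n : total_vals (fun _ : cone_obj C n => 0 : R) = 0.
Proof. exact: linear_at0 (@total_vals_linear n). Qed.

Lemma total_cocycleP n (h : cone_obj C n -> R) : bimod_hom h ->
  total_cocycle (total_vals h) <-> ext_cocycle (P := K) h.
Proof.
move=> hP; have E := total_vals_diff hP; split.
  move=> [E1 E2]; split=> //.
  apply: (@total_vals_inj n.+1 _ (fun=> 0)).
  - exact: bimod_hom_comp hP (res_diff_hom K n).
  - exact: bimod_hom0.
  - by rewrite total_vals0 [LHS]E E1 E2 subrr.
move=> [_ h0].
have {}E := etrans (esym E) (etrans (congr1 (@total_vals n.+1) (funext h0)) (total_vals0 n.+1)).
by case: E => E1 /eqP; rewrite subr_eq0 => /eqP E2; split.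
Qed.

Lemma HH_dim_pbw n : HH_dim A n (dim0 n.+1 + dim0 n).
Proof.
apply: (@Ext_dim_of_resolution _ _ _ _ K).
apply: quotient_dim_pull (total_dim n).
- exact: (@total_vals_linear n).
- exact: ext_cocycle_subspace.
- exact: total_coboundary_subspace.
- by move=> h hP; apply/total_cocycleP => //; case: hP.
- move=> v vP; have [h hP hE] := total_vals_surj v.
  exists h; first by apply/total_cocycleP => //; rewrite hE.
  by rewrite hE subrr; exact: (proj1 (total_coboundary_subspace n)).
- case: n => [|n] h /=.
    by move=> h0; have -> : h = (fun=> 0) by exact: funext.
  move=> [g gP gE]; have -> : h = _ := funext gE.
  exists (total_vals g).1, (total_vals g).2.
  have E := total_vals_diff gP.
  case: E => E1 E2; split; [exact: E1 | exact: E2].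
- case: n => [|n] h [hP h0] /=.
    move=> hE x; have g0 := bimod_hom0 (cone_obj C 0) R.
    apply: (@total_vals_inj 0 h (fun=> 0) hP g0).
    exact: etrans hE (esym (total_vals0 0)).
  move=> [g1 [g2 [E1 E2]]]; have [g gP gE] := total_vals_surj (g1, g2).
  exists g => //; have dP := bimod_hom_comp gP (res_diff_hom K n).
  apply: (total_vals_inj hP dP); apply: etrans _ (esym (total_vals_diff gP)).
  rewrite gE; apply: etrans (surjective_pairing (total_vals h)) _.
  by congr pair; [exact: E1 | exact: E2].
Qed.

End TotalComplex.

(** * Derivations *)

Section Derivations.
Variables (k : fieldType) (A : algType k) (H : pbw_algebra A).
Hypothesis char0 : [pchar k] =i pred0.
Local Notation x := (gx H).
Local Notation y := (gy H).
Local Notation D := (gD H).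
Local Notation E := (gE H).
Local Notation W := (cochain A).
Local Notation R := (regular_bimodule A).
Local Notation C := (B_obj H).
Local Notation K := (K_resolution H).
Implicit Types X Y : A -> A.

Lemma derivation_subspace : subspace (@derivation k A).
Proof.
split.
  by split=> [c a b|a b]; rewrite /= ?scaler0 ?mul0r ?mulr0 addr0.
move=> c X Y [lX X_M] [lY Y_M]; split=> [t a b|a b].
  rewrite -[LHS]/(c *: X (t *: a + b) + Y (t *: a + b)) lX lY.
  rewrite -[RHS]/(t *: (c *: X a + Y a) + (c *: X b + Y b)).
  rewrite !scalerDr !scalerA [t * c]mulrC.
  exact: addrACA.
rewrite -[LHS]/(c *: X (a * b) + Y (a * b)) X_M Y_M.
rewrite -[RHS]/((c *: X a + Y a) * b + a * (c *: X b + Y b)).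
rewrite mulrDl mulrDr -scalerAl -scalerAr scalerDr.
exact: addrACA.
Qed.

Lemma derivation_inner (a : A) : derivation (fun b : A => a * b - b * a).
Proof.
split=> [c u v|u v].
  rewrite mulrDr mulrDl -scalerAr -scalerAl scalerBr; abel.
by rewrite mulrBl mulrBr !mulrA; abel.
Qed.

Lemma derivation_add X Y : derivation X -> derivation Y ->
  derivation (fun a : A => X a + Y a).
Proof.
move=> XP YP; have := proj2 derivation_subspace 1 X Y XP YP.
by congr (@derivation k A _); apply: funext => a; rewrite -[LHS]/(1 *: X a + Y a) scale1r.
Qed.

Lemma derivation_bracket X Y : derivation X -> derivation Y ->
  derivation (Lie_bracket X Y).
Proof.
move=> [lX X_M] [lY Y_M]; split=> [c a b|a b]; rewrite /Lie_bracket.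
  by rewrite lX lY lX lY scalerBr; abel.
rewrite X_M Y_M !(linear_add _ _ lX) !(linear_add _ _ lY) !X_M !Y_M.
by rewrite mulrBl mulrBr; abel.
Qed.

Lemma derivation1 X : derivation X -> X 1 = 0.
Proof.
move=> [_ /(_ 1 1)]; rewrite !mul1r mulr1 => /eqP.
by rewrite eq_sym -subr_eq0 addrK => /eqP.
Qed.

Lemma derivation_ext X Y : derivation X -> derivation Y ->
  X x = Y x -> X y = Y y -> X D = Y D -> X E = Y E -> forall a, X a = Y a.
Proof.
move=> XP YP; have [lX X_M] := XP; have [lY Y_M] := YP => Xx Xy XD XE.
have XM a b : X a = Y a -> X b = Y b -> X (a * b) = Y (a * b).
  by move=> Ea Eb; rewrite X_M Y_M Ea Eb.
have XX a n : X a = Y a -> X (a ^+ n) = Y (a ^+ n).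
  move=> Ea; elim: n => [|n IHn]; first by rewrite !derivation1.
  by rewrite exprS XM.
apply: (@pbw_span _ _ H); first by rewrite (linear_at0 lX) (linear_at0 lY).
by move=> c i j p q b Eb; rewrite lX lY Eb /pbw_mon !XM // !XX.
Qed.

(** The Koszul part of the cone takes the values on [x], [y], [D], the part added by the cone that
    on [E]. *)
Definition der_vals X : (W 2 * W 1)%type := ((X x, X y, X D), X E).

Lemma der_vals_linear : linear der_vals.
Proof. by []. Qed.

(** The six defining relations, differentiated: those among [x], [y], [D] give the Koszul equation,
    those with [E] the weight equation. *)
Lemma der_vals_cocycle X : derivation X -> total_cocycle H (n := 1) (der_vals X).
Proof.
move=> [lX X_M].
have [[Exy EDx] EDy] := (congr1 X (rel_xy H), congr1 X (rel_Dx H), congr1 X (rel_Dy H)).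
have [[EEx EEy] EED] := (congr1 X (rel_Ex H), congr1 X (rel_Ey H), congr1 X (rel_ED H)).
rewrite !(X_M, linear_add _ _ lX) in Exy EDx EDy EEx EEy EED.
split; rewrite /= /wt3 /wt /br /=.
  congr (_, _, _).
  - by apply: (lin1 Exy); abel.
  - by apply: (lin1 EDx); abel.
  - by apply: (lin1 EDy); abel.
congr (_, _, _).
- by apply: (lin1 EEx); abel.
- by apply: (lin1 EEy); abel.
- by apply: (lin1 EED); abel.
Qed.

Section OfHom.
Variable h : cone_obj C 1 -> R.
Hypothesis hP : bimod_hom h.
Hypothesis h0 : forall v, h (res_diff (p := K) v) = 0.
Local Notation d := (@res_diff _ _ _ K 0).
Local Notation u := (free_gen H : free_bimodule H).

(** The universal derivation, with values in the kernel of the multiplication [A (x) A -> A]. *)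
Definition comm_gen (a : A) : free_bimodule H := lact a u - ract u a.

Lemma comm_gen_linear : linear comm_gen.
Proof.
move=> c a b; rewrite /comm_gen (lact_linearl u) (ract_linearr u) scalerBr.
by abel.
Qed.

Lemma comm_genM a b : comm_gen (a * b) = ract (comm_gen a) b + lact a (comm_gen b).
Proof.
rewrite /comm_gen lactM ractM ractD ractN lactD lactN lract; abel.
Qed.

Definition comm_elt (a : A) : cone_obj C 0 := (comm_gen a, 0).

Let inP : bimod_hom (fun f : C 1 => (f, 0) : cone_obj C 0) := prod_hom_inl (C 1) (C 0).

Lemma comm_elt_boundary a : exists v, d v = comm_elt a.
Proof.
apply: (proj1 (@res_exact0 _ _ _ K (comm_elt a))).
have augP := res_aug_hom K; have [_ al ar] := augP.
have [_ il ir] := inP.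
rewrite /comm_elt /comm_gen (homB inP) il ir (homB augP) al ar.
set m := res_aug _; suff -> : m = 1 by rewrite /= mulr1 mul1r subrr.
by rewrite /m /= /ev4 /free_gen ev3_term peval_pterm /= !mulr1.
Qed.

Lemma comm_elt_linear : linear comm_elt.
Proof.
by move=> c a b; have [li _ _] := inP; rewrite /comm_elt comm_gen_linear li.
Qed.

Lemma comm_eltM a b : comm_elt (a * b) = ract (comm_elt a) b + lact a (comm_elt b).
Proof.
have [_ il ir] := inP; rewrite /comm_elt comm_genM (homD inP) ir il.
by [].
Qed.

Lemma hom_boundary_eq v w : d v = d w -> h v = h w.
Proof.
move=> E0; have dvw : d (v - w) = 0.
  by rewrite (homB (res_diff_hom K 0)) E0 subrr.
have [t tE] := proj1 (@res_exactS _ _ _ K 0 (v - w)) dvw.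
by apply/eqP; rewrite -subr_eq0 -(homB hP) -tE h0.
Qed.

(** By exactness a 1-cocycle vanishes on the kernel of the first differential, hence descends to the
    kernel of the augmentation; composing with the universal derivation gives [X]. [fE] expresses
    independence of the chosen preimages. *)
Lemma derivation_of_hom :
  exists2 X : A -> A, derivation X & forall a v, d v = comm_elt a -> X a = h v.
Proof.
have [f fP] := choice comm_elt_boundary.
have dP := res_diff_hom K 0; have [ld dl dr] := dP; have [lh hl hr] := hP.
have fE a v : d v = comm_elt a -> h (f a) = h v.
  by move=> vE; apply: hom_boundary_eq; rewrite fP vE.
exists (fun a => h (f a)); last exact: fE.
split=> [c a b|a b].
  by rewrite -lh; apply: fE; rewrite ld !fP comm_elt_linear.
rewrite -[RHS]/(ract (h (f a) : R) b + lact a (h (f b) : R)) -hr -hl -(homD hP).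
by apply: fE; rewrite (homD dP) dr dl !fP comm_eltM.
Qed.

Let dcol (v : cone_obj C 1) : d v =
  (@inner_map _ _ H x v.1.1.1 + inner_map y v.1.1.2 + inner_map D v.1.2 +
    weight_map 0 v.2, 0).
Proof. by congr pair; rewrite /= oppr0. Qed.

Lemma derivation_of_hom_vals : exists2 X : A -> A, derivation X &
  der_vals X = total_vals h.
Proof.
have [X XP XE] := derivation_of_hom; exists X => //.
have [i0 [_ [_ w0]]] := maps0 H.
have inE z : @inner_map _ _ H z u = lact z u - ract u z by exact: free_map_gen.
have wE : @weight_map _ _ H 0 u = lact E u - ract u E.
  by rewrite /weight_map free_map_gen mulr0n subr0.
by rewrite /der_vals /total_vals /=; congr (_, _, _, _); apply: XE; rewrite dcol /=
  !i0 ?w0 ?inE ?wE ?(addr0, add0r).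
Qed.

End OfHom.

(** [der_vals] identifies derivations modulo inner ones with the first cohomology of the total
    complex, of dimension [dim0 2 + dim0 1 = 2 + 1]. *)
Lemma HH1_dim_pbw : HH1_Lie_dim A 3.
Proof.
apply: quotient_dim_pull (total_dim H char0 1).
- exact: der_vals_linear.
- exact: derivation_subspace.
- exact: total_coboundary_subspace.
- exact: der_vals_cocycle.
- move=> v vP; have [h hP hE] := total_vals_surj H v.
  have [|_ h0] := proj1 (total_cocycleP hP); first by rewrite hE.
  have [X XP XE] := derivation_of_hom_vals hP h0; exists X => //.
  rewrite XE hE subrr; exact: (proj1 (total_coboundary_subspace H 1)).
(* The sign compares [br x g = x g - g x] with the convention [a b - b a] of inner derivations. *)
- move=> X [a XE]; exists (- a), 0; rewrite /der_vals /= !XE /wt3 /wt /br.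
  by split; first congr (_, _, _); rewrite ?mulrN ?mulNr /=; abel.
- move=> X XP [g [? [vE wE]]]; exists (- g) => b.
  case: vE => Ex Ey ED; rewrite /= in wE.
  have := derivation_ext XP (derivation_inner (- g)); apply;
    rewrite ?Ex ?Ey ?ED ?wE /br /wt ?mulrN ?mulNr; abel.
Qed.

Lemma derivation_normal X : derivation X -> exists s t c g,
  [/\ X x = g * x - x * g, X y = g * y - y * g,
      X D = g * D - D * g + (s *: x + t *: y) & X E = g * E - E * g + c%:A].
Proof.
move=> /der_vals_cocycle/(total_cocycle_split char0)[w0 [w' [vP wP wE]]].
have [p [s [t pE]]] := H1_rep char0 vP.
have [c cE] := H0_const char0 wP.
have p0 : wt H 0 (form0 H p) = 0 by apply/(f0P H char0); exists p.
(* [w'] reduces the cocycle to weight zero and [form0 p] puts it into normal form. *)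
exists s, t, c, (- (w' + form0 H p)).
have f1E : form1 H s%:P t%:P 0 = s *: x + t *: y.
  rewrite /form1 mf0 /mf !polEC !expr0 !expr1 !(mulr1, mul1r) addr0.
  by rewrite -!scalerAr !mulr1.
have f0E : form0 H c%:P = c%:A by rewrite /form0 /mf polEC !expr0 !mul1r.
rewrite !f1_0 f1E in pE; rewrite f0E in cE.
move: (form0 H p) p0 pE => f p0 pE.
have E3 : (X x, X y, X D) = (br x f + 0 + br x w', br y f + 0 + br y w',
    br D f + (s *: x + t *: y) + br D w') :> (A * A * A)%type.
  pose e := codiff H (w' : W 1) : W 2.
  exact: etrans (esym (subrK e _)) (congr1 (fun v : W 2 => v + e) pE).
case: E3; rewrite /br => Xx Xy XD; split.
- by rewrite Xx mulNr mulrN mulrDl mulrDr; abel.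
- by rewrite Xy mulNr mulrN mulrDl mulrDr; abel.
- by rewrite XD mulNr mulrN mulrDl mulrDr; abel.
- apply: etrans wE _; move: p0; rewrite cE /= /wt !mulr0n !subr0 => p0.
  set cA := c%:A; rewrite -[LHS]/(cA + (E * w' - w' * E)).
  by apply: (lin1 (esym p0)); rewrite mulNr mulrN mulrDl mulrDr; abel.
Qed.

Lemma HH1_abelian_pbw : HH1_Lie_abelian A.
Proof.
have normal X : derivation X -> exists g X0, [/\ derivation X0,
    forall a, X a = X0 a + (g * a - a * g), X0 x = 0, X0 y = 0 &
    exists s t c, X0 D = s *: x + t *: y /\ X0 E = c%:A].
  move=> XP; have [s [t [c [g [Xx Xy XD XE]]]]] := derivation_normal XP.
  exists g, (fun a => X a + ((- g) * a - a * (- g))); split.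
  - exact: derivation_add XP (derivation_inner _).
  - by move=> a; rewrite mulNr mulrN; abel.
  - by rewrite Xx mulNr mulrN; abel.
  - by rewrite Xy mulNr mulrN; abel.
  - by exists s, t, c; split; rewrite ?XD ?XE mulNr mulrN; abel.
move=> X Y XP YP.
have [g [X0 [X0P XE Xx Xy [s [t [c [XD XEE]]]]]]] := normal X XP.
have [g' [Y0 [Y0P YE Yx Yy [s' [t' [c' [YD YEE]]]]]]] := normal Y YP.
have [lX X_M] := X0P; have [lY Y_M] := Y0P.
have X0Z := linear_at0 lX; have Y0Z := linear_at0 lY.
have lX2 a z : X0 (a *: z) = a *: X0 z by rewrite -[a *: z]addr0 lX X0Z addr0.
have lY2 a z : Y0 (a *: z) = a *: Y0 z by rewrite -[a *: z]addr0 lY Y0Z addr0.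
have XY0 a : X0 (Y0 a) = Y0 (X0 a).
  apply/eqP; rewrite -subr_eq0; apply/eqP; move: a.
  have := derivation_ext (derivation_bracket X0P Y0P) (proj1 derivation_subspace).
  rewrite /Lie_bracket /=; apply; rewrite -[RHS]/(0 : A).
  - by rewrite Xx Yx X0Z Y0Z subrr.
  - by rewrite Xy Yy X0Z Y0Z subrr.
  - rewrite XD YD lX lY lX2 lY2 Xx Xy Yx Yy !scaler0 addr0; exact: subrr.
  - by rewrite XEE YEE lX2 lY2 !derivation1 // !scaler0 subrr.
(* With [X = X0 + [g, -]] and [Y = Y0 + [g', -]], the bracket [[X0, Y0]] vanishes and the three
   other brackets are inner, given by these three terms. *)
exists (X0 g' - Y0 g + (g * g' - g' * g)) => b; rewrite /Lie_bracket !XE !YE.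
have lXN a : X0 (- a) = - X0 a by rewrite -scaleN1r lX2 scaleN1r.
have lYN a : Y0 (- a) = - Y0 a by rewrite -scaleN1r lY2 scaleN1r.
rewrite !(linear_add _ _ lX) !(linear_add _ _ lY) !(lXN, lYN) !X_M !Y_M XY0.
by rewrite !(mulrDl, mulrDr, mulrN, mulNr) !mulrA; abel.
Qed.
End Derivations.

(** * Operators tangent to the arrangement *)

Section IteratedDerivation.
Variables (k : fieldType) (M : algType k) (d : M -> M).
Hypothesis dP : derivation d.

Lemma der_linear : linear d. Proof. by case: dP. Qed.
Lemma derM a b : d (a * b) = d a * b + a * d b.
Proof. by case: dP. Qed.
Lemma derD a b : d (a + b) = d a + d b.
Proof. exact: linear_add der_linear. Qed.
Lemma der0 : d 0 = 0.
Proof. exact: linear_at0 der_linear. Qed.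
Lemma derMn a n : d (a *+ n) = d a *+ n.
Proof. by elim: n => [|n IHn]; rewrite ?der0 // !mulrS derD IHn. Qed.

Lemma der_iterD n a b : iter n d (a + b) = iter n d a + iter n d b.
Proof. by elim: n => //= n ->; rewrite derD. Qed.
Lemma der_iter0 n : iter n d 0 = 0.
Proof. by elim: n => //= n ->; rewrite der0. Qed.
Lemma der_iter_linear n : linear (iter n d).
Proof. by elim: n => //= n IHn c u v /=; rewrite IHn der_linear. Qed.
Lemma der_iter_sum n (I : Type) (r : seq I) (F : I -> M) :
  iter n d (\sum_(i <- r) F i) = \sum_(i <- r) iter n d (F i).
Proof. by apply: (big_morph (iter n d)); [exact: der_iterD | exact: der_iter0]. Qed.

Lemma der_iter_const n c a : d c = 0 -> iter n d (c * a) = c * iter n d a.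
Proof. by move=> dc; elim: n => //= n ->; rewrite derM dc mul0r add0r. Qed.

Section Power.
Variable e : M.
Hypothesis dde : d (d e) = 0.

(** The Leibniz formula stops after two terms because [d (d e) = 0]. *)
Lemma der_iter_mul n a :
  iter n d (e * a) = e * iter n d a + (d e * iter n.-1 d a) *+ n.
Proof.
elim: n => [|n IHn] /=; first by rewrite mulr0n addr0.
rewrite IHn derD derM derMn derM dde mul0r add0r addrAC addrC; congr (_ + _).
by case: n {IHn} => [|n] /=; rewrite ?mulr0n ?addr0 // [RHS]mulrS.
Qed.

Lemma der_iter_pow_gt m n : (n < m)%N -> iter m d (e ^+ n) = 0.
Proof.
elim: n m => [|n IHn] [|m] // ltnm.
  by rewrite expr0 iterSr (derivation1 dP) der_iter0.
rewrite exprS der_iter_mul (IHn m.+1 (ltnW ltnm)) (IHn m ltnm).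
by rewrite !mulr0 mul0rn addr0.
Qed.

Lemma der_iter_pow n : iter n d (e ^+ n) = d e ^+ n *+ n`!.
Proof.
elim: n => [|n IHn]; first by rewrite !expr0.
rewrite exprS der_iter_mul der_iter_pow_gt // mulr0 add0r /= IHn.
by rewrite mulrnAr -mulrnA mulnC factS exprS.
Qed.
End Power.

Section PolyEval.
Hypothesis char0 : [pchar k] =i pred0.
Variables (R : nzRingType) (phi : R -> M) (e : M).
Hypothesis phiD : {morph phi : r s / r + s}.
Hypothesis phi_inj : forall r, phi r = 0 -> r = 0.
Hypothesis dphi : forall r, d (phi r) = 0.
Hypothesis dde : d (d e) = 0.
Hypothesis phi_reg : forall r n, phi r * d e ^+ n = 0 -> phi r = 0.

Definition poly_eval (f : polyR R) : M := poly_sum (fun n r => phi r * e ^+ n) f.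

Lemma poly_evalD : {morph poly_eval : f g / f + g}.
Proof. by apply: poly_sumD => n r s; rewrite phiD mulrDl. Qed.

Lemma poly_eval_term r n : poly_eval (pterm r n) = phi r * e ^+ n.
Proof.
by apply: (poly_sum_term (G := fun n r => phi r * e ^+ n)) => m a b; rewrite phiD mulrDl.
Qed.

Lemma natr_scale_eq0 (a : M) n : a *+ n.+1 = 0 -> a = 0.
Proof.
rewrite -scaler_nat => /eqP; rewrite scaler_eq0 (negPf (natr_neq0 char0 n)).
exact: eqP.
Qed.

(** For [n] the degree, [d^n] kills every term but the leading one and turns [e^n] into
    [n! (d e)^n], which can be cancelled. The lemma serves once for each of the generators [x], [y],
    [D], [E]. *)
Lemma poly_eval_inj f : poly_eval f = 0 -> f = 0.
Proof.
move=> f0; apply/eqP/negPn/negP => nz.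
have sz : (0 < size (f : {poly R}))%N by rewrite size_poly_gt0.
pose n := (size (f : {poly R})).-1; have szE : size (f : {poly R}) = n.+1.
  by rewrite /n prednK.
have : iter n d (poly_eval f) = 0 by rewrite f0 der_iter0.
rewrite /poly_eval /poly_sum szE der_iter_sum big_ord_recr /= big1 => [|i _].
  rewrite add0r (der_iter_const _ _ (dphi _)) (der_iter_pow dde) mulrnAr.
  case: (n`!) (fact_gt0 n) => // m _ /natr_scale_eq0/phi_reg/phi_inj /eqP.
  by rewrite /n -/(lead_coef _) lead_coef_eq0 (negPf nz).
by rewrite (der_iter_const _ _ (dphi _)) (der_iter_pow_gt dde (ltn_ord i)) mulr0.
Qed.

End PolyEval.
End IteratedDerivation.

Section Divisibility.
Variable S : comNzRingType.
Implicit Types a b g h : S.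

Definition divides a h := exists g, h = a * g.
Definition regular a := forall h, a * h = 0 -> h = 0.
(** [b] is a nonzerodivisor modulo [a]. The definition is not symmetric, hence the two orders in
    [coordinates]. *)
Definition coprime_to a b := forall h, divides a (b * h) -> divides a h.

Lemma divides_sub a g h : divides a g -> divides a h -> divides a (g - h).
Proof. by move=> [u ->] [v ->]; exists (u - v); rewrite mulrBr. Qed.
Lemma divides_mull a b h : divides a h -> divides (b * a) (b * h).
Proof. by move=> [u ->]; exists u; rewrite mulrA. Qed.
Lemma divides_mulr a b h : divides (a * b) h -> divides a h.
Proof. by move=> [u ->]; exists (b * u); rewrite mulrA. Qed.

Lemma regular_inj a g h : regular a -> a * g = a * h -> g = h.
Proof.
by move=> ra E; apply/eqP; rewrite -subr_eq0; apply/eqP/ra; rewrite mulrBr E subrr.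
Qed.
Lemma regularM a b : regular a -> regular b -> regular (a * b).
Proof. by move=> ra rb h; rewrite -mulrA => /ra/rb. Qed.
Lemma regularX a n : regular a -> regular (a ^+ n).
Proof.
move=> ra; elim: n => [|n IHn]; first by move=> h; rewrite expr0 mul1r.
by rewrite exprS; exact: regularM.
Qed.

Lemma coprime_toMl a a' b : regular a -> coprime_to a b -> coprime_to a' b ->
  coprime_to (a * a') b.
Proof.
move=> ra ab a'b h ah; have [g hE] := ab h (divides_mulr ah).
case: ah => u; rewrite hE mulrCA -mulrA => /(regular_inj ra) uE.
have [v ->] : divides a' g by apply: a'b; exists u.
by exists v; rewrite mulrA.
Qed.
Lemma coprime_toMr a b b' : coprime_to a b -> coprime_to a b' -> coprime_to a (b * b').
Proof. by move=> ab ab' h; rewrite -mulrA => /ab/ab'. Qed.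
Lemma coprime_to1 a : coprime_to a 1.
Proof. by move=> h; rewrite mul1r. Qed.
Lemma coprime_1to a : coprime_to 1 a.
Proof. by move=> h _; exists h; rewrite mul1r. Qed.
Lemma coprime_toXr a b n : coprime_to a b -> coprime_to a (b ^+ n).
Proof.
move=> ab; elim: n => [|n IHn]; first by rewrite expr0; exact: coprime_to1.
by rewrite exprS; exact: coprime_toMr.
Qed.
Lemma coprime_toXl a b n : regular a -> coprime_to a b -> coprime_to (a ^+ n) b.
Proof.
move=> ra ab; elim: n => [|n IHn]; first by rewrite expr0; exact: coprime_1to.
by rewrite exprS; exact: coprime_toMl.
Qed.
Lemma coprime_divides a b h : regular b -> coprime_to a b ->
  divides a h -> divides b h -> divides (a * b) h.
Proof.
move=> rb ab ah [g hE]; rewrite hE mulrC; apply: divides_mull; apply: ab.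
by rewrite -hE.
Qed.

Lemma diffop_lt_regular n a (P : S -> S) : regular a ->
  diffop_lt n (fun g => a * P g) -> diffop_lt n P.
Proof.
move=> ra; elim: n P => [|n IHn] P /= aP; first by move=> g; exact/ra/aP.
move=> f; apply: IHn; have := aP f; congr diffop_lt; apply: funext => g.
by rewrite mulrBr [f * (a * _)]mulrCA.
Qed.

End Divisibility.

Section TangentOperators.
Variables (k : fieldType) (S : comAlgType k) (Q : S).
Local Notation A := (Diff Q).
Implicit Types (P : S -> S) (a b : A) (f g h l : S).

Lemma commutator_linear P f : linear P -> linear (fun g => P (f * g) - f * P g).
Proof. exact: linear_commutator_subproof. Qed.

Lemma commutator_preserves P f : linear P -> preserves_powers Q P ->
  preserves_powers Q (fun g => P (f * g) - f * P g).
Proof.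
move=> lP PQ m g; have [u uE] := PQ m (f * g); have [v vE] := PQ m g.
by exists (u - f * v); rewrite mulrCA uE vE mulrBr [f * _]mulrCA.
Qed.

(** Induction on the order: [P (Q^m g)] is [F^m P (l^m g)] plus the value at [l^m g] of the
    commutator of [P] with [F^m], which has smaller order. So [l^m] divides [F^m P (l^m g)], and
    [F^m] is removed by coprimality. *)
Lemma tangent_to_factor l F n P : Q = l * F -> regular l -> coprime_to l F ->
  linear P -> diffop_lt n P -> preserves_powers Q P ->
  forall m g, divides (l ^+ m) (P (l ^+ m * g)).
Proof.
move=> QE rl lF; elim: n P => [|n IHn] P lP nP PQ m g.
  by rewrite nP; exists 0; rewrite mulr0.
have cop : coprime_to (l ^+ m) (F ^+ m) by apply/coprime_toXl/coprime_toXr.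
apply: cop; have [u uE] := PQ m g.
have E0 : Q ^+ m * g = F ^+ m * (l ^+ m * g) by rewrite QE exprMn mulrCA mulrA.
have [v vE] := IHn _ (commutator_linear (F ^+ m) lP) (nP _)
  (commutator_preserves (F ^+ m) lP PQ) m g.
exists (F ^+ m * u - v); rewrite mulrBr -vE -E0 uE QE exprMn opprB.
by rewrite -mulrA addrCA subrr addr0.
Qed.

Lemma mul_op_subproof f : `[< is_tangent_diffop Q (fun g => f * g) >].
Proof.
apply/asboolP; split.
- by move=> c g h; rewrite mulrDr -scalerAr.
- by exists 1%N => h g; rewrite mulrCA subrr.
- by move=> m g; exists (f * g); rewrite mulrCA.
Qed.
Definition mul_op f : A := MkDiff (mul_op_subproof f).

Lemma mul_opD : {morph mul_op : f g / f + g}.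
Proof. by move=> f g; apply: val_inj; apply: funext => h; exact: mulrDl. Qed.
Lemma mul_opM : {morph mul_op : f g / f * g}.
Proof. by move=> f g; apply: val_inj; apply: funext => h; rewrite /= mulrA. Qed.
Lemma mul_opZ c f : mul_op (c *: f) = c *: mul_op f.
Proof. by apply: val_inj; apply: funext => h; rewrite /= -scalerAl. Qed.
Lemma mul_op1 : mul_op 1 = 1.
Proof. by apply: val_inj; apply: funext => h; rewrite /= mul1r. Qed.
Lemma mul_opX f n : mul_op (f ^+ n) = mul_op f ^+ n.
Proof. by elim: n => [|n IHn]; rewrite ?expr0 ?mul_op1 // !exprS mul_opM IHn. Qed.

(** The sign is that of the commutators in [diffop_lt], opposite to the usual one. *)
Definition ad (A' : algType k) (z a : A') : A' := a * z - z * a.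

Lemma derivation_ad (A' : algType k) (z : A') : derivation (ad z).
Proof.
split=> [c u v|u v]; rewrite /ad.
  by rewrite mulrDl mulrDr -scalerAl -scalerAr scalerBr; abel.
by rewrite mulrBl mulrBr !mulrA; abel.
Qed.

Lemma ad_mul_opE f a g : (ad (mul_op f) a : A) g = a (f * g) - f * a g.
Proof. by []. Qed.

Lemma ad_nilp a f : exists n, iter n (ad (mul_op f)) a = 0.
Proof.
have /asboolP[_ [n nP] _] := DiffP a; exists n; elim: n a nP => [|n IHn] a nP.
  by apply: val_inj; apply: funext => g; exact: nP.
by rewrite iterSr; apply: IHn; exact: nP f.
Qed.

(** A commutator with [l] has one term with an additional [l] inside the argument and one with [l]
    outside, so it gains a power of [l]. The exponent [j] is there for the induction. *)
Lemma iter_ad_divides l F a N j g : Q = l * F -> regular l -> coprime_to l F ->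
  divides (l ^+ (N + j)) (iter N (ad (mul_op l)) a (l ^+ j * g)).
Proof.
move=> QE rl lF; elim: N j g => [|N IHN] j g.
  have /asboolP[lP [n nP] PQ] := DiffP a.
  by rewrite add0n; exact: (tangent_to_factor QE rl lF lP nP PQ).
rewrite iterS ad_mul_opE; apply: divides_sub.
  by rewrite mulrA -exprS addSnnS; exact: IHN.
by rewrite addSn exprS; apply: divides_mull; exact: IHN.
Qed.

(** The pointwise quotient is again tangent: [b] commutes with [l], so only the powers of [F] in
    [Q^m] matter, and [l^N] can be cancelled modulo those. *)
Lemma divide_operator l F N a : Q = l * F -> regular l -> coprime_to F l -> regular F ->
  ad (mul_op l) a = 0 -> (forall g, divides (l ^+ N) (a g)) ->
  exists b, a = mul_op (l ^+ N) * b /\ ad (mul_op l) b = 0.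
Proof.
move=> QE rl Fl rF al /choice[b bE].
have rlN := regularX (n := N) rl.
have /asboolP[lP [n nP] PQ] := DiffP a.
have aX m g : a (l ^+ m * g) = l ^+ m * a g.
  elim: m g => [|m IHm] g; first by rewrite expr0 !mul1r.
  rewrite exprSr -!mulrA IHm; congr (_ * _).
  by have := congr1 (fun P : A => P g) al; rewrite ad_mul_opE => /eqP;
    rewrite subr_eq0 => /eqP.
have bX m g : b (l ^+ m * g) = l ^+ m * b g.
  by apply: (regular_inj rlN); rewrite -bE aX bE mulrCA.
have bT : `[< is_tangent_diffop Q b >].
  apply/asboolP; split.
  - move=> c u v; apply: (regular_inj rlN).
    by rewrite -bE lP !bE mulrDr -scalerAr.
  - exists n; apply: (diffop_lt_regular rlN); apply: diffop_lt_ext nP => g.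
    exact: bE.
  - move=> m g; have [u uE] := PQ m g.
    have QmE : Q ^+ m = l ^+ m * F ^+ m by rewrite QE exprMn.
    move: uE; rewrite QmE -!mulrA aX => /(regular_inj (regularX (n := m) rl)) uE.
    have [v vE] : divides (F ^+ m) (b (F ^+ m * g)).
      have cop : coprime_to (F ^+ m) (l ^+ N) by apply/coprime_toXl/coprime_toXr.
      by apply: cop; exists u; rewrite -bE.
    by exists v; rewrite bX vE mulrA.
exists (MkDiff bT); split; apply: val_inj; apply: funext => g /=.
  exact: bE.
by rewrite -[LHS]/(b (l * g) - l * b g) -[l in b (l * g)]expr1 bX expr1 subrr.
Qed.

Lemma derivation_diff P : derivation P -> divides Q (P Q) ->
  `[< is_tangent_diffop Q P >].
Proof.
move=> PP [q qE]; apply/asboolP; split; first by case: PP.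
  exists 2%N => f f' g; rewrite !(derM PP) ; ring.
move=> m g; rewrite (derM PP).
have [u ->] : divides (Q ^+ m) (P (Q ^+ m)).
  elim: m => [|m [u uE]]; first by rewrite expr0 (derivation1 PP); exists 0; rewrite mulr0.
  by rewrite exprS (derM PP) uE qE; exists (q + u); ring.
by exists (u * g + P g); ring.
Qed.

End TangentOperators.

Section PolyEvalMore.
Variables (k : fieldType) (M : algType k) (R : nzRingType) (phi : R -> M) (e : M).
Hypothesis phiD : {morph phi : r s / r + s}.

Lemma derivation_pow0 (d : M -> M) n : derivation d -> d e = 0 -> d (e ^+ n) = 0.
Proof.
move=> dP de; elim: n => [|n IHn]; first by rewrite (derivation1 dP).
by rewrite exprS (derM dP) de IHn mul0r mulr0 addr0.
Qed.

Lemma poly_eval_ker (d : M -> M) : derivation d -> (forall r, d (phi r) = 0) ->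
  d e = 0 -> forall f, d (poly_eval phi e f) = 0.
Proof.
move=> dP dphi de; elim/pterm_ind => [f g df dg||r n].
- by rewrite poly_evalD // (derD dP) df dg addr0.
- by rewrite /poly_eval /poly_sum size_poly0 big_ord0 (der0 dP).
- by rewrite poly_eval_term // (derM dP) dphi (derivation_pow0 _ dP de) mul0r mulr0 addr0.
Qed.

End PolyEvalMore.

(** What the study of operators uses of polynomial functions. The monomials in [x] and [y] are only
    asked to span; their independence will follow from [dx] and [dy]. *)
Record coordinates (k : fieldType) (S : comAlgType k) (x y : S) := Coordinates {
  dx : S -> S; dy : S -> S;
  dxP : derivation dx; dyP : derivation dy;
  dx_x : dx x = 1; dx_y : dx y = 0; dy_x : dy x = 0; dy_y : dy y = 1;
  coords_span : forall P : S -> Prop, (forall c i j, P (c *: (x ^+ i * y ^+ j))) ->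
    (forall f g, P f -> P g -> P (f + g)) -> forall f, P f;
  reg_x : regular x; reg_y : regular y; reg_z : regular (x + y);
  cop_xy : coprime_to x y; cop_xz : coprime_to x (x + y);
  cop_yx : coprime_to y x; cop_yz : coprime_to y (x + y);
  cop_zx : coprime_to (x + y) x; cop_zy : coprime_to (x + y) y }.

(** * The PBW basis of the tangent operators *)

Section Operators.
Variables (k : fieldType) (S : comAlgType k) (x y Q : S) (c0 : k).
Hypothesis char0 : [pchar k] =i pred0.
Hypothesis c0_neq0 : c0 != 0.
Variable X : coordinates x y.
Hypothesis QE : Q = c0 *: (x * (y * (x + y))).
Local Notation A := (Diff Q).
Local Notation op := (@mul_op k S Q).
Local Notation z := (x + y).

Lemma derivation_mull (f : S) P : derivation P -> derivation (fun g => f * P g : S).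
Proof.
move=> [lP PM]; split=> [c g h|g h].
  by rewrite lP mulrDr -scalerAr.
by rewrite PM mulrDr mulrA [g * (f * _)]mulrCA.
Qed.

Lemma derivation_coords_ext P P' : derivation P -> derivation P' ->
  P x = P' x -> P y = P' y -> forall f, P f = P' f.
Proof.
move=> PP PP' Ex Ey; apply: (coords_span X) => [c i j|f g Ef Eg]; last first.
  by rewrite (derD PP) (derD PP') Ef Eg.
have PM g h : P g = P' g -> P h = P' h -> P (g * h) = P' (g * h).
  by move=> Eg Eh; rewrite (derM PP) (derM PP') Eg Eh.
have PX g n : P g = P' g -> P (g ^+ n) = P' (g ^+ n).
  by move=> Eg; elim: n => [|n IHn]; rewrite ?expr0 ?derivation1 // exprS PM.
have [[lP _] [lP' _]] := (PP, PP').
rewrite -[c *: _]addr0 lP lP' (der0 PP) (der0 PP').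
by rewrite PM // PX.
Qed.

Definition euler (f : S) : S := x * dx X f + y * dy X f.
Definition vert (f : S) : S := y * z * dy X f.

Lemma euler_der : derivation euler.
Proof.
by apply: derivation_add; apply: derivation_mull; [exact: dxP | exact: dyP].
Qed.
Lemma vert_der : derivation vert.
Proof. exact: derivation_mull (dyP X). Qed.

Lemma euler_x : euler x = x.
Proof. by rewrite /euler dx_x dy_x mulr1 mulr0 addr0. Qed.
Lemma euler_y : euler y = y.
Proof. by rewrite /euler dx_y dy_y mulr1 mulr0 add0r. Qed.
Lemma vert_x : vert x = 0.
Proof. by rewrite /vert dy_x mulr0. Qed.
Lemma vert_y : vert y = y * z.
Proof. by rewrite /vert dy_y mulr1. Qed.

Lemma derZ (d : S -> S) c f : derivation d -> d (c *: f) = c *: d f.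
Proof. by move=> dP; have [ld _] := dP; rewrite -[c *: f]addr0 ld (der0 dP) addr0. Qed.

Lemma euler_Q : divides Q (euler Q).
Proof.
(* Euler's formula for the cubic form [Q]. *)
have eP := euler_der; exists 3%:R.
rewrite QE (derZ _ _ eP) !(derM eP, derD eP) euler_x euler_y -scalerAl.
by congr (_ *: _); ring.
Qed.
Lemma vert_Q : divides Q (vert Q).
Proof.
have eP := vert_der; exists (x + y *+ 2).
(* [vert] multiplies [y] by [z] and [z] by [y], so it multiplies [Q] by [y + z = x + 2 y]. *)
rewrite QE (derZ _ _ eP) !(derM eP, derD eP) vert_x vert_y -scalerAl.
by congr (_ *: _); ring.
Qed.

Definition op_E : A := MkDiff (derivation_diff euler_der euler_Q).
Definition op_D : A := MkDiff (derivation_diff vert_der vert_Q).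

Lemma op_eq (a b : A) : (forall g, a g = b g) -> a = b.
Proof. by move=> E; apply: val_inj; exact: funext. Qed.

Lemma op_D_op f : op_D * op f = op f * op_D + op (vert f).
Proof.
apply: op_eq => g; rewrite -[LHS]/(vert (f * g)) (derM vert_der).
by rewrite addrC.
Qed.
Lemma op_E_op f : op_E * op f = op f * op_E + op (euler f).
Proof.
apply: op_eq => g; rewrite -[LHS]/(euler (f * g)) (derM euler_der).
by rewrite addrC.
Qed.

(** The bracket of two derivations is a derivation, so it is enough to compare it with [vert] on [x]
    and [y]. *)
Lemma op_ED : op_E * op_D = op_D * op_E + op_D.
Proof.
apply: op_eq; rewrite -[forall g, _]/(forall g, euler (vert g) = vert (euler g) + vert g).
have EDP := derivation_bracket euler_der vert_der.
suff E f : Lie_bracket euler vert f = vert f.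
  by move=> g; rewrite -[X in _ + X]E /Lie_bracket addrC subrK.
move: f; apply: (derivation_coords_ext EDP vert_der); rewrite /Lie_bracket.
  by rewrite vert_x euler_x vert_x (der0 euler_der) subr0.
rewrite vert_y euler_y vert_y (derM euler_der) (derD euler_der) euler_x euler_y; ring.
Qed.

Let ad_op f g : ad (op f) (op g) = 0.
Proof. by rewrite /ad -!mul_opM (mulrC f) subrr. Qed.
Let ad_op_D f : ad (op f) op_D = op (vert f).
Proof. by rewrite /ad op_D_op addrC addKr. Qed.
Let ad_op_E f : ad (op f) op_E = op (euler f).
Proof. by rewrite /ad op_E_op addrC addKr. Qed.

Lemma op0 : op 0 = 0.
Proof. by have := mul_opZ Q 0 (0 : S); rewrite !scale0r. Qed.

Lemma op_inj f : op f = 0 -> f = 0.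
Proof. by move=> /(congr1 (fun a : A => a 1)) /=; rewrite mulr1. Qed.

Local Notation R1 := (polyR k).
Local Notation R2 := (polyR R1).
Local Notation R3 := (polyR R2).
Local Notation R4 := (polyR R3).

(** The maps [eval1] to [eval4] adjoin [x], [y], [D], [E] in turn; their images are [k[x]], [S], the
    centraliser of [x], and [A]. The derivations detecting the successive variables are [dx], [dy]
    and the commutators with [y] and with [x]. *)
Definition eval0 (c : k) : S := c%:A.
Definition eval1 : R1 -> S := poly_eval eval0 x.
Definition eval2 : R2 -> S := poly_eval eval1 y.
Definition eval2_op (f : R2) : A := op (eval2 f).
Definition eval3 : R3 -> A := poly_eval eval2_op op_D.
Definition eval4 : R4 -> A := poly_eval eval3 op_E.

Lemma eval0D : {morph eval0 : r s / r + s}.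
Proof. by move=> r s; exact: scalerDl. Qed.
Lemma eval1D : {morph eval1 : r s / r + s}.
Proof. exact: poly_evalD eval0D. Qed.
Lemma eval2D : {morph eval2 : r s / r + s}.
Proof. exact: poly_evalD eval1D. Qed.
Lemma eval2_opD : {morph eval2_op : r s / r + s}.
Proof. by move=> r s; rewrite /eval2_op eval2D mul_opD. Qed.
Lemma eval3D : {morph eval3 : r s / r + s}.
Proof. exact: poly_evalD eval2_opD. Qed.
Lemma eval4D : {morph eval4 : r s / r + s}.
Proof. exact: poly_evalD eval3D. Qed.

Lemma der_eval0 (d : S -> S) c : derivation d -> d (eval0 c) = 0.
Proof. by move=> dP; rewrite (derZ _ _ dP) (derivation1 dP) scaler0. Qed.

Lemma eval1_inj f : eval1 f = 0 -> f = 0.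
Proof.
apply: (poly_eval_inj (dxP X) char0).
- by move=> c /eqP; rewrite scaler_eq0 oner_eq0 orbF => /eqP.
- by move=> c; exact: der_eval0 (dxP X).
- by rewrite dx_x (derivation1 (dxP X)).
- by move=> c n; rewrite dx_x expr1n mulr1.
Qed.

Lemma eval2_inj f : eval2 f = 0 -> f = 0.
Proof.
apply: (poly_eval_inj (dyP X) char0 eval1_inj).
- apply: (poly_eval_ker eval0D (dyP X)); last exact: dy_x.
  by move=> c; exact: der_eval0 (dyP X).
- by rewrite dy_y (derivation1 (dyP X)).
- by move=> c n; rewrite dy_y expr1n mulr1.
Qed.

Lemma reg_F : regular (y * z).
Proof. exact: regularM (reg_y X) (reg_z X). Qed.

Lemma eval3_inj f : eval3 f = 0 -> f = 0.
Proof.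
apply: (poly_eval_inj (derivation_ad (op y)) char0).
- by move=> r /op_inj/eval2_inj.
- by move=> r; exact: ad_op.
- by rewrite ad_op_D ad_op.
- move=> r n; rewrite ad_op_D vert_y -mul_opX -mul_opM /eval2_op.
  by move=> /op_inj; rewrite mulrC => /(regularX reg_F) ->; exact: op0.
Qed.

Lemma ad_x_eval3 f : ad (op x) (eval3 f) = 0.
Proof.
apply: (poly_eval_ker eval2_opD (derivation_ad _)).
  by move=> r; exact: ad_op.
by rewrite ad_op_D vert_x op0.
Qed.

Lemma ad_eq0X (a : A) f n : ad (op f) a = 0 -> a * op f ^+ n = op f ^+ n * a.
Proof.
move=> /eqP; rewrite subr_eq0 => /eqP E; elim: n => [|n IHn].
  by rewrite expr0 mulr1 mul1r.
by rewrite exprSr mulrA IHn -mulrA E mulrA.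
Qed.

Lemma op_mul_eq0 f (a : A) : regular f -> op f * a = 0 -> a = 0.
Proof.
move=> rf /(congr1 (fun b : A => (b : S -> S))) E; apply: op_eq => g.
by apply: rf; exact: (congr1 (fun b => b g) E).
Qed.

Lemma eval4_inj f : eval4 f = 0 -> f = 0.
Proof.
apply: (poly_eval_inj (derivation_ad (op x)) char0 eval3_inj).
- exact: ad_x_eval3.
- by rewrite ad_op_E euler_x ad_op.
- move=> r n; rewrite ad_op_E euler_x (ad_eq0X _ (ad_x_eval3 r)) -mul_opX.
  exact: op_mul_eq0 (regularX (reg_x X)).
Qed.

Lemma Q_x : Q = x * (c0 *: (y * z)).
Proof. by rewrite QE -scalerAr. Qed.
Lemma Q_y : Q = y * (c0 *: (x * z)).
Proof. by rewrite QE -scalerAr mulrCA. Qed.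
Lemma Q_z : Q = z * (c0 *: (x * y)).
Proof. by rewrite QE -scalerAr mulrA mulrC. Qed.

Lemma coprime_toZr (a b : S) : coprime_to a b -> coprime_to a (c0 *: b).
Proof.
move=> ab h [g E]; apply: ab; exists (c0^-1 *: g); apply: (scalerI c0_neq0).
by rewrite -scalerAr scalerA mulfV // scale1r -E scalerAl.
Qed.

Lemma coprime_toZl (a b : S) : coprime_to a b -> coprime_to (c0 *: a) b.
Proof.
move=> ab h [g E]; have [|u ->] := ab h; first by exists (c0 *: g); rewrite E -scalerAl scalerAr.
by exists (c0^-1 *: u); rewrite -scalerAl -scalerAr scalerA mulfV // scale1r.
Qed.

Lemma regularZ (a : S) : regular a -> regular (c0 *: a).
Proof.
move=> ra h /eqP; rewrite -scalerAl scaler_eq0 (negPf c0_neq0) => /eqP; exact: ra.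
Qed.

Lemma Diff_linearE (a : A) : [/\ {morph a : f g / f + g},
  (forall c f, a (c *: f) = c *: a f) & a 0 = 0].
Proof.
have la := Diff_linear a; split.
- by move=> f g; exact: linear_add la.
- by move=> c f; rewrite -[c *: f]addr0 la (linear_at0 la) addr0.
- exact: linear_at0 la.
Qed.

Lemma ad_opC f g (a : A) : ad (op f) (ad (op g) a) = ad (op g) (ad (op f) a).
Proof.
apply: op_eq => h; rewrite !ad_mul_opE; have [aD _ _] := Diff_linearE a.
by rewrite !mulrBr [f * (g * h)]mulrCA [f * (g * a _)]mulrCA; abel.
Qed.

Lemma ad_opD f g (a : A) : ad (op (f + g)) a = ad (op f) a + ad (op g) a.
Proof. by rewrite /ad mul_opD mulrDr mulrDl; abel. Qed.

Lemma iter_ad_x n (a : A) : ad (op x) a = 0 ->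
  ad (op x) (iter n (ad (op y)) a) = 0.
Proof.
move=> ax; elim: n => //= n IHn; rewrite ad_opC IHn; exact: (der0 (derivation_ad _)).
Qed.

(** For an operator commuting with [x], the same iterated commutator is thus divisible by powers of
    [y] and of [z]. *)
Lemma iter_ad_z n (a : A) : ad (op x) a = 0 ->
  iter n (ad (op z)) a = iter n (ad (op y)) a.
Proof.
by move=> ax; elim: n => //= n ->; rewrite ad_opD (iter_ad_x n ax) add0r.
Qed.

Lemma centralizer_xy (a : A) : ad (op x) a = 0 -> ad (op y) a = 0 -> a = op (a 1).
Proof.
have [aD aZ _] := Diff_linearE a.
have comm l n g : ad (op l) a = 0 -> a (l ^+ n * g) = l ^+ n * a g.
  move=> /(ad_eq0X n); rewrite -mul_opX => E.
  exact: (congr1 (fun b : A => b g) E).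
move=> ax ay; apply: op_eq; apply: (coords_span X) => [c i j|f g Ef Eg].
  have E1 : a (x ^+ i * y ^+ j) = x ^+ i * y ^+ j * a 1.
    by rewrite -{1}[y ^+ j]mulr1 !comm // mulrA.
  by rewrite aZ E1 -[RHS]/(a 1 * (c *: (x ^+ i * y ^+ j))) -scalerAr mulrC.
by rewrite aD Ef Eg -[RHS]/(_ * _) mulrDr.
Qed.

Lemma eval2_surj s : exists f, eval2 f = s.
Proof.
move: s; apply: (coords_span X) => [c i j|_ _ [f <-] [g <-]]; last first.
  by exists (f + g); exact: eval2D.
exists (pterm (pterm c i) j); rewrite /eval2 (poly_eval_term _ eval1D).
by rewrite /eval1 (poly_eval_term _ eval0D) -!scalerAl mul1r.
Qed.

Lemma fact_neq0 n : (n`!%:R : k) != 0.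
Proof. by case: (n`!) (fact_gt0 n) => // m _; exact: natr_neq0. Qed.

Lemma eval3_surj (a : A) : ad (op x) a = 0 -> exists f, eval3 f = a.
Proof.
have [n aN] := ad_nilp a y; elim: n a aN => [|n IHn] a aN ax.
  exists 0; rewrite [RHS]aN.
  by rewrite /eval3 /poly_eval /poly_sum size_poly0 big_ord0.
pose R := iter n (ad (op y)) a.
have Rx : ad (op x) R = 0 by exact: iter_ad_x.
have RE := centralizer_xy Rx aN.
have cyz : coprime_to (y ^+ n) (z ^+ n).
  exact: (coprime_toXl (reg_y X) (coprime_toXr (cop_yz X))).
have [s sE] : divides ((y * z) ^+ n) (R 1).
  rewrite exprMn; apply: (coprime_divides (regularX (reg_z X)) cyz).
  - have cyQ : coprime_to y (c0 *: (x * z)).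
      by apply: coprime_toZr; exact: coprime_toMr (cop_yx X) (cop_yz X).
    have := iter_ad_divides a n 0 1 Q_y (reg_y X) cyQ.
    by rewrite addn0 expr0 mulr1.
  - have czQ : coprime_to z (c0 *: (x * y)).
      by apply: coprime_toZr; exact: coprime_toMr (cop_zx X) (cop_zy X).
    have := iter_ad_divides a n 0 1 Q_z (reg_z X) czQ.
    by rewrite addn0 expr0 mulr1 iter_ad_z.
have [f fE] := eval2_surj ((n`!%:R)^-1 *: s).
(* [b] is [s / n!] times [D^n]; its [n]-th commutator with [y] is [s (y z)^n], the same as that of
   [a]. *)
pose b := eval3 (pterm f n).
have bn : iter n (ad (op y)) b = R.
  have dP := derivation_ad (op y).
  rewrite /b /eval3 (poly_eval_term _ eval2_opD) /eval2_op fE.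
  rewrite (der_iter_const dP _ _ (ad_op y _)) (der_iter_pow dP) ad_op_D ?ad_op //.
  rewrite vert_y -mul_opX mulrnAr -mul_opM RE sE -scaler_nat -mul_opZ; congr op.
  by rewrite -scalerAl scalerA mulfV ?fact_neq0 // scale1r mulrC.
have [||g gE] := IHn (a - b).
- by rewrite (linear_sub _ _ (der_iter_linear (derivation_ad _) n)) bn subrr.
- by rewrite (linear_sub _ _ (der_linear (derivation_ad _))) ax ad_x_eval3 subrr.
by exists (g + pterm f n); rewrite eval3D gE subrK.
Qed.

Lemma eval4_surj (a : A) : exists f, eval4 f = a.
Proof.
have [n aN] := ad_nilp a x; elim: n a aN => [|n IHn] a aN.
  exists 0; rewrite [RHS]aN.
  by rewrite /eval4 /poly_eval /poly_sum size_poly0 big_ord0.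
pose R := iter n (ad (op x)) a.
have Rx : ad (op x) R = 0 by [].
have cxF : coprime_to x (y * z) := coprime_toMr (cop_xy X) (cop_xz X).
have cFx : coprime_to (y * z) x.
  exact: coprime_toMl (reg_y X) (cop_yx X) (cop_zx X).
have Rdiv g : divides (x ^+ n) (R g).
  have := iter_ad_divides a n 0 g Q_x (reg_x X) (coprime_toZr cxF).
  by rewrite addn0 expr0 mul1r.
(* The quotient of [R] by [x^n] is again a tangent operator commuting with [x], hence in the image
   of [eval3]; it becomes the coefficient of [E^n], up to [n!]. *)
have [b [RE bx]] := divide_operator Q_x (reg_x X) (coprime_toZl cFx)
  (regularZ reg_F) Rx Rdiv.
have dP := derivation_ad (op x).
have [|f fE] := @eval3_surj ((n`!%:R)^-1 *: b).
  by rewrite -[_ *: b]addr0 (der_linear dP) bx scaler0 (der0 dP) addr0.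
pose b' := eval4 (pterm f n).
have bn : iter n (ad (op x)) b' = R.
  rewrite /b' /eval4 (poly_eval_term _ eval3D).
  rewrite (der_iter_const dP _ _ (ad_x_eval3 f)) (der_iter_pow dP) ad_op_E euler_x ?ad_op //.
  rewrite (mulrnAr) (ad_eq0X _ (ad_x_eval3 f)) fE RE mul_opX -scalerAr.
  by rewrite -scaler_nat scalerA mulfV ?fact_neq0 // scale1r.
have [|g gE] := IHn (a - b').
  by rewrite (linear_sub _ _ (der_iter_linear dP n)) bn subrr.
by exists (g + pterm f n); rewrite eval4D gE subrK.
Qed.

Lemma R4_ind (P : R4 -> Prop) : (forall f g, P f -> P g -> P (f + g)) ->
  (forall c i j p q, P (pterm (pterm (pterm (pterm c i) j) p) q)) -> forall f, P f.
Proof.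
move=> PD Pt; have P0 : P 0 by rewrite -(pterm0 _ 0) -(pterm0 _ 0) -(pterm0 _ 0) -(pterm0 _ 0).
apply: pterm_ind => // f3 q; elim/pterm_ind: f3 => [f g Pf Pg||f2 p].
- by rewrite ptermD; exact: PD.
- by rewrite pterm0.
elim/pterm_ind: f2 => [f g Pf Pg||f1 j].
- by rewrite !ptermD; exact: PD.
- by rewrite !pterm0.
elim/pterm_ind: f1 => [f g Pf Pg||//].
- by rewrite !ptermD; exact: PD.
- by rewrite !pterm0.
Qed.

Lemma eval4_term c i j p q : eval4 (pterm (pterm (pterm (pterm c i) j) p) q) =
  c *: pbw_mon (op x) (op y) op_D op_E i j p q.
Proof.
rewrite /eval4 (poly_eval_term _ eval3D) /eval3 (poly_eval_term _ eval2_opD).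
rewrite /eval2_op /eval2 (poly_eval_term _ eval1D) /eval1 (poly_eval_term _ eval0D).
by rewrite -!scalerAl mul1r mul_opZ mul_opM !mul_opX -!scalerAl.
Qed.

(* In [tens A] the outermost variable is that of [x], in [R4] it is that of [E]. *)
Definition swap1 j p q (f : R1) : tens A := poly_sum (fun i c => term (c%:A) i j p q) f.
Definition swap2 p q (f : R2) : tens A := poly_sum (fun j => swap1 j p q) f.
Definition swap3 q (f : R3) : tens A := poly_sum (fun p => swap2 p q) f.
Definition swap4 (f : R4) : tens A := poly_sum swap3 f.

Let swap0D j p q i : {morph (fun c : k => term (c%:A : A) i j p q) : a b / a + b}.
Proof. by move=> a b; rewrite scalerDl termD. Qed.
Let swap1D j p q : {morph swap1 j p q : f g / f + g}.
Proof. exact: poly_sumD. Qed.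
Let swap2D p q : {morph swap2 p q : f g / f + g}.
Proof. exact: poly_sumD. Qed.
Let swap3D q : {morph swap3 q : f g / f + g}.
Proof. exact: poly_sumD. Qed.
Lemma swap4D : {morph swap4 : f g / f + g}.
Proof. exact: poly_sumD. Qed.
Lemma swap4_term c i j p q :
  swap4 (pterm (pterm (pterm (pterm c i) j) p) q) = term (c%:A) i j p q.
Proof.
rewrite /swap4 (poly_sum_term swap3D) /swap3 (poly_sum_term (fun p => swap2D p q)).
rewrite /swap2 (poly_sum_term (fun j => swap1D j p q)).
by rewrite /swap1 (poly_sum_term (swap0D j p q)).
Qed.

Definition Diff_coord (a : A) : tens A := swap4 (projT1 (cid (eval4_surj a))).

Lemma Diff_coordE f : Diff_coord (eval4 f) = swap4 f.
Proof.
rewrite /Diff_coord; case: cid => g /= gE; congr swap4.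
have D0 : eval4 0 = 0 by rewrite /eval4 /poly_eval /poly_sum size_poly0 big_ord0.
apply/eqP; rewrite -subr_eq0; apply/eqP/eval4_inj.
have := eval4D (g - f) f; rewrite subrK gE => /eqP.
by rewrite eq_sym -subr_eq0 addrK => /eqP.
Qed.

Lemma Diff_coord_linear : linear Diff_coord.
Proof.
have cD a b : Diff_coord (a + b) = Diff_coord a + Diff_coord b.
  have [f <-] := eval4_surj a; have [g <-] := eval4_surj b.
  by rewrite -eval4D !Diff_coordE swap4D.
move=> c a b; rewrite cD; congr (_ + _).
have [f <-] := eval4_surj a; rewrite Diff_coordE; elim/R4_ind: f => [f g Ef Eg|c' i j p q].
  by rewrite eval4D scalerDr cD Ef Eg swap4D scalerDr.
rewrite (eval4_term c' i j p q) scalerA.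
have E0 := eval4_term (c * c') i j p q; rewrite -[X in Diff_coord X]E0.
rewrite Diff_coordE; apply: etrans (swap4_term (c * c') i j p q) _.
apply: etrans (congr1 (GRing.scale c) (esym (swap4_term c' i j p q))).
by rewrite tens_scaleE smul_term -scalerAl mul1r scalerA.
Qed.

Definition Diff_pbw : pbw_algebra A.
Proof.
apply: (@PbwAlgebra k A (op x) (op y) op_D op_E _ _ _ _ _ op_ED _
  Diff_coord Diff_coord_linear).
- by rewrite -!mul_opM (mulrC x).
- by rewrite op_D_op vert_x op0 addr0.
- by rewrite op_D_op vert_y mulrDr mul_opD !mul_opM -(mul_opM _ x) (mulrC x) mul_opM; abel.
- by rewrite op_E_op euler_x.
- by rewrite op_E_op euler_y.
- move=> P P0 PS a; have [f <-] := eval4_surj a; rewrite -[eval4 f]addr0.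
  elim/R4_ind: f (0 : A) P0 => [f g Pf Pg|c i j p q] b Pb.
    by rewrite eval4D -addrA; apply/Pf/Pg.
  by rewrite eval4_term; exact: PS.
- move=> i j p q; have := swap4_term 1 i j p q.
  by rewrite -Diff_coordE eval4_term !scale1r.
Defined.

End Operators.

(** * Coordinates on the plane *)

Section PolynomialFunctions.
Variables (k : fieldType) (V : vectType k).
Hypothesis char0 : [pchar k] =i pred0.
Local Notation S := (polyfun V).
Implicit Types (f g : S) (v w u : V) (l : 'Hom(V, k^o)).

Lemma polyfun_eq f g : (forall v, f v = g v) -> f = g.
Proof. by move=> E; apply: val_inj; exact: funext. Qed.

Lemma polyfun_ind (P : S -> Prop) : (forall c, P c%:A) -> (forall l, P (linform l)) ->
  (forall f g, P f -> P g -> P (f + g)) -> (forall f g, P f -> P g -> P (f * g)) ->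
  forall f, P f.
Proof.
move=> Pc Pl PD PM [f fP].
have /asboolP : `[< is_polyfun f >] := fP.
suff main : forall h, is_polyfun h -> forall hP, P (@Polyfun k V h hP) by move=> /main; apply.
move=> {f fP} h; elim=> {h} [c|l|f g fi IHf gi IHg|f g fi IHf gi IHg] hP.
- by congr P : (Pc c); apply: polyfun_eq => v /=; exact: mulr1.
- by congr P : (Pl l); exact: polyfun_eq.
- have := PD _ _ (IHf (asboolT fi)) (IHg (asboolT gi)); congr P; exact: polyfun_eq.
- have := PM _ _ (IHf (asboolT fi)) (IHg (asboolT gi)); congr P; exact: polyfun_eq.
Qed.

Lemma poly_eq_fun (p q : {poly k}) : (forall t, p.[t] = q.[t]) -> p = q.
Proof.
move=> E; apply/eqP; rewrite -subr_eq0; apply/eqP/(horner_nat_eq0 char0) => n.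
by rewrite hornerD hornerN E subrr.
Qed.

(** Elements of [S] are functions, not formal polynomials; degrees, cancellation and derivatives are
    obtained from their restrictions to lines. *)
Lemma line_poly f v u : exists p : {poly k}, forall t, f (v + t *: u) = p.[t].
Proof.
elim/polyfun_ind: f => [c|l|f g [p pE] [q qE]|f g [p pE] [q qE]].
- by exists c%:P => t; rewrite hornerC; exact: mulr1.
- exists ((l v)%:P + (l u) *: 'X) => t.
  by rewrite hornerD hornerC hornerZ hornerX mulrC; rewrite /= linearD linearZ.
- by exists (p + q) => t; rewrite hornerD -pE -qE.
- by exists (p * q) => t; rewrite hornerM -pE -qE.
Qed.

(** In [k[t]] the product is zero, and the factor of [l] is not, as [l] varies along [u]. *)
Lemma line_cancel f l v u : l u != 0 ->
  (forall t, l (v + t *: u) * f (v + t *: u) = 0) -> f v = 0.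
Proof.
move=> lu E; have [p pE] := line_poly f v u; have [q qE] := line_poly (linform l) v u.
have /eqP : q * p = 0.
  by apply: poly_eq_fun => t; rewrite hornerM -pE -qE horner0 E.
rewrite mulf_eq0 => /orP[] /eqP z0; last by rewrite -[v]addr0 -(scale0r u) pE z0 horner0.
move: (qE 0) (qE 1); rewrite z0 !horner0 /= scale0r addr0 scale1r linearD /= => -> .
by rewrite add0r => /eqP; rewrite (negPf lu).
Qed.

Lemma linform_regular l u : l u != 0 -> regular (linform l).
Proof.
move=> lu f E; apply: polyfun_eq => v; apply: line_cancel lu _ => t.
by have := congr1 (fun g : S => g (v + t *: u)) E.
Qed.

(** [pr] projects onto the kernel of [l] along [u]. The difference of [f] and [f (pr v)] is
    divisible by [l] for every [f], by induction, and here [f (pr v) = 0]. *)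
Lemma linform_divides l u f : l u != 0 -> (forall v, l v = 0 -> f v = 0) ->
  divides (linform l) f.
Proof.
move=> lu f0; pose pr v := v - (l v / l u) *: u.
have lpr v : l (pr v) = 0.
  by rewrite /pr linearB linearZ /= [X in _ - X]divfK // subrr.
have main g : exists h : S, forall v, g v - g (pr v) = l v * h v.
  elim/polyfun_ind: g => [c|l'|g1 g2 [h1 E1] [h2 E2]|g1 g2 [h1 E1] [h2 E2]].
  - by exists 0 => v; rewrite mulr0 subrr.
  - pose c : k := l' u / l u; exists (c%:A : S) => v.
    rewrite /pr /= linearB linearZ /= opprB addrC subrK.
    rewrite -[RHS]/(l v * (l' u / l u * 1)) /= -[LHS]/(l v / l u * l' u).
    by rewrite mulr1 mulrAC -mulrA.
  - exists (h1 + h2) => v; rewrite -[RHS]/(l v * (h1 v + h2 v)) mulrDr -E1 -E2.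
    rewrite -[LHS]/(g1 v + g2 v - (g1 (pr v) + g2 (pr v))); abel.
  (* [g1 - linform l * h1] is the function [g1 (pr v)], which appears when the difference of the
     products is telescoped. *)
  - exists (h1 * g2 + (h2 * (g1 - linform l * h1))) => v.
    have prE (g0 h0 : S) : g0 v - g0 (pr v) = l v * h0 v -> g0 (pr v) = g0 v - l v * h0 v.
      by move=> <-; rewrite opprB addrC subrK.
    rewrite -[LHS]/(g1 v * g2 v - (g1 (pr v) * g2 (pr v))) (prE _ _ (E1 v)) (prE _ _ (E2 v)).
    rewrite -[RHS]/(l v * (h1 v * g2 v + h2 v * (g1 v - l v * h1 v))).
    ring.
have [h hE] := main f; exists h; apply: polyfun_eq => v.
by apply: etrans (hE v); rewrite (f0 _ (lpr v)) subr0.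
Qed.

(** From a zero of [l], the line in direction [u] stays in the kernel of [l]; there [l' f] vanishes,
    and [l'] can be cancelled. *)
Lemma linform_coprime l l' u : l u = 0 -> l' u != 0 ->
  (exists w, l w != 0) -> coprime_to (linform l) (linform l').
Proof.
move=> lu l'u [w lw] f [g gE]; apply: linform_divides lw _ => v lv.
apply: (line_cancel l'u) => t.
apply: etrans (congr1 (fun g0 : S => g0 (v + t *: u)) gE) _.
by rewrite -[LHS]/(l (v + t *: u) * g (v + t *: u)) linearD linearZ /= lv lu scaler0 addr0 mul0r.
Qed.

Lemma direction_exists u f : exists g, forall v, exists p : {poly k},
  (forall t, f (v + t *: u) = p.[t]) /\ g v = p^`().[0].
Proof.
elim/polyfun_ind: f => [c|l|f1 f2 [g1 E1] [g2 E2]|f1 f2 [g1 E1] [g2 E2]].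
- exists 0 => v; exists c%:P; split=> [t|]; first by rewrite hornerC; exact: mulr1.
  by rewrite derivC horner0.
- exists ((l u : k)%:A : S) => v; exists ((l v)%:P + (l u) *: 'X); split=> [t|].
    by rewrite hornerD hornerC hornerZ hornerX mulrC; rewrite /= linearD linearZ.
  by rewrite derivD derivC derivZ derivX !hornerE; exact: mulr1.
- exists (g1 + g2) => v; have [p [pE gp]] := E1 v; have [q [qE gq]] := E2 v.
  exists (p + q); split=> [t|]; first by rewrite hornerD -pE -qE.
  by rewrite derivD hornerD -gp -gq.
- exists (g1 * f2 + f1 * g2) => v.
  have [p [pE gp]] := E1 v; have [q [qE gq]] := E2 v.
  exists (p * q); split=> [t|]; first by rewrite hornerM -pE -qE.
  by rewrite derivM hornerD !hornerM -gp -gq -pE -qE scale0r addr0.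
Qed.

(** The directional derivative along [u], computed by [directionE] from any polynomial representing
    the restriction to the line. *)
Definition direction u f : S := projT1 (cid (direction_exists u f)).

Lemma directionE u f v p : (forall t, f (v + t *: u) = p.[t]) ->
  direction u f v = p^`().[0].
Proof.
move=> pE; rewrite /direction; case: cid => g /= /(_ v)[q [qE ->]].
by rewrite (poly_eq_fun (p := p) (q := q)) // => t; rewrite -pE -qE.
Qed.

Lemma direction_derivation u : derivation (direction u).
Proof.
split=> [c f g|f g]; apply: polyfun_eq => v;
  have [p pE] := line_poly f v u; have [q qE] := line_poly g v u.
  rewrite (directionE (p := c *: p + q)) => [|t].
    by rewrite derivD derivZ hornerD hornerZ -(directionE pE) -(directionE qE).
  by rewrite hornerD hornerZ -pE -qE.
rewrite (directionE (p := p * q)) => [|t]; last by rewrite hornerM -pE -qE.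
rewrite derivM hornerD !hornerM -(directionE pE) -(directionE qE) -pE -qE.
by rewrite scale0r addr0.
Qed.

Lemma direction_linform u l : direction u (linform l) = (l u : k)%:A.
Proof.
apply: polyfun_eq => v; rewrite (directionE (p := (l v)%:P + (l u) *: 'X)) => [|t].
  by rewrite derivD derivC derivZ derivX !hornerE; exact: esym (mulr1 _).
by rewrite hornerD hornerC hornerZ hornerX mulrC; rewrite /= linearD linearZ.
Qed.

Lemma polyfun_span l l' u u' : (forall v, v = l v *: u + l' v *: u') ->
  forall P : S -> Prop,
  (forall c i j, P (c *: (linform l ^+ i * linform l' ^+ j))) ->
  (forall f g, P f -> P g -> P (f + g)) -> forall f, P f.
Proof.
move=> vE P Pm PD f.
(* The span is expressed as membership in every such [P], which allows an induction on each factor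
   of a product. *)
pose span g := forall P : S -> Prop,
  (forall c i j, P (c *: (linform l ^+ i * linform l' ^+ j))) ->
  (forall f g, P f -> P g -> P (f + g)) -> P g.
have spanD g h : span g -> span h -> span (g + h).
  by move=> sg sh P' Pm' PD'; exact: PD' (sg P' Pm' PD') (sh P' Pm' PD').
have spanM g h : span g -> span h -> span (g * h).
  move=> sg; apply: (sg (fun g0 => span h -> span (g0 * h))) => [c i j|g1 g2 IH1 IH2 sh].
    move=> sh; apply: (sh (fun h0 => span (_ * h0))) => [c' i' j' P' Pm' _|h1 h2 s1 s2].
      rewrite -scalerAl -scalerAr scalerA mulrACA -!exprD; exact: Pm'.
    by rewrite mulrDr; exact: spanD.
  by rewrite mulrDl; exact: spanD (IH1 sh) (IH2 sh).
suff sf : span f by exact: sf.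
elim/polyfun_ind: f => // [c|m].
  by move=> P' Pm' _; have := Pm' c 0%N 0%N; rewrite !expr0 mulr1.
have -> : linform m = (m u : k) *: linform l + (m u' : k) *: linform l'.
  apply: polyfun_eq => v; rewrite -[LHS]/(m v) {1}[v]vE linearD !linearZ.
  by congr (_ + _); exact: mulrC.
apply: spanD => P' Pm' _.
  by have := Pm' (m u) 1%N 0%N; rewrite expr1 expr0 mulr1.
by have := Pm' (m u') 0%N 1%N; rewrite expr1 expr0 mul1r.
Qed.

Lemma dual_basis l l' u u' : l u = 1 -> l u' = 0 -> l' u = 0 -> l' u' = 1 ->
  (forall v, l v = 0 -> l' v = 0 -> v = 0) -> forall v, v = l v *: u + l' v *: u'.
Proof.
move=> lu lu' l'u l'u' inj v.
apply/eqP; rewrite -subr_eq0; apply/eqP; apply: inj;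
  rewrite linearB linearD !linearZ /= ?lu ?lu' ?l'u ?l'u' /GRing.scale /=.
  by rewrite mulr1 mulr0 addr0 subrr.
by rewrite mulr1 mulr0 add0r subrr.
Qed.

Lemma polyfun_coordinates l l' u u' : l u = 1 -> l u' = 0 -> l' u = 0 -> l' u' = 1 ->
  (forall v, l v = 0 -> l' v = 0 -> v = 0) ->
  coordinates (linform l) (linform l').
Proof.
move=> lu lu' l'u l'u' inj.
have nz : (1 : k) != 0 by exact: oner_neq0.
have lzE : linform l + linform l' = linform (l + l').
  by apply: polyfun_eq => v; rewrite /= add_lfunE.
have zE v : (l + l') v = l v + l' v by rewrite add_lfunE.
have vE := dual_basis lu lu' l'u l'u' inj.
have du := direction_derivation u; have du' := direction_derivation u'.
apply: (Coordinates du du').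
- by rewrite direction_linform lu scale1r.
- by rewrite direction_linform l'u scale0r.
- by rewrite direction_linform lu' scale0r.
- by rewrite direction_linform l'u' scale1r.
- exact: (polyfun_span vE).
- by apply: (linform_regular (u := u)); rewrite lu.
- by apply: (linform_regular (u := u')); rewrite l'u'.
- by rewrite lzE; apply: (linform_regular (u := u)); rewrite zE lu l'u addr0.
- by apply: (linform_coprime (u := u')); rewrite ?l'u' //; exists u; rewrite lu.
- rewrite lzE; apply: (linform_coprime (u := u')); rewrite ?zE ?lu' ?l'u' ?add0r //.
  by exists u; rewrite lu.
- by apply: (linform_coprime (u := u)); rewrite ?lu //; exists u'; rewrite l'u'.
(* [u - u'] spans the kernel of the sum of the two forms. *)
- rewrite lzE; apply: (linform_coprime (u := u)); rewrite ?zE ?lu ?l'u ?addr0 //.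
  by exists u'; rewrite l'u'.
- rewrite lzE; apply: (linform_coprime (u := u - u')).
  + by rewrite zE !linearB /= lu lu' l'u l'u' subr0 sub0r subrr.
  + by rewrite linearB /= lu lu' subr0.
  + by exists u; rewrite zE lu l'u addr0.
- rewrite lzE; apply: (linform_coprime (u := u' - u)).
  + by rewrite zE !linearB /= lu lu' l'u l'u' subr0 sub0r addNr.
  + by rewrite linearB /= l'u l'u' subr0.
  + by exists u; rewrite zE lu l'u addr0.
Qed.

End PolynomialFunctions.

(** * Normal form of three lines *)

Section ThreeLines.
Variables (k : fieldType) (V : vectType k).
Variables (H : 'I_3 -> {vspace V}) (dimH : forall i, \dim (H i) = 1%N).
Hypothesis H_inj : injective H.
Variables (lam : 'I_3 -> 'Hom(V, k^o)) (ker_lam : forall i, lker (lam i) = H i).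
Implicit Types (i j : 'I_3) (v : V).

Lemma lam_eq0 i v : (lam i v == 0) = (v \in H i).
Proof. by rewrite -ker_lam memv_ker. Qed.

Lemma line_inj i j v : v \in H i -> v \in H j -> v != 0 -> i = j.
Proof.
move=> vi vj nz; apply: H_inj; apply: (eq_trans (y := <[v]>%VS)).
  by apply/esym/eqP; rewrite eqEdim -memvE vi dimH dim_vline nz.
by apply/eqP; rewrite eqEdim -memvE vj dimH dim_vline nz.
Qed.

Lemma lines_coordinates : exists (x y : 'Hom(V, k^o)) (u u' : V) (c : k),
  [/\ x u = 1, x u' = 0, y u = 0 & y u' = 1] /\
  [/\ forall v, x v = 0 -> y v = 0 -> v = 0, c != 0 &
    \prod_(i < 3) linform (lam i) =
      c *: (linform x * (linform y * (linform x + linform y)))].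
Proof.
pose i0 : 'I_3 := ord0; pose i1 : 'I_3 := inord 1; pose i2 : 'I_3 := inord 2.
have ne01 : i0 != i1 by rewrite -val_eqE /= inordK.
have ne02 : i0 != i2 by rewrite -val_eqE /= inordK.
have ne12 : i1 != i2 by rewrite -val_eqE /= !inordK.
pose v i := vpick (H i).
have vH i : v i \in H i by exact: memv_pick.
have vn0 i : v i != 0 by rewrite vpick0 -dimv_eq0 dimH.
have lam0 i : lam i (v i) = 0 by apply/eqP; rewrite lam_eq0.
have lamn0 i j : i != j -> lam i (v j) != 0.
  by move=> ne; rewrite lam_eq0; apply: contra ne => /line_inj E; apply/eqP/(E j).
(* With this scaling [x] and [y] take the values 1 and -1 on a generator of the third line, so that
   [lam i2] is a multiple of [x + y]. *)
pose a : k := lam i0 (v i2); pose b : k := - (lam i1 (v i2) : k).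
have a0 : a != 0 by exact: lamn0.
have b0 : b != 0 by rewrite oppr_eq0; apply: lamn0.
pose x := a^-1 *: lam i0; pose y := b^-1 *: lam i1.
have xE w : x w = a^-1 * lam i0 w :> k by rewrite scale_lfunE.
have yE w : y w = b^-1 * lam i1 w :> k by rewrite scale_lfunE.
have x1 : x (v i1) != 0 by rewrite xE mulf_neq0 ?invr_eq0 // lamn0.
have y0 : y (v i0) != 0 by rewrite yE mulf_neq0 ?invr_eq0 // lamn0 // eq_sym.
pose u := (x (v i1))^-1 *: v i1; pose u' := (y (v i0))^-1 *: v i0.
have xu : x u = 1 by rewrite linearZ /=; exact: mulVf.
have yu' : y u' = 1 by rewrite linearZ /=; exact: mulVf.
have xu' : x u' = 0 by rewrite linearZ /= xE lam0 mulr0 scaler0.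
have yu : y u = 0 by rewrite linearZ /= yE lam0 mulr0 scaler0.
have inj w : x w = 0 -> y w = 0 -> w = 0.
  move=> xw yw; apply/eqP/negPn/negP => wn0.
  suff E : i0 = i1 by rewrite E eqxx in ne01.
  apply: (@line_inj _ _ w) => //; rewrite -lam_eq0.
    by have /eqP := xw; rewrite xE mulf_eq0 invr_eq0 (negPf a0).
  by have /eqP := yw; rewrite yE mulf_eq0 invr_eq0 (negPf b0).
have wE := dual_basis xu xu' yu yu' inj.
have v2E : v i2 = u - u'.
  have x2 : x (v i2) = 1 by rewrite xE; exact: mulVf.
  have y2 : y (v i2) = - 1 by rewrite yE -[lam i1 _]opprK mulrN -/b mulVf.
  by rewrite [LHS]wE x2 y2 scale1r scaleN1r.
pose s : k := lam i2 u.
have sE w : lam i2 w = s * (x w + y w) :> k.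
  have : lam i2 u' = s.
    by have /eqP := lam0 i2; rewrite v2E linearB subr_eq0 => /eqP.
  have -> : lam i2 w = (x w : k) * s + (y w : k) * lam i2 u' :> k.
    by rewrite {1}[w]wE linearD; congr (_ + _); exact: linearZ.
  by move=> ->; rewrite -mulrDl mulrC.
have s0 : s != 0.
  apply/eqP => s0; have := lamn0 i2 i0; rewrite eq_sym => /(_ ne02).
  by rewrite sE s0 mul0r eqxx.
exists x, y, u, u', (a * b * s); split=> //; split=> //.
  by rewrite !mulf_neq0.
have l0 : linform (lam i0) = a *: linform x.
  apply: polyfun_eq => w; rewrite -[RHS]/(a * x w) xE mulrA mulfV // mul1r.
  by [].
have l1 : linform (lam i1) = b *: linform y.
  apply: polyfun_eq => w; rewrite -[RHS]/(b * y w) yE mulrA mulfV // mul1r.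
  by [].
have l2 : linform (lam i2) = s *: (linform x + linform y).
  by apply: polyfun_eq => w; exact: sE.
rewrite !big_ord_recl big_ord0 mulr1.
have -> : lift ord0 ord0 = i1 by apply: val_inj; rewrite /= inordK.
have -> : lift ord0 (lift ord0 ord0) = i2 by apply: val_inj; rewrite /= inordK.
rewrite -/i0 l0 l1 l2 -!scalerAl -!scalerAr !scalerA; congr (_ *: _).
by rewrite -mulrA.
Qed.

Lemma Diff_lines_pbw (char0 : [pchar k] =i pred0) :
  inhabited (pbw_algebra (Diff (\prod_(i < 3) linform (lam i)))).
Proof.
have [x [y [u [u' [c [[xu xu' yu yu'] [inj c0 QE]]]]]]] := lines_coordinates.
have X := polyfun_coordinates char0 xu xu' yu yu' inj.
exact: inhabits (Diff_pbw char0 c0 X QE).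
Qed.

End ThreeLines.

Theorem theorem1 (k : fieldType) (char0 : [pchar k] =i pred0)
    (V : vectType k) (dimV : \dim {:V} = 2%N)
    (H : 'I_3 -> {vspace V}) (dimH : forall i, \dim (H i) = 1%N)
    (H_inj : injective H)
    (lam : 'I_3 -> 'Hom(V, k^o)) (ker_lam : forall i, lker (lam i) = H i) :
  let A : algType k := Diff (\prod_(i < 3) linform (lam i)) in
  HH_hilbert_series A (1 + 3 *: 'X + 6 *: 'X^2 + 4 *: 'X^3) /\
  (HH1_Lie_dim A 3 /\ HH1_Lie_abelian A).
Proof.
move=> A; have [P] := Diff_lines_pbw dimH H_inj ker_lam char0.
split; last by split; [exact: (HH1_dim_pbw P) | exact: HH1_abelian_pbw P char0].
move=> n; have := HH_dim_pbw P char0 n; congr HH_dim.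
(* The coefficients are the sums [dim0 n.+1 + dim0 n]: 1 + 0, 2 + 1, 4 + 2, 0 + 4. *)
rewrite !coefD !coefZ coefX !coefXn coef1.
by case: n => [|[|[|[|n]]]].
Qed.
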